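(* Let $f$ be a semiregular function on $B = B(0,R)$, choose $p \in B$ and let $m = ord_f(p)$, $n = ord_f(\bar p)$. There exists a unique semiregular function $g$ on $B$ such that $$f(q) = [(q-p)^{*m}*(q-\bar p)^{*n}]^{-*}* g(q).$$ The function $g$ is regular near $p$ and $\bar p$, and $g(p) \neq 0$, $g(\bar p) \neq 0$, provided $m>0$ or $n>0$.
   Context: $\mathbb{H}$ is the skew field of real quaternions, $\mathbb{S} = \{q \in \mathbb{H} : q^2=-1\}$, $L_I = \mathbb{R} + I\mathbb{R}$ for $I\in\mathbb{S}$, $B(0,R)=\{q\in\mathbb{H}:|q|<R\}$ with $0<R\le\infty$; $\bar p$ is the quaternionic conjugate of $p$. For a domain $\Omega\subseteq\mathbb{H}$ set $\Omega_I=\Omega\cap L_I$ and, for $f:\Omega\to\mathbb{H}$, $f_I=f|_{\Omega_I}$. A real differentiable $f:\Omega\to\mathbb{H}$ is regular if for every $I\in\mathbb{S}$ the function $\frac12\left(\frac{\partial}{\partial x}+I\frac{\partial}{\partial y}\right)f_I(x+Iy)$ vanishes identically on $\Omega_I$. Regular functions on $B(0,R)$ are exactly the sums of power series $\sum_{n\ge0}q^na_n$, $a_n\in\mathbb{H}$, converging in $B(0,R)$. Poles: if a regular $f$ is defined on an annulus $\{z\in L_I: R_1<|z-p|<R_2\}$ in a complex line $L_I$ through $p$ (for an isolated singularity in $L_I$, or a point of regularity, $R_1=0$), write $f_I(z)=\sum_{n\in\mathbb{Z}}(z-p)^na_n$ there, $a_n\in\mathbb{H}$ (for real $p$ the $a_n$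 do not depend on $I$). The point $p$ is a pole if there is $n\in\mathbb{N}$ (possibly $0$) with $a_{-m}=0$ for all $m>n$; the minimum such $n$ is its (classical) order $ord_f(p)$. Otherwise $p$ is an essential singularity. Semiregular: let $\mathcal{S}\subseteq\Omega$ be such that $\mathcal{S}\cap L_I$ is a discrete subset of $\Omega_I$ for all $I\in\mathbb{S}$; a regular function $f:\Omega\setminus\mathcal{S}\to\mathbb{H}$ is semiregular on $\Omega$ if $\mathcal{S}$ contains no essential singularities for $f$. Regular operations: for $f=\sum q^na_n$, $g=\sum q^nb_n$ regular on a ball, $f*g(q)=\sum_n q^n\sum_{k=0}^na_kb_{n-k}$, $f^c(q)=\sum_n q^n\bar a_n$, $f^s=f*f^c=f^c*f$, $f^{-s}(q)=1/f^s(q)$, $f^{*n}=f*\cdots*f$ ($n$ times). For $f\not\equiv0$, the left regular quotient is $f^{-*}*g(q)=\frac{1}{f^s(q)}\,f^c*g(q)$, defined off the zeros of $f^s$, and $f^{-*}=f^{-*}*1$. Left regular quotients on a ball are multiplied by $(f^{-*}*g)*(h^{-*}*k)=f^{-s}h^{-s}f^c*g*h^c*k$. A semiregular function on $B(0,R_0)$ restricts to a left regular quotient of regular functions on every $B(0,R)$ with $0<R<R_0$; the product $f*g$ of semiregular functions on $B(0,R_0)$ is the semiregular function whose restriction to each such $B(0,R)$ is the product of the restrictions. Equality of semiregular functions means equality at the points where both sides are defined.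
   Formalization: The last claim is false as printed (f=1/q, p=0 gives g(q)=q; f=(q-p̄)^{-*}*(q-p) gives m=0, n=1, g(p)=0). It is stated for non-real p only and read respectively: g(p)≠0 if m>0, and g(p̄)≠0 if n>0. *)

(* Defs.v *)
From HB Require Import structures.
From mathcomp Require Import all_boot all_order all_algebra.
From mathcomp Require Import ring lra.
From mathcomp Require Import all_classical all_reals all_analysis.

Set Implicit Arguments.
Unset Strict Implicit.
Unset Printing Implicit Defensive.

Import Order.TTheory GRing.Theory Num.Theory.
Import numFieldNormedType.Exports.

Local Open Scope classical_set_scope.
Local Open Scope ring_scope.

Record quat (R : realType) := Quat { qre : R; qi : R; qj : R; qk : R }.

Section QuatAlgebra.
Context {R : realType}.
Implicit Types p q : quat R.

Definition quat_tuple q : R * R * R * R := (qre q, qi q, qj q, qk q).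
Definition tuple_quat (t : R * R * R * R) : quat R :=
  Quat t.1.1.1 t.1.1.2 t.1.2 t.2.

Lemma quat_tupleK : cancel quat_tuple tuple_quat.
Proof. by case. Qed.

HB.instance Definition _ := Choice.copy (quat R) (can_type quat_tupleK).

Lemma quatP p q :
  [/\ qre p = qre q, qi p = qi q, qj p = qj q & qk p = qk q] -> p = q.
Proof. by case: p q => [a b c d] [a' b' c' d'] /= [-> -> -> ->]. Qed.

Definition qzero : quat R := Quat 0 0 0 0.
Definition qopp q := Quat (- qre q) (- qi q) (- qj q) (- qk q).
Definition qadd p q :=
  Quat (qre p + qre q) (qi p + qi q) (qj p + qj q) (qk p + qk q).

Fact qaddA : associative qadd.
Proof. by move=> x y z; apply: quatP; split; rewrite /= addrA. Qed.
Fact qaddC : commutative qadd.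
Proof. by move=> x y; apply: quatP; split; rewrite /= addrC. Qed.
Fact qadd0 : left_id qzero qadd.
Proof. by move=> x; apply: quatP; split; rewrite /= add0r. Qed.
Fact qaddN : left_inverse qzero qopp qadd.
Proof. by move=> x; apply: quatP; split; rewrite /= addNr. Qed.

HB.instance Definition _ :=
  GRing.isZmodule.Build (quat R) qaddA qaddC qadd0 qaddN.

Definition qone : quat R := Quat 1 0 0 0.
Definition qmul p q := Quat
  (qre p * qre q - qi p * qi q - qj p * qj q - qk p * qk q)
  (qre p * qi q + qi p * qre q + qj p * qk q - qk p * qj q)
  (qre p * qj q - qi p * qk q + qj p * qre q + qk p * qi q)
  (qre p * qk q + qi p * qj q - qj p * qi q + qk p * qre q).

Fact qmulA : associative qmul.
Proof. by move=> x y z; apply: quatP; split; rewrite /=; ring. Qed.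
Fact qmul1q : left_id qone qmul.
Proof. by move=> x; apply: quatP; split; rewrite /=; ring. Qed.
Fact qmulq1 : right_id qone qmul.
Proof. by move=> x; apply: quatP; split; rewrite /=; ring. Qed.
Fact qmulDl : left_distributive qmul +%R.
Proof. by move=> x y z; apply: quatP; split; rewrite /=; ring. Qed.
Fact qmulDr : right_distributive qmul +%R.
Proof. by move=> x y z; apply: quatP; split; rewrite /=; ring. Qed.
Fact qone_neq0 : qone != 0.
Proof. by apply/eqP => -[] /eqP; rewrite oner_eq0. Qed.

HB.instance Definition _ := GRing.Zmodule_isNzRing.Build (quat R)
  qmulA qmul1q qmulq1 qmulDl qmulDr qone_neq0.

Definition qscale (a : R) q := Quat (a * qre q) (a * qi q) (a * qj q) (a * qk q).

Fact qscaleA a b q : qscale a (qscale b q) = qscale (a * b) q.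
Proof. by apply: quatP; split; rewrite /= mulrA. Qed.
Fact qscale1 : left_id 1 qscale.
Proof. by move=> q; apply: quatP; split; rewrite /= mul1r. Qed.
Fact qscaleDr : right_distributive qscale +%R.
Proof. by move=> a p q; apply: quatP; split; rewrite /= mulrDr. Qed.
Fact qscaleDl q : {morph qscale^~ q : a b / a + b}.
Proof. by move=> a b; apply: quatP; split; rewrite /= mulrDl. Qed.

HB.instance Definition _ := GRing.Zmodule_isLmodule.Build R (quat R)
  qscaleA qscale1 qscaleDr qscaleDl.

Fact qscaleAl (a : R) p q : a *: (p * q) = (a *: p) * q.
Proof. by apply: quatP; split; rewrite /=; ring. Qed.
Fact qscaleAr (a : R) p q : a *: (p * q) = p * (a *: q).
Proof. by apply: quatP; split; rewrite /=; ring. Qed.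

HB.instance Definition _ := GRing.Lmodule_isLalgebra.Build R (quat R) qscaleAl.
HB.instance Definition _ := GRing.Lalgebra_isAlgebra.Build R (quat R) qscaleAr.

Definition qconj q := Quat (qre q) (- qi q) (- qj q) (- qk q).
Definition qnormsq q : R := qre q ^+ 2 + qi q ^+ 2 + qj q ^+ 2 + qk q ^+ 2.
Definition qinv q := (qnormsq q)^-1 *: qconj q.

Lemma qnormsq_ge0 q : 0 <= qnormsq q.
Proof. by rewrite /qnormsq !addr_ge0 ?sqr_ge0. Qed.

Lemma qnormsq_eq0 q : (qnormsq q == 0) = (q == 0).
Proof.
apply/eqP/eqP => [|->]; last by rewrite /qnormsq /= expr0n /= !addr0.
move=> /eqP; rewrite /qnormsq !paddr_eq0 ?addr_ge0 ?sqr_ge0// !sqrf_eq0.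
by move=> /andP[/andP[/andP[/eqP a /eqP b] /eqP c] /eqP d]; apply: quatP.
Qed.

Fact qmulVq : {in [pred q : quat R | q != 0], left_inverse 1 qinv *%R}.
Proof.
move=> q; rewrite inE -qnormsq_eq0 => q0.
by apply: quatP; split; rewrite /=; rewrite /qnormsq in q0 *; field.
Qed.
Fact qmulqV : {in [pred q : quat R | q != 0], right_inverse 1 qinv *%R}.
Proof.
move=> q; rewrite inE -qnormsq_eq0 => q0.
by apply: quatP; split; rewrite /=; rewrite /qnormsq in q0 *; field.
Qed.
Fact qunitP p q : q * p = 1 /\ p * q = 1 -> [pred q : quat R | q != 0] p.
Proof.
move=> [qp _] /=; apply/eqP => p0; move: qp.
by rewrite p0 mulr0 => /esym/eqP; rewrite oner_eq0.
Qed.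
Fact qinv_out : {in [predC [pred q : quat R | q != 0]], qinv =1 id}.
Proof.
by move=> q; rewrite !inE negbK => /eqP ->; apply: quatP; split;
  rewrite /= ?oppr0 mulr0.
Qed.

HB.instance Definition _ := GRing.NzRing_hasMulInverse.Build (quat R)
  qmulVq qmulqV qunitP qinv_out.

Definition qnorm q : R := Num.sqrt (qnormsq q).

Lemma qnormD p q : qnorm (p + q) <= qnorm p + qnorm q.
Proof.
have np : 0 <= qnorm p by exact: sqrtr_ge0.
have nq : 0 <= qnorm q by exact: sqrtr_ge0.
rewrite -(@ler_pXn2r _ 2) ?nnegrE ?addr_ge0 ?sqrtr_ge0//.
rewrite sqrrD !sqr_sqrtr ?qnormsq_ge0//.
suff : qre p * qre q + qi p * qi q + qj p * qj q + qk p * qk q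
       <= qnorm p * qnorm q.
  move=> h; rewrite -subr_ge0 /qnormsq /= mulr2n; rewrite -subr_ge0 in h.
  set t := _ - _ in h; have := addr_ge0 h h; rewrite /t.
  set u := qnorm p * qnorm q; move=> {}h.
  by apply: le_trans h _; rewrite le_eqVlt; apply/orP; left; apply/eqP; ring.
rewrite /qnorm -sqrtrM ?qnormsq_ge0//.
apply: le_trans (ler_norm _) _; rewrite -sqrtr_sqr ler_sqrt; last first.
  by rewrite mulr_ge0 ?qnormsq_ge0.
rewrite -subr_ge0 /qnormsq.
rewrite [X in 0 <= X](_ : _ =
  (qre p * qi q - qi p * qre q) ^+ 2 + (qre p * qj q - qj p * qre q) ^+ 2 +
  (qre p * qk q - qk p * qre q) ^+ 2 + (qi p * qj q - qj p * qi q) ^+ 2 +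
  (qi p * qk q - qk p * qi q) ^+ 2 + (qj p * qk q - qk p * qj q) ^+ 2);
  last by ring.
by rewrite !addr_ge0 ?sqr_ge0.
Qed.

Lemma qnormZ (a : R) q : qnorm (a *: q) = `|a| * qnorm q.
Proof.
rewrite /qnorm -sqrtr_sqr -sqrtrM ?sqr_ge0//; congr Num.sqrt.
by rewrite /qnormsq /=; ring.
Qed.

Lemma qnorm0_eq0 q : qnorm q = 0 -> q = 0.
Proof.
move/eqP; rewrite sqrtr_eq0 => h; apply/eqP; rewrite -qnormsq_eq0.
by rewrite eq_le h qnormsq_ge0.
Qed.

(* [`|q|] is the Euclidean norm; it induces the topology of [quat R]. *)
HB.instance Definition _ :=
  Lmodule_isNormed.Build R (quat R) qnormD qnormZ qnorm0_eq0.

End QuatAlgebra.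

Section Semiregular.
Context {R : realType}.
Local Notation H := (quat R).
Implicit Types (p q z I : H) (D : set H) (rho : \bar R).

Definition imag_units : set H := [set I | I ^+ 2 = -1].

Definition slice I (x y : R) : H := x%:A + I * y%:A.
Definition cplane I : set H := [set q | exists x y, q = slice I x y].

(* [rho] may be [+oo], in which case this is the whole space. *)
Definition qball rho : set H := [set q | (`|q|%:E < rho)%E].

Definition dbar (f : H -> H) I (x y : R) : H :=
  2^-1 *: (derive1 (fun s : R => f (slice I s y)) x
           + I * derive1 (fun t : R => f (slice I x t)) y).

Definition regular D (f : H -> H) := [/\ open D,
  (forall q, D q -> differentiable f q) &
  (forall I x y, imag_units I -> D (slice I x y) -> dbar f I x y = 0)].

(* A function defined on [dom f]; its values elsewhere are irrelevant. *)
Record qfun := QFun { dom : set H; qval :> H -> H }.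

Definition qfun_eq (f g : qfun) := forall q, dom f q -> dom g q -> f q = g q.

Definition regular_near (f : qfun) p :=
  exists U : set H, [/\ U p, U `<=` dom f & regular U f].

(* [f] is defined on a punctured disc around [p] in [cplane I], and there it is
   the sum of the bilateral series of general term [(z - p) ^ n * a n]. *)
Definition laurent (f : qfun) p I (a : int -> H) := cplane I p /\
  exists2 r : R, 0 < r & forall z, cplane I z -> 0 < `|z - p| < r ->
    dom f z /\ exists u v : H,
      [/\ series (fun k : nat => (z - p) ^ k%:Z * a k%:Z) @ \oo --> u,
          series (fun k : nat => (z - p) ^ (- k.+1%:Z) * a (- k.+1%:Z))
            @ \oo --> v
        & f z = u + v].

Definition vanishes_below (a : int -> H) (n : nat) :=
  forall m : nat, (n < m)%N -> a (- m%:Z) = 0.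

Definition pole (f : qfun) p := exists I a,
  [/\ imag_units I, laurent f p I a & exists n, vanishes_below a n].

Definition is_ord (f : qfun) p (n : nat) := exists I a,
  [/\ imag_units I, laurent f p I a, vanishes_below a n &
      forall k, vanishes_below a k -> (n <= k)%N].

(* The default value [0] is only taken at essential singularities. *)
Definition ord (f : qfun) p : nat := xget 0%N [set n | is_ord f p n].

(* The exceptional set is [Omega `\` dom f]. *)
Definition semiregular (Omega : set H) (f : qfun) := [/\ dom f `<=` Omega,
  regular (dom f) f,
  (forall I, imag_units I -> let S := (Omega `\` dom f) `&` cplane I in
     S `<=` isolated S) &
  (forall p, (Omega `\` dom f) p -> pole f p)].

(* A regular function on a ball centred at [0] is given by the coefficients [a]
   of its power series, which are on the right. *)
Definition pterm (a : nat -> H) q : nat -> H := fun n => q ^+ n * a n.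
Definition psum (a : nat -> H) q : H := lim (series (pterm a q) @ \oo).
Definition converges rho (a : nat -> H) :=
  forall q, qball rho q -> cvgn (series (pterm a q)).
Definition nonzero rho (a : nat -> H) := exists2 q, qball rho q & psum a q != 0.

Definition star (a b : nat -> H) : nat -> H :=
  fun n => \sum_(k < n.+1) a k * b (n - k)%N.
Definition star1 : nat -> H := fun n => if n is 0%N then 1 else 0.
Definition starpow (a : nat -> H) (n : nat) : nat -> H := iter n (star a) star1.
Definition conjc (a : nat -> H) : nat -> H := fun n => qconj (a n).
Definition sym (a : nat -> H) : nat -> H := star a (conjc a).

(* The polynomial [q - p]. *)
Definition lin p : nat -> H :=
  fun n => match n with 0%N => - p | 1%N => 1 | _ => 0 end.

(* [a^-* * b = (a^s)^-1 (a^c * b)] on [qball rho]. *)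
Definition lquot rho (a b : nat -> H) : qfun := QFun
  [set q | qball rho q /\ psum (sym a) q != 0]
  (fun q => (psum (sym a) q)^-1 * psum (star (conjc a) b) q).

(* [(a^-* * b) * (c^-* * d) = (a^s)^-1 (c^s)^-1 (a^c * b * c^c * d)], where the
   inverses are pointwise. *)
Definition lquot_mul rho (a b c d : nat -> H) : qfun := QFun
  [set q | [/\ qball rho q, psum (sym a) q != 0 & psum (sym c) q != 0]]
  (fun q => (psum (sym a) q)^-1 * (psum (sym c) q)^-1 *
            psum (star (star (star (conjc a) b) (conjc c)) d) q).

(* [h] is the regular product [f * g] of semiregular functions on [qball rho]:
   on every smaller ball it is the product of the left regular quotients which
   [f] and [g] restrict to. *)
Definition is_star_prod rho (f g h : qfun) := semiregular (qball rho) h /\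
  forall r : R, 0 < r -> (r%:E < rho)%E -> exists a b c d : nat -> H,
    [/\ [/\ converges r%:E a, converges r%:E b,
            converges r%:E c & converges r%:E d],
        nonzero r%:E a /\ nonzero r%:E c,
        qfun_eq f (lquot r%:E a b), qfun_eq g (lquot r%:E c d) &
        qfun_eq h (lquot_mul r%:E a b c d)].

End Semiregular.

Arguments qfun R : clear implicits.

(* Main.v *)
Require Import Defs.
From HB Require Import structures.
From mathcomp Require Import all_boot all_order all_algebra.
From mathcomp Require Import ring lra.
From mathcomp Require Import all_classical all_reals all_analysis.

Set Implicit Arguments.
Unset Strict Implicit.
Unset Printing Implicit Defensive.

Import Order.TTheory GRing.Theory Num.Theory.
Import numFieldNormedType.Exports.

Local Open Scope classical_set_scope.
Local Open Scope ring_scope.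

(** Put [P z = (z - p)^m (z - p')^n], where [p'] is the conjugate of [p]. On the
    complex line through [p] and [p'] the singularities of [P f] at [p] and [p']
    are removable, and if [p] is not real and [m > 0], then the value of the
    extension at [p] is not zero, because the order is minimal; likewise at [p']
    if [n > 0]. The other singularities in a smaller closed disc of this line are
    finitely many poles [s]. A power of the real quadratic polynomial
    [X^2 - 2 re(s) X + |s|^2], whose zeros in the line are [s] and its conjugate,
    clears the pole at [s]. So there are a real polynomial [Q], with
    [Q(p)] and [Q(p')] nonzero, and a power series [d] such that [Q P f = d] on
    the disc; this is [ordfactor_quotient]. As [Q] has real coefficients, it maps
    every complex line to itself, and [g = Q^-1 d] is regular on the ball away
    from the zeros of [Q], not only on the given line. In each line these zeros
    are isolated and [Q^-1] has poles there ([mero_inv]), so [g] is semiregular;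
    it is regular and nonzero where the theorem asserts it.

    All identities between regular products and quotients are reduced to real
    points. There the variable commutes with the coefficients, the regular product
    is the pointwise product, and the equation to be solved is [g = P f] in a skew
    field. An identity which holds at small real points extends to each complex
    line by the identity principle [identity_semireg], once the denominators,
    which map the line to itself, have been moved to the left of both sides. This
    shows that [g] does not depend on [Q] and [d] ([clearing_same]), that it
    solves the equation ([quot_lquot], [f_lquot_mul]), and that it is the only
    solution ([quot_unique]).

    What remains is complex analysis on one complex line, for functions with
    quaternionic values which are differentiable for the multiplication on the
    left. Goursat's theorem is applied in logarithmic polar coordinates, where
    an annulus is a rectangle; hence means over concentric circles are equal
    ([cmean_const]), which gives the Taylor expansion ([taylor]). The identity
    principle [identity_slice] propagates zeros from small real points along
    segments that avoid the finitely many singularities. *)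

(** * Quaternion algebra *)

Section Quaternions.
Context {R : realType}.
Local Notation H := (quat R).
Implicit Types (p q z w : H) (x y : R).

Lemma qnormE q : `|q| = Num.sqrt (qnormsq q).
Proof. by []. Qed.

Lemma qnorm_sqr q : `|q| ^+ 2 = qnormsq q.
Proof. by rewrite qnormE sqr_sqrtr ?qnormsq_ge0. Qed.

Lemma qnormM p q : `|p * q| = `|p| * `|q|.
Proof.
rewrite !qnormE -sqrtrM ?qnormsq_ge0//; congr Num.sqrt.
by rewrite /qnormsq /=; ring.
Qed.

Lemma qnormX q n : `|q ^+ n| = `|q| ^+ n.
Proof.
elim: n => [|n IH]; last by rewrite !exprS qnormM IH.
by rewrite !expr0 qnormE /qnormsq /= expr0n /= expr1n !addr0 sqrtr1.
Qed.

Lemma qunitE q : (q \is a GRing.unit) = (q != 0).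
Proof. by []. Qed.

Lemma qmulVf q : q != 0 -> q^-1 * q = 1.
Proof. by move=> q0; rewrite mulVr. Qed.

Lemma qmulfV q : q != 0 -> q * q^-1 = 1.
Proof. by move=> q0; rewrite mulrV. Qed.

Lemma qmulf_neq0 p q : p != 0 -> q != 0 -> p * q != 0.
Proof. by rewrite -!normr_gt0 qnormM => *; rewrite mulr_gt0. Qed.

Lemma qexpf_neq0 q n : q != 0 -> q ^+ n != 0.
Proof. by rewrite -!normr_gt0 qnormX => *; rewrite exprn_gt0. Qed.

Lemma qmulf_eq0 p q : (p * q == 0) = (p == 0) || (q == 0).
Proof. by rewrite -[LHS]normr_eq0 qnormM mulf_eq0 !normr_eq0. Qed.

Lemma qnorm1 : `|1 : H| = 1.
Proof. by rewrite -(expr0 (0 : H)) qnormX expr0. Qed.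

Lemma qinv0 : (0 : H)^-1 = 0.
Proof. by rewrite invr_out // qunitE eqxx. Qed.

Lemma qnormV q : `|q^-1| = `|q|^-1.
Proof.
have [->|q0] := eqVneq q 0; first by rewrite qinv0 normr0 invr0.
apply: (mulfI (x := `|q|)); first by rewrite normr_eq0.
by rewrite -qnormM qmulfV// qnorm1 divff// normr_eq0.
Qed.

Lemma qinv_neq0 q : q != 0 -> q^-1 != 0.
Proof. by rewrite -!normr_gt0 qnormV invr_gt0. Qed.

Lemma qscalarC x q : x%:A * q = q * x%:A.
Proof. by rewrite mulr_algl mulr_algr. Qed.

Lemma qnorm_real x : `|x%:A : H| = `|x|.
Proof. by rewrite normrZ qnorm1 mulr1. Qed.

Lemma qrealM x y : (x * y)%:A = x%:A * y%:A :> H.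
Proof. by rewrite mulr_algl scalerA. Qed.

Lemma qrealD x y : (x + y)%:A = x%:A + y%:A :> H.
Proof. by rewrite scalerDl. Qed.

Lemma qreal_eq0 x : (x%:A == 0 :> H) = (x == 0).
Proof. by rewrite -normr_eq0 qnorm_real normr_eq0. Qed.

Lemma qrealV x : (x^-1)%:A = (x%:A)^-1 :> H.
Proof.
have [->|x0] := eqVneq x 0; first by rewrite invr0 scale0r qinv0.
apply: (@mulrI _ (x%:A : H)); first by rewrite qunitE qreal_eq0.
by rewrite -qrealM divff// scale1r qmulfV// qreal_eq0.
Qed.

Lemma qrealX x n : (x ^+ n)%:A = (x%:A) ^+ n :> H.
Proof.
by elim: n => [|n IH]; rewrite ?expr0 ?scale1r// !exprS qrealM IH.
Qed.

Lemma qconjK q : qconj (qconj q) = q.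
Proof. by apply: quatP; split; rewrite /= ?opprK. Qed.

Lemma qconjM p q : qconj (p * q) = qconj q * qconj p.
Proof. by apply: quatP; split; rewrite /=; ring. Qed.

Lemma qconjD p q : qconj (p + q) = qconj p + qconj q.
Proof. by apply: quatP; split; rewrite /= ?opprD. Qed.

Lemma qconj0 : qconj 0 = 0 :> H.
Proof. by apply: quatP; split; rewrite /= ?oppr0. Qed.

Lemma qconj_sum n (F : nat -> H) :
  qconj (\sum_(i < n) F i) = \sum_(i < n) qconj (F i).
Proof.
elim: n => [|n IH]; first by rewrite !big_ord0 qconj0.
by rewrite !big_ord_recr /= qconjD IH.
Qed.

Lemma qreE (x : R) : x%:A = Quat x 0 0 0 :> H.
Proof. by apply: quatP; split; rewrite /= ?mulr1 ?mulr0. Qed.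

Lemma qconj_real x : qconj (x%:A) = x%:A :> H.
Proof. by rewrite qreE; apply: quatP; split; rewrite /= ?oppr0. Qed.

Lemma qmul_conj q : q * qconj q = (qnormsq q)%:A.
Proof. by rewrite qreE; apply: quatP; split; rewrite /qnormsq /=; ring. Qed.

Lemma qnorm_conj q : `|qconj q| = `|q|.
Proof. by rewrite !qnormE /qnormsq /= !sqrrN. Qed.

Lemma qconj_selfP q : qconj q = q -> q = (qre q)%:A.
Proof.
case: q => a b c d [] hb hc hd; rewrite qreE; apply: quatP; split => //=; lra.
Qed.

Lemma qre_le q : `|qre q| <= `|q|.
Proof.
rewrite qnormE -sqrtr_sqr ler_sqrt ?qnormsq_ge0// /qnormsq -!addrA lerDl.
by rewrite !addr_ge0// sqr_ge0.
Qed.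

Lemma qi_le q : `|qi q| <= `|q|.
Proof.
rewrite qnormE -sqrtr_sqr ler_sqrt ?qnormsq_ge0// /qnormsq.
have := sqr_ge0 (qre q); have := sqr_ge0 (qj q); have := sqr_ge0 (qk q); lra.
Qed.

Lemma qj_le q : `|qj q| <= `|q|.
Proof.
rewrite qnormE -sqrtr_sqr ler_sqrt ?qnormsq_ge0// /qnormsq.
have := sqr_ge0 (qre q); have := sqr_ge0 (qi q); have := sqr_ge0 (qk q); lra.
Qed.

Lemma qk_le q : `|qk q| <= `|q|.
Proof.
rewrite qnormE -sqrtr_sqr ler_sqrt ?qnormsq_ge0// /qnormsq.
have := sqr_ge0 (qre q); have := sqr_ge0 (qi q); have := sqr_ge0 (qj q); lra.
Qed.

Definition qI : H := Quat 0 1 0 0.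
Definition qJ : H := Quat 0 0 1 0.
Definition qK : H := Quat 0 0 0 1.

Lemma quat_basis q :
  q = qre q *: 1 + qi q *: qI + qj q *: qJ + qk q *: qK.
Proof. by apply: quatP; split; rewrite /= !(mulr0, mulr1, addr0, add0r). Qed.

Lemma qnormI : `|qI| = 1.
Proof. by rewrite qnormE /qnormsq /= expr0n expr1n /= !(addr0, add0r) sqrtr1. Qed.
Lemma qnormJ : `|qJ| = 1.
Proof. by rewrite qnormE /qnormsq /= expr0n expr1n /= !(addr0, add0r) sqrtr1. Qed.
Lemma qnormK : `|qK| = 1.
Proof. by rewrite qnormE /qnormsq /= expr0n expr1n /= !(addr0, add0r) sqrtr1. Qed.

Lemma qnorm_le4 q : `|q| <= `|qre q| + `|qi q| + `|qj q| + `|qk q|.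
Proof.
rewrite [in leLHS](quat_basis q).
apply: le_trans (ler_normD _ _) _; rewrite lerD//; last first.
  by rewrite normrZ qnormK mulr1.
apply: le_trans (ler_normD _ _) _; rewrite lerD//; last first.
  by rewrite normrZ qnormJ mulr1.
apply: le_trans (ler_normD _ _) _; rewrite lerD//; last first.
  by rewrite normrZ qnormI mulr1.
by rewrite normrZ qnorm1 mulr1.
Qed.

(** * Limits *)

Section Cvg.
Context T (F : set_system T) {FF : Filter F}.
Implicit Types f g : T -> H.

Lemma cvg_dist0 f (a : H) : f @ F --> a <-> (fun t => `|f t - a|) @ F --> (0 : R).
Proof.
split=> [fa|h].
  rewrite [X in _ --> X](_ : _ = `|a - a|); last by rewrite subrr normr0.
  by apply: cvg_norm; apply: cvgB => //; exact: cvg_cst.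
by apply: cvg_zero; apply: norm_cvg0; exact: h.
Qed.

Lemma cvg_qmul f g (a b : H) :
  f @ F --> a -> g @ F --> b -> (fun t => f t * g t) @ F --> a * b.
Proof.
move=> fa gb.
have -> : (fun t => f t * g t) = (fun t => f t * (g t - b) + (f t - a) * b + a * b).
  by apply/funext => t; rewrite mulrBr mulrBl addrA !subrK.
rewrite -[X in _ --> X]add0r; apply: cvgD; last exact: cvg_cst.
rewrite -[X in _ --> X]addr0; apply: cvgD; apply: norm_cvg0.
  rewrite [X in X @ _](_ : _ = fun t => `|f t| * `|g t - b|); last first.
    by apply/funext => t; rewrite qnormM.
  rewrite -[X in _ --> X](mulr0 `|a|).
  by apply: cvgM; [exact: cvg_norm|exact/cvg_dist0].
rewrite [X in X @ _](_ : _ = fun t => `|f t - a| * `|b|); last first.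
  by apply/funext => t; rewrite qnormM.
rewrite -[X in _ --> X](mul0r `|b|).
by apply: cvgM; [exact/cvg_dist0|exact: cvg_cst].
Qed.

Lemma cvg_qmull f (a b : H) : f @ F --> a -> (fun t => b * f t) @ F --> b * a.
Proof. by move=> fa; apply: cvg_qmul => //; exact: cvg_cst. Qed.

Lemma cvg_qmulr f (a b : H) : f @ F --> a -> (fun t => f t * b) @ F --> a * b.
Proof. by move=> fa; apply: cvg_qmul => //; exact: cvg_cst. Qed.

Lemma cvg_qinv f (a : H) : a != 0 -> f @ F --> a ->
  (fun t => (f t)^-1) @ F --> a^-1.
Proof.
move=> a0 fa; apply/cvg_dist0.
have /cvgr_neq0 - /(_ a0) f0 := fa.
have : (fun t => `|f t|^-1 * (`|f t - a| * `|a|^-1)) @ F --> (0 : R).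
  rewrite -[X in _ --> X](mulr0 `|a|^-1); apply: cvgM.
    by apply: cvgV; [rewrite normr_eq0|exact: cvg_norm].
  by rewrite -[X in _ --> X](mul0r `|a|^-1); apply: cvgM;
    [exact/cvg_dist0|exact: cvg_cst].
apply: cvg_trans; apply: near_eq_cvg; apply: filterS f0 => t ft0.
rewrite -!qnormV -qnormM -qnormM -normrN; congr `|_|.
by rewrite mulrBl mulrBr qmulfV// mulr1 mulrA qmulVf// mul1r opprB.
Qed.

Lemma cvg_quat (f1 f2 f3 f4 : T -> R) a : f1 @ F --> qre a -> f2 @ F --> qi a ->
  f3 @ F --> qj a -> f4 @ F --> qk a ->
  (fun t => Quat (f1 t) (f2 t) (f3 t) (f4 t)) @ F --> a.
Proof.
move=> h1 h2 h3 h4; rewrite (quat_basis a).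
rewrite [X in X @ _](_ : _ =
  fun t => f1 t *: 1 + f2 t *: qI + f3 t *: qJ + f4 t *: qK); last first.
  by apply/funext => t; rewrite [LHS]quat_basis.
by do 3 (apply: cvgD; last exact: cvgZr_tmp); exact: cvgZr_tmp.
Qed.

Lemma cvg_comp_le (phi : H -> R) f a :
  {morph phi : x y / x - y} -> (forall q, `|phi q| <= `|q|) ->
  f @ F --> a -> (fun t => phi (f t)) @ F --> phi a.
Proof.
move=> phiB phile fa; apply/cvgrPdist_le => e e0.
have /cvgrPdist_le/(_ e e0) := fa; apply: filterS => t.
by apply: le_trans; rewrite -phiB.
Qed.

Lemma cvg_qre f a : f @ F --> a -> (fun t => qre (f t)) @ F --> qre a.
Proof. by apply: cvg_comp_le => //; exact: qre_le. Qed.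
Lemma cvg_qi f a : f @ F --> a -> (fun t => qi (f t)) @ F --> qi a.
Proof. by apply: cvg_comp_le => //; exact: qi_le. Qed.
Lemma cvg_qj f a : f @ F --> a -> (fun t => qj (f t)) @ F --> qj a.
Proof. by apply: cvg_comp_le => //; exact: qj_le. Qed.
Lemma cvg_qk f a : f @ F --> a -> (fun t => qk (f t)) @ F --> qk a.
Proof. by apply: cvg_comp_le => //; exact: qk_le. Qed.

End Cvg.

(** * Complex planes *)

Implicit Types I : H.

(** The square of [a + v], with [a] real and [v] a vector, is
    [a^2 - |v|^2 + 2 a v]; if it is real and [a] is not zero, then it is positive. *)
Lemma imag_unitP I : imag_units I -> qre I = 0 /\ qnormsq I = 1.
Proof.
rewrite /imag_units /= expr2; case: I => a b c d [] /= h0 h1 h2 h3.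
have a0 : a = 0.
  apply/eqP; apply: contraT => a0.
  have b0 : b = 0 by apply: (mulfI a0); lra.
  have c0 : c = 0 by apply: (mulfI a0); lra.
  have d0 : d = 0 by apply: (mulfI a0); lra.
  move: h0; rewrite b0 c0 d0 => h0; have := sqr_ge0 a; rewrite expr2; lra.
split => //; rewrite /qnormsq /= a0 in h0 *; lra.
Qed.

Lemma imag_unit_sqr I : imag_units I -> I * I = -1.
Proof. by rewrite /imag_units /= expr2. Qed.

Lemma imag_unit_norm I : imag_units I -> `|I| = 1.
Proof. by move=> /imag_unitP[_ h]; rewrite qnormE h sqrtr1. Qed.

Lemma slice_comp I x y : imag_units I -> [/\ qre (slice I x y) = x,
  qi (slice I x y) = y * qi I, qj (slice I x y) = y * qj I
  & qk (slice I x y) = y * qk I].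
Proof.
move=> /imag_unitP[I0 _]; rewrite /slice mulr_algr qreE /= I0 mulr0.
by split; rewrite ?addr0 ?add0r.
Qed.

Lemma slice_normsq I x y : imag_units I -> qnormsq (slice I x y) = x ^+ 2 + y ^+ 2.
Proof.
move=> hI; have [h0 h1] := imag_unitP hI.
rewrite /qnormsq; have [-> -> -> ->] := slice_comp x y hI.
rewrite !exprMn -[in RHS](mulr1 (y ^+ 2)) -h1 /qnormsq h0; ring.
Qed.

Lemma cplane_exists q : exists2 I, imag_units I & cplane I q.
Proof.
pose v := Quat 0 (qi q) (qj q) (qk q).
have qv : q = (qre q)%:A + v.
  by rewrite qreE; apply: quatP; split; rewrite /= ?addr0 ?add0r.
have [v0|v0] := eqVneq v 0.
  exists qI; first by rewrite /imag_units /= expr2; apply: quatP; split;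
    rewrite /= ; ring.
  by exists (qre q), 0; rewrite {1}qv v0 /slice scale0r mulr0.
have nv : `|v| != 0 by rewrite normr_eq0.
exists (`|v|^-1 *: v).
  rewrite /imag_units /= expr2 -scalerAl -scalerAr scalerA.
  have -> : v * v = - (`|v| * `|v|)%:A.
    rewrite -[`|v| * `|v|]expr2 qnorm_sqr qreE; apply: quatP; split; rewrite /qnormsq /=; ring.
  by rewrite scalerN scalerA -invfM mulVf ?scale1r// mulf_neq0.
exists (qre q), `|v|; rewrite {1}qv /slice; congr (_ + _).
by rewrite mulr_algr scalerA divff// scale1r.
Qed.

Section Plane.
Variable I : H.
Hypothesis hI : imag_units I.

Lemma cplane_slice x y : cplane I (slice I x y).
Proof. by exists x, y. Qed.

Lemma cplane_real x : cplane I (x%:A).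
Proof. by exists x, 0; rewrite /slice scale0r mulr0 addr0. Qed.

Lemma cplane_unit : cplane I I.
Proof. by exists 0, 1; rewrite /slice scale0r scale1r mulr1 add0r. Qed.

Lemma cplane0 : cplane I 0.
Proof. by have := cplane_real 0; rewrite scale0r. Qed.

Lemma cplane1 : cplane I 1.
Proof. by have := cplane_real 1; rewrite scale1r. Qed.

Lemma cplaneD z w : cplane I z -> cplane I w -> cplane I (z + w).
Proof.
move=> [x [y ->]] [x' [y' ->]]; exists (x + x'), (y + y').
by rewrite /slice !qrealD mulrDr addrACA.
Qed.

Lemma cplaneN z : cplane I z -> cplane I (- z).
Proof.
by move=> [x [y ->]]; exists (- x), (- y); rewrite /slice !scaleNr mulrN opprD.
Qed.

Lemma cplaneB z w : cplane I z -> cplane I w -> cplane I (z - w).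
Proof. by move=> hz hw; apply: cplaneD => //; exact: cplaneN. Qed.

Lemma cplaneZ x z : cplane I z -> cplane I (x *: z).
Proof.
move=> [a [b ->]]; exists (x * a), (x * b).
by rewrite /slice scalerDr scalerAr !scalerA.
Qed.

Lemma cplane_comm z w : cplane I z -> cplane I w -> z * w = w * z.
Proof.
move=> [x [y ->]] [x' [y' ->]]; rewrite /slice.
by apply: quatP; split; rewrite /=; ring.
Qed.

Lemma cplaneM z w : cplane I z -> cplane I w -> cplane I (z * w).
Proof.
move=> [x [y ->]] [x' [y' ->]]; exists (x * x' - y * y'), (x * y' + y * x').
rewrite /slice !mulr_algr mulrDl !mulrDr -!scalerAl -!scalerAr.
rewrite !mul1r !mulr1 imag_unit_sqr// !scalerA scalerDl [in RHS]scalerDl.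
by rewrite scalerN scaleNr -!addrA; congr (_ + _); rewrite addrA [RHS]addrC.
Qed.

Lemma cplaneX z n : cplane I z -> cplane I (z ^+ n).
Proof.
move=> hz; elim: n => [|n IH]; rewrite ?expr0 ?exprS; first exact: cplane1.
exact: cplaneM.
Qed.

Lemma cplane_conj z : cplane I z -> cplane I (qconj z).
Proof.
move=> [x [y ->]]; exists x, (- y); have [I0 _] := imag_unitP hI.
have [h1 h2 h3 h4] := slice_comp x y hI.
have [k1 k2 k3 k4] := slice_comp x (- y) hI.
by rewrite /qconj h1 h2 h3 h4; apply: quatP; split;
  rewrite ?k1 ?k2 ?k3 ?k4 /= ?mulNr.
Qed.

Lemma cplaneV z : cplane I z -> cplane I z^-1.
Proof. by move=> hz; apply: cplaneZ; exact: cplane_conj. Qed.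

Lemma slice_norm x y : `|slice I x y| = Num.sqrt (x ^+ 2 + y ^+ 2).
Proof. by rewrite qnormE slice_normsq. Qed.

Lemma slice_norm_gex x y : `|x| <= `|slice I x y|.
Proof. by rewrite slice_norm -sqrtr_sqr ler_sqrt ?addr_ge0 ?sqr_ge0// lerDl sqr_ge0. Qed.

Lemma slice_norm_gey x y : `|y| <= `|slice I x y|.
Proof. by rewrite slice_norm -sqrtr_sqr ler_sqrt ?addr_ge0 ?sqr_ge0// lerDr sqr_ge0. Qed.

Lemma slice_norm_le x y : `|slice I x y| <= `|x| + `|y|.
Proof.
apply: le_trans (ler_normD _ _) _; rewrite qnorm_real lerD2l qnormM qnorm_real.
by rewrite imag_unit_norm// mul1r.
Qed.

Lemma sliceD x y x' y' : slice I (x + x') (y + y') = slice I x y + slice I x' y'.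
Proof. by rewrite /slice !qrealD mulrDr addrACA. Qed.

Lemma sliceB x y x' y' : slice I (x - x') (y - y') = slice I x y - slice I x' y'.
Proof.
by rewrite sliceD; congr (_ + _); rewrite /slice !scaleNr mulrN opprD.
Qed.

Lemma slice0 x : slice I x 0 = x%:A.
Proof. by rewrite /slice scale0r mulr0 addr0. Qed.

Lemma slice_inj x y x' y' : slice I x y = slice I x' y' -> x = x' /\ y = y'.
Proof.
move=> h; have : slice I (x - x') (y - y') = 0 by rewrite sliceB h subrr.
move=> /(congr1 (fun q => `|q|)); rewrite normr0 => h0.
have := slice_norm_gex (x - x') (y - y'); have := slice_norm_gey (x - x') (y - y').
by rewrite h0 !normr_le0 !subr_eq0 => /eqP -> /eqP ->.
Qed.

End Plane.

(** A nonreal point of a plane determines the imaginary unit up to a real factor. *)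
Lemma cplane_eq I J z : imag_units I -> imag_units J -> cplane I z ->
  cplane J z -> qconj z != z -> cplane I `<=` cplane J.
Proof.
move=> hI hJ [x [y zI]] zJ zr.
have y0 : y != 0.
  by apply: contra zr => /eqP y0; rewrite zI y0 slice0 // qconj_real.
(* It suffices to find [I] in the other plane, as planes are real algebras. *)
suff IJ : cplane J I.
  move=> _ [a [b ->]]; apply: cplaneD => //; first exact: cplane_real.
  by apply: cplaneM => //; exact: cplane_real.
have -> : I = y^-1 *: (z - x%:A).
  by rewrite zI /slice addrC addKr mulr_algr scalerA mulVf// scale1r.
by apply: cplaneZ => //; apply: cplaneB => //; exact: cplane_real.
Qed.

Lemma real_cplane I z : imag_units I -> cplane I z -> qconj z = z ->
  exists x, z = x%:A.
Proof. by move=> _ _ /qconj_selfP zr; exists (qre z). Qed.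

End Quaternions.

(** * Power series *)

Section PowerSeries.
Context {R : realType}.
Local Notation H := (quat R).
Implicit Types (p q z w : H) (x y s t : R) (a b : nat -> H).

Lemma geo_partial t n m : 0 <= t -> t < 1 ->
  \sum_(m <= i < n) t ^+ i <= t ^+ m / (1 - t).
Proof.
move=> t0 t1; have t1' : 0 < 1 - t by lra.
have [nm|mn] := leqP n m.
  by rewrite big_geq// divr_ge0 ?exprn_ge0// ltW.
rewrite ler_pdivlMr//.
suff -> : (\sum_(m <= i < n) t ^+ i) * (1 - t) = t ^+ m - t ^+ n.
  by rewrite gerBl exprn_ge0.
rewrite -(subnKC (ltnW mn)); elim: (n - m)%N => [|k IH].
  by rewrite addn0 big_geq// mul0r subrr.
by rewrite addnS big_nat_recr ?leq_addr//= mulrDl IH exprS; ring.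
Qed.

Lemma geo_series_dist (u : nat -> H) (C t : R) m n : 0 <= t -> t < 1 ->
  (forall n, `|u n| <= C * t ^+ n) -> (m <= n)%N ->
  `|series u n - series u m| <= C * t ^+ m / (1 - t).
Proof.
move=> t0 t1 hu mn; rewrite sub_series_geq//.
apply: le_trans (ler_norm_sum _ _ _) _.
apply: (@le_trans _ _ (\sum_(m <= i < n) C * t ^+ i)).
  by apply: ler_sum => i _; exact: hu.
rewrite -mulr_sumr -mulrA ler_wpM2l ?geo_partial//.
by have := hu 0%N; rewrite expr0 mulr1; apply: le_trans.
Qed.

(** Quaternionic series dominated by a geometric series converge, because each
    of the four real component series does. *)
Lemma geo_cvg (u : nat -> H) (C t : R) : 0 <= t -> t < 1 ->
  (forall n, `|u n| <= C * t ^+ n) -> cvgn (series u).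
Proof.
move=> t0 t1 hu.
have C0 : 0 <= C by have := hu 0%N; rewrite expr0 mulr1; apply: le_trans.
have comp (phi : H -> R) : (forall q, `|phi q| <= `|q|) ->
    cvgn (series (phi \o u)).
  move=> hphi; apply: normed_cvg.
  apply: (@series_le_cvg _ _ (geometric C t)) => [n|n|n|].
  - exact: normr_ge0.
  - by rewrite /= mulr_ge0// exprn_ge0.
  - by rewrite /=; apply: le_trans (hphi _) _; exact: hu.
  - by apply: is_cvg_geometric_series; rewrite ger0_norm.
have seriesE (phi : H -> R) : {morph phi : p q / p + q} -> phi 0 = 0 ->
    series (phi \o u) = phi \o series u.
  move=> phiD phi0; apply/funext => n; rewrite /series /=.
  by apply: (big_ind2 (fun x q => x = phi q)) => [//|x q y p -> ->|//]; rewrite phiD.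
have := comp _ qre_le; have := comp _ qi_le; have := comp _ qj_le.
have := comp _ qk_le; rewrite !seriesE// => hk hj hi hr.
apply/cvg_ex; exists (Quat (limn (@qre R \o series u)) (limn (@qi R \o series u))
  (limn (@qj R \o series u)) (limn (@qk R \o series u))).
rewrite [X in X @ _](_ : _ = fun n => Quat (qre (series u n)) (qi (series u n))
  (qj (series u n)) (qk (series u n))); last by apply/funext => n; case: (series u n).
exact: cvg_quat.
Qed.

Lemma cvg_norm_le T (F : set_system T) {FF : ProperFilter F} (f : T -> H) l (M : R) :
  f @ F --> l -> (\forall t \near F, `|f t| <= M) -> `|l| <= M.
Proof.
move=> fl fM; rewrite -(cvg_lim _ (cvg_norm fl))//; apply: limr_le => //.
exact: cvgP (cvg_norm fl).
Qed.

Lemma qcvg_unique T (F : set_system T) {FF : ProperFilter F} (f : T -> H) (l l' : H) :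
  f @ F --> l -> f @ F --> l' -> l = l'.
Proof. by move=> h h'; exact: (cvg_unique _ h h'). Qed.

Lemma geo_tail (u : nat -> H) (C t : R) l m : 0 <= t -> t < 1 ->
  (forall n, `|u n| <= C * t ^+ n) -> series u @ \oo --> l ->
  `|l - series u m| <= C * t ^+ m / (1 - t).
Proof.
move=> t0 t1 hu ul; apply: (@cvg_norm_le _ \oo _ (fun n => series u n - series u m)).
  by apply: cvgB => //; exact: cvg_cst.
by near=> n; apply: geo_series_dist => //; near: n; exact: nbhs_infty_ge.
Unshelve. all: by end_near. Qed.

Lemma geo_lim_le (u : nat -> H) (C t : R) l : 0 <= t -> t < 1 ->
  (forall n, `|u n| <= C * t ^+ n) -> series u @ \oo --> l -> `|l| <= C / (1 - t).
Proof.
move=> t0 t1 hu ul; have := geo_tail 0 t0 t1 hu ul.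
by rewrite expr0 mulr1 /series /= big_geq// subr0.
Qed.

(** The coefficients of a power series whose radius of convergence exceeds [s]
    satisfy this bound, which is what the estimates use. *)
Definition gbound s a := exists C, forall n, `|a n| * s ^+ n <= C.

Lemma gbound_le s s' a : 0 <= s' -> s' <= s -> gbound s a -> gbound s' a.
Proof.
move=> s0 ss [C hC]; exists C => n; apply: le_trans (hC n).
by rewrite ler_wpM2l// lerXn2r// nnegrE// (le_trans s0).
Qed.

Lemma gbound_geo s a q : 0 < s -> gbound s a ->
  exists2 C, 0 <= C & forall n, `|pterm a q n| <= C * (`|q| / s) ^+ n.
Proof.
move=> s0 [C hC]; exists C.
  by apply: le_trans (hC 0%N); rewrite expr0 mulr1.
move=> n; rewrite /pterm qnormM qnormX expr_div_n mulrCA.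
by rewrite ler_wpM2l ?exprn_ge0// ler_pdivlMr ?exprn_gt0.
Qed.

Lemma psum_cvg s a q : gbound s a -> `|q| < s ->
  series (pterm a q) @ \oo --> psum a q.
Proof.
move=> ha qs; have s0 : 0 < s by exact: le_lt_trans qs.
have [C C0 hC] := gbound_geo q s0 ha.
by apply: (geo_cvg _ _ hC); rewrite ?divr_ge0// ?ltW// ltr_pdivrMr// mul1r.
Qed.

Lemma gbound_converges (r : R) a :
  (forall s, 0 < s -> s < r -> gbound s a) -> converges r%:E a.
Proof.
move=> ha q; rewrite /qball /= lte_fin => qr.
have [s /andP[qs sr]] : exists s, `|q| < s < r by exists ((`|q| + r) / 2); lra.
by apply: cvgP; apply: (psum_cvg (ha s _ sr)) => //; exact: le_lt_trans qs.
Qed.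

(** Convergence at the real point [s] makes the terms bounded there. *)
Lemma converges_gbound (r : R) a s :
  converges r%:E a -> 0 < s -> s < r -> gbound s a.
Proof.
move=> ca s0 sr; have := ca (s%:A).
rewrite /qball /= qnorm_real gtr0_norm// lte_fin => /(_ sr).
move=> /cvg_series_cvg_0 /cvgP /cvg_seq_bounded [M [Mr hM]].
exists (M + 1) => n; have /(_ _ n I) := hM (M + 1); rewrite /= /pterm.
rewrite qnormM qnormX qnorm_real gtr0_norm// mulrC; apply; lra.
Qed.

Lemma psum_finite a N q : (forall n, (N <= n)%N -> a n = 0) ->
  psum a q = \sum_(0 <= n < N) q ^+ n * a n.
Proof.
move=> ha; apply: cvg_lim => //; apply: cvg_near_cst.
near=> n; rewrite /series /=.
have Nn : (N <= n)%N by near: n; exact: nbhs_infty_ge.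
rewrite (big_cat_nat (n := N))//= [X in _ + X]big1_seq ?addr0// => i.
by rewrite mem_index_iota => /andP[_ /andP[Ni _]]; rewrite /pterm ha// mulr0.
Unshelve. all: by end_near. Qed.

Lemma gbound_finite a N s : (forall n, (N <= n)%N -> a n = 0) -> gbound s a.
Proof.
move=> ha; exists (\sum_(i < N) `| `|a i| * s ^+ i|) => n.
have [nN|Nn] := ltnP n N.
  rewrite (bigD1 (Ordinal nN))//= (le_trans (ler_norm _))// lerDl.
  by apply: sumr_ge0.
by rewrite ha// normr0 mul0r; apply: sumr_ge0.
Qed.

Definition shiftc a n := a n.+1.

Lemma gbound_shift s a : 0 < s -> gbound s a -> gbound s (shiftc a).
Proof.
move=> s0 [C hC]; exists (C / s) => n; rewrite ler_pdivlMr// -mulrA -exprSr.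
exact: hC.
Qed.

Lemma psum_shift s a q : gbound s a -> `|q| < s ->
  psum a q = a 0%N + q * psum (shiftc a) q.
Proof.
move=> ha qs; have s0 : 0 < s by exact: le_lt_trans qs.
have h1 := psum_cvg ha qs.
have h2 := psum_cvg (gbound_shift s0 ha) qs.
have h1' : (fun n => series (pterm a q) n.+1) @ \oo --> psum a q by rewrite cvg_shiftS.
apply: (qcvg_unique h1').
rewrite [X in X @ _](_ : _ =
    fun n => a 0%N + q * series (pterm (shiftc a) q) n).
  by apply: cvgD; [exact: cvg_cst|exact: cvg_qmull].
apply/funext => n; rewrite /series /= big_nat_recl//=.
rewrite {1}/pterm expr0 mul1r; congr (_ + _); rewrite mulr_sumr.
by apply: eq_bigr => i _; rewrite /pterm /shiftc exprS mulrA.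
Qed.

Lemma psum_le s a : 0 < s -> gbound s a ->
  exists2 C, 0 <= C & forall q, `|q| <= s / 2 -> `|psum a q| <= C.
Proof.
move=> s0 ha; have [C hC] := ha.
have C0 : 0 <= C by apply: le_trans (hC 0%N); rewrite expr0 mulr1.
exists (C / (1 - 2^-1)) => [|w ws]; first by rewrite divr_ge0//; lra.
apply: (geo_lim_le (u := pterm a w)); [lra|lra| |]; last first.
  by apply: (psum_cvg ha); lra.
move=> n; rewrite /pterm qnormM qnormX.
apply: (@le_trans _ _ ((s / 2) ^+ n * `|a n|)).
  by rewrite ler_wpM2r// lerXn2r// nnegrE; move: (normr_ge0 w); lra.
by rewrite exprMn mulrC mulrA ler_wpM2r ?exprn_ge0// invr_ge0.
Qed.

Lemma psum_zero0 s a : 0 < s -> gbound s a ->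
  (forall e, 0 < e -> exists2 w, 0 < `|w| < e & psum a w = 0) -> a 0%N = 0.
Proof.
move=> s0 ha hz.
apply/eqP; rewrite -normr_le0; apply/ler_addgt0Pl => e e0; rewrite addr0.
have [C C0 hC] := psum_le s0 (gbound_shift s0 ha).
have [|w /andP[w0 we] aw] := hz (Order.min (s / 2) (e / (C + 1))).
  by rewrite lt_min divr_gt0//= divr_gt0// ltr_wpDl.
move: we; rewrite lt_min => /andP[ws we].
have := psum_shift ha (q := w) ltac:(lra); rewrite aw => /esym/eqP.
rewrite addr_eq0 => /eqP ->; rewrite normrN qnormM.
apply: (@le_trans _ _ (e / (C + 1) * C)).
  by rewrite ler_pM ?normr_ge0 ?(ltW we)//; apply: hC; exact: ltW.
by rewrite mulrAC ler_pdivrMr ?ltr_wpDl// ler_wpM2l ?(ltW e0)//; lra.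
Qed.

(** A power series which vanishes at points accumulating at its center has only
    zero coefficients: dividing by the variable preserves the hypothesis, and
    the constant term is the limit of values which are all zero. *)
Lemma psum_zero s a : 0 < s -> gbound s a ->
  (forall e, 0 < e -> exists2 w, 0 < `|w| < e & psum a w = 0) ->
  forall n, a n = 0.
Proof.
move=> s0 ha hz n; elim: n a ha hz => [|n IH] a ha hz.
  exact: (psum_zero0 s0 ha hz).
apply: (IH (shiftc a)); first exact: gbound_shift.
move=> e e0; have [|w] := hz (Order.min s e); first by rewrite lt_min s0.
rewrite lt_min => /and3P[w0 ws we] aw; exists w; first by rewrite w0.
have := psum_shift ha ws; rewrite aw (psum_zero0 s0 ha hz) add0r => /esym/eqP.
by rewrite qmulf_eq0 -normr_eq0 gt_eqF//= => /eqP.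
Qed.

(** * Products *)

Lemma cvg_exprn t : 0 <= t -> t < 1 -> (fun n => t ^+ n) @ \oo --> (0 : R).
Proof. by move=> t0 t1; apply: cvg_expr; rewrite ger0_norm. Qed.

(** The partial sums of the Cauchy product are [sum A i * S (N - i)], where [S]
    are the partial sums of [B]. Replacing [S] by its limit changes each of the [N]
    terms by a multiple of [t^N] at most. *)
Lemma cauchy_product (A B : nat -> H) (CA CB t : R) (la lb : H) :
  0 <= t -> t < 1 ->
  (forall n, `|A n| <= CA * t ^+ n) -> (forall n, `|B n| <= CB * t ^+ n) ->
  series A @ \oo --> la -> series B @ \oo --> lb ->
  series (fun n => \sum_(k < n.+1) A k * B (n - k)%N) @ \oo --> la * lb.
Proof.
move=> t0 t1 hA hB Ala Blb.
(* Any ratio strictly between [t] and 1 dominates [N t^N]. *)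
have [tau [tau0 tau1 ttau]] : exists tau, [/\ 0 < tau, tau < 1 & t < tau].
  by exists ((1 + t) / 2); split; lra.
have CA0 : 0 <= CA by have := hA 0%N; rewrite expr0 mulr1; apply: le_trans.
have CB0 : 0 <= CB by have := hB 0%N; rewrite expr0 mulr1; apply: le_trans.
set C := fun n => _.
have SC N : series C N = \sum_(i < N) A i * series B (N - i)%N.
  elim: N => [|N IH]; first by rewrite /series /= big_geq// big_ord0.
  rewrite seriesSr /= IH /C big_ord_recr /= [RHS]big_ord_recr /= subnn subSn//.
  rewrite subnn [series B 1]/series /= big_nat1 addrA; congr (_ + _).
  rewrite -big_split /=; apply: eq_bigr => i _.
  by rewrite subSn ?(ltnW (ltn_ord i))// seriesSr -mulrDr.
have K0 : 0 <= CA * (CB / (1 - t)).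
  by rewrite mulr_ge0// divr_ge0// subr_ge0 ltW.
have bound N : `|series A N * lb - series C N| <=
    CA * (CB / (1 - t)) / (1 - t / tau) * tau ^+ N.
  rewrite SC /series /= big_mkord mulr_suml -sumrB.
  apply: le_trans (ler_norm_sum _ _ _) _.
  apply: (@le_trans _ _ (\sum_(i < N)
      CA * (CB / (1 - t)) * tau ^+ N * (t / tau) ^+ i)).
    apply: ler_sum => i _; rewrite -mulrBr qnormM.
    have h1 := hA i; have h2 := geo_tail (N - i)%N t0 t1 hB Blb.
    apply: le_trans (ler_pM _ _ h1 h2) _; rewrite ?normr_ge0//.
    rewrite [leLHS](_ : _ = CA * (CB / (1 - t)) * (t ^+ i * t ^+ (N - i))); last ring.
    rewrite -[leRHS]mulrA; apply: ler_wpM2l => //.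
    have -> : tau ^+ N = tau ^+ (N - i) * tau ^+ i.
      by rewrite -exprD subnK// ltnW.
    rewrite expr_div_n.
    have -> : tau ^+ (N - i) * tau ^+ i * (t ^+ i / tau ^+ i) =
      t ^+ i * tau ^+ (N - i) by field; rewrite expf_neq0// gt_eqF.
    apply: ler_wpM2l; first exact: exprn_ge0.
    by apply: lerXn2r; rewrite ?nnegrE// ltW.
  rewrite -mulr_sumr -(big_mkord xpredT (fun i => (t / tau) ^+ i)).
  have tt0 : 0 <= t / tau by rewrite divr_ge0// ltW.
  have tt1 : t / tau < 1 by rewrite ltr_pdivrMr// mul1r.
  have := geo_partial N 0 tt0 tt1; rewrite expr0 div1r => h.
  rewrite -[leLHS]mulrA [leRHS]mulrAC -[leRHS]mulrA; apply: ler_wpM2l => //.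
  by apply: ler_wpM2l => //; rewrite exprn_ge0// ltW.
have lim0 : (fun N => series A N * lb - series C N) @ \oo --> (0 : H).
  apply: norm_cvg0.
  apply: (@squeeze_cvgr _ _ _ _ (fun=> 0)
    (fun N => CA * (CB / (1 - t)) / (1 - t / tau) * tau ^+ N)).
  - by near=> N; rewrite normr_ge0 bound.
  - exact: cvg_cst.
  - rewrite -[X in _ --> X](mulr0 (CA * (CB / (1 - t)) / (1 - t / tau))).
    by apply: cvgM; [exact: cvg_cst|apply: cvg_exprn => //; exact: ltW].
rewrite [X in X @ _](_ : _ = fun N => series A N * lb - (series A N * lb - series C N)).
  by rewrite -[X in _ --> X]subr0; apply: cvgB => //; exact: cvg_qmulr.
by apply/funext => N; rewrite subKr.
Unshelve. all: by end_near. Qed.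

(** The regular product is not the pointwise product in general; it is at the
    points which commute with the coefficients of the left factor. *)
Lemma psum_star_comm s a b q : gbound s a -> gbound s b -> `|q| < s ->
  (forall k, a k * q = q * a k) -> psum (star a b) q = psum a q * psum b q.
Proof.
move=> ha hb qs aq; have s0 : 0 < s by exact: le_lt_trans qs.
have [CA _ hA] := gbound_geo q s0 ha; have [CB _ hB] := gbound_geo q s0 hb.
have aqX k i : a k * q ^+ i = q ^+ i * a k.
  elim: i => [|i IH]; first by rewrite expr0 mulr1 mul1r.
  by rewrite exprS mulrA aq -mulrA IH mulrA.
apply: cvg_lim => //.
have := cauchy_product _ _ hA hB (psum_cvg ha qs) (psum_cvg hb qs).
rewrite [X in series X @ _](_ : _ = pterm (star a b) q); last first.
  apply/funext => n; rewrite /pterm /star mulr_sumr; apply: eq_bigr => i _.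
  have -> : q ^+ n = q ^+ i * q ^+ (n - i) by rewrite -exprD subnKC// -ltnS.
  by rewrite -!mulrA; congr (_ * _); rewrite !mulrA aqX.
by apply; rewrite ?divr_ge0 ?ltr_pdivrMr ?mul1r// ltW.
Qed.

(** The passage from [s'] to [s] absorbs the number of terms of each coefficient
    of the product. *)
Lemma gbound_star s s' a b : 0 < s -> s < s' -> gbound s' a -> gbound s' b ->
  gbound s (star a b).
Proof.
move=> s0 ss [CA hA] hb; have [CB hB] := gbound_le (ltW s0) (ltW ss) hb.
have s'0 : 0 < s' by exact: lt_trans ss.
have CA0 : 0 <= CA by have := hA 0%N; rewrite expr0 mulr1; apply: le_trans.
have CB0 : 0 <= CB by have := hB 0%N; rewrite expr0 mulr1; apply: le_trans.
have t0 : 0 <= s / s' by rewrite divr_ge0// ltW.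
have t1 : s / s' < 1 by rewrite ltr_pdivrMr// mul1r.
exists (CA * CB * (1 / (1 - s / s'))) => n.
apply: (@le_trans _ _ (\sum_(k < n.+1) CA * CB * (s / s') ^+ k)); last first.
  rewrite -mulr_sumr ler_wpM2l ?mulr_ge0// -(big_mkord xpredT (fun i => (s / s') ^+ i)).
  by have := geo_partial n.+1 0 t0 t1; rewrite expr0.
rewrite -ler_pdivlMr ?exprn_gt0//; apply: le_trans (ler_norm_sum _ _ _) _.
rewrite mulr_suml; apply: ler_sum => i _; rewrite qnormM.
rewrite ler_pdivlMr ?exprn_gt0//.
have -> : CA * CB * (s / s') ^+ i = (CA / s' ^+ i * s ^+ i) * CB.
  by rewrite expr_div_n; ring.
have -> : s ^+ n = s ^+ i * s ^+ (n - i) by rewrite -exprD subnKC// -ltnS.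
rewrite mulrACA.
apply: ler_pM; rewrite ?mulr_ge0 ?exprn_ge0 ?normr_ge0// ?(ltW s0)//.
by rewrite ler_wpM2r ?exprn_ge0 ?(ltW s0)// ler_pdivlMr ?exprn_gt0.
Qed.

Lemma gbound_conjc s a : gbound s a -> gbound s (conjc a).
Proof. by move=> [C hC]; exists C => n; rewrite /conjc qnorm_conj. Qed.

Lemma psum_conjc_real s a x : gbound s a -> `|x| < s ->
  psum (conjc a) x%:A = qconj (psum a x%:A).
Proof.
move=> ha xs; have nx : `|x%:A : H| < s by rewrite qnorm_real.
apply: cvg_lim => //; have h := psum_cvg ha nx.
rewrite [X in X @ _](_ : _ = fun n => qconj (series (pterm a x%:A) n)).
  apply: cvg_quat => /=; first exact: cvg_qre.
  - by apply: cvgN; exact: cvg_qi.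
  - by apply: cvgN; exact: cvg_qj.
  - by apply: cvgN; exact: cvg_qk.
apply/funext => n; rewrite /series /= !big_mkord (qconj_sum n (pterm a x%:A)).
by apply: eq_bigr => i _; rewrite /pterm /conjc qconjM -qrealX qconj_real qscalarC.
Qed.

(** Conjugation reverses the order of the factors, hence of the terms of the sum,
    which is therefore its own conjugate. *)
Lemma sym_real a n : sym a n = (qre (sym a n))%:A.
Proof.
apply: qconj_selfP; rewrite /sym /star.
rewrite (qconj_sum n.+1 (fun k => a k * conjc a (n - k)%N)).
rewrite (reindex_inj rev_ord_inj) /=; apply: eq_bigr => i _.
by rewrite subSS qconjM /conjc qconjK subKn// -ltnS.
Qed.

End PowerSeries.

(** * Differentiability of power series *)

Section PowerSeriesDiff.
Context {R : realType}.
Local Notation H := (quat R).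
Implicit Types (p q z w : H) (x y s t : R) (a b : nat -> H).

(** The differential at [q] of the [n]-th power, applied to [k]; the factors do
    not commute in general. *)
Fixpoint dpow q k n : H := if n is n'.+1 then dpow q k n' * q + q ^+ n' * k else 0.

Lemma dpowD q k k' n : dpow q (k + k') n = dpow q k n + dpow q k' n.
Proof.
elim: n => [|n IH] /=; first by rewrite addr0.
by rewrite IH mulrDl mulrDr addrACA.
Qed.

Lemma dpowZ q x k n : dpow q (x *: k) n = x *: dpow q k n.
Proof.
elim: n => [|n IH] /=; first by rewrite scaler0.
by rewrite IH -scalerAl -scalerAr scalerDr.
Qed.

Lemma dpow_comm q k n : k * q = q * k -> dpow q k n = k * dpow q 1 n.
Proof.
move=> kq; have kqn m : k * q ^+ m = q ^+ m * k.
  by elim: m => [|m IH]; rewrite ?expr0 ?mulr1 ?mul1r// exprS mulrA kq -mulrA IH mulrA.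
elim: n => [|n IH] /=; first by rewrite mulr0.
by rewrite IH mulr1 mulrDr mulrA kqn.
Qed.

Lemma dpow_le q k (d : R) n : 0 < d ->
  `|dpow q k n| <= `|k| / d * (`|q| + d) ^+ n.
Proof.
move=> d0; have kd : 0 <= `|k| / d by rewrite divr_ge0// ltW.
elim: n => [|n IH] /=; first by rewrite normr0 mulr_ge0.
apply: le_trans (ler_normD _ _) _; rewrite !qnormM qnormX exprSr.
rewrite mulrA mulrDr; apply: lerD; first by rewrite ler_wpM2r.
rewrite -mulrA [X in _ <= _ * X]mulrC mulrA divfK ?gt_eqF// mulrC.
by rewrite ler_wpM2l// lerXn2r ?nnegrE ?addr_ge0 ?(ltW d0)// lerDl ltW.
Qed.

(** Both bounds follow by comparison with the commutative expansion of
    [(|q| + d) ^ n]: the terms of degree at least [j] in [k] gain a factor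
    [(|k| / d) ^ j] there. *)
Lemma pow_diff_le q k (d : R) n : 0 < d -> `|k| <= d ->
  `|(q + k) ^+ n - q ^+ n| <= `|k| / d * ((`|q| + d) ^+ n - `|q| ^+ n) /\
  `|(q + k) ^+ n - q ^+ n - dpow q k n| <=
    (`|k| / d) ^+ 2 * ((`|q| + d) ^+ n - `|q| ^+ n).
Proof.
move=> d0 kd; set e := `|k| / d; set A := `|q|; set B := A + d.
have e0 : 0 <= e by rewrite divr_ge0// ltW.
have ed : `|k| = e * d by rewrite /e divfK// gt_eqF.
have A0 : 0 <= A by rewrite normr_ge0.
have AB : A <= B by rewrite lerDl ltW.
have qkB : `|q + k| <= B by apply: le_trans (ler_normD _ _) _; rewrite lerD2l.
have AnBn n' : A ^+ n' <= B ^+ n' by rewrite lerXn2r// nnegrE// (le_trans A0).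
elim: n => [|n [IH1 IH2]] /=.
  by rewrite !expr0 !subrr !normr0 !mulr0.
have G0 : 0 <= B ^+ n - A ^+ n by rewrite subr_ge0.
split.
  rewrite (_ : _ - _ = ((q + k) ^+ n - q ^+ n) * (q + k) + q ^+ n * k); last first.
    by rewrite !exprSr mulrBl -addrA; congr (_ + _); rewrite mulrDr opprD subrK.
  apply: le_trans (ler_normD _ _) _; rewrite !qnormM qnormX ed.
  apply: (@le_trans _ _ (e * (B ^+ n - A ^+ n) * B + A ^+ n * (e * d))).
    by rewrite lerD2r; apply: ler_pM.
  by rewrite !exprSr le_eqVlt; apply/orP; left; apply/eqP; rewrite /B; ring.
rewrite (_ : _ - _ - _ = ((q + k) ^+ n - q ^+ n - dpow q k n) * q +
    ((q + k) ^+ n - q ^+ n) * k); last first.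
  rewrite !exprSr !mulrBl mulrDr opprD !addrA; congr (_ - _).
  by rewrite [RHS]addrAC; congr (_ - _); rewrite [RHS]addrAC.
apply: le_trans (ler_normD _ _) _; rewrite !qnormM ed.
apply: (@le_trans _ _ (e ^+ 2 * (B ^+ n - A ^+ n) * A +
    e * (B ^+ n - A ^+ n) * (e * d))).
  by rewrite lerD// ler_wpM2r// mulr_ge0// ltW.
rewrite [leLHS](_ : _ = e ^+ 2 * ((B ^+ n - A ^+ n) * B)); last by rewrite /B; ring.
rewrite ler_wpM2l ?exprn_ge0// !exprSr mulrBl lerB// ler_wpM2l//.
by rewrite exprn_ge0.
Qed.

(** A single estimate yields differentiability on the whole space and, since
    [L k = k * L 1] for increments commuting with [q], complex differentiability
    on the slices. *)
Lemma psum_expansion s a q : gbound s a -> `|q| < s ->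
  exists L : H -> H, exists C d : R,
  [/\ forall x k k', L (x *: k + k') = x *: L k + L k',
      0 < d, 0 <= C,
      forall k, `|L k| <= C * `|k|
    & (forall k, `|k| <= d ->
        `|psum a (q + k) - psum a q - L k| <= C * `|k| ^+ 2) /\
      (forall k, k * q = q * k -> L k = k * L 1)].
Proof.
move=> ha qs; have s0 : 0 < s by exact: le_lt_trans qs.
have [d [B [d0 BE Bs]]] : exists d, exists B, [/\ 0 < d, B = `|q| + d & B < s].
  by exists ((s - `|q|) / 2), (`|q| + (s - `|q|) / 2); split; lra.
have B0 : 0 < B by rewrite BE ltr_wpDl.
have Bs1 : B / s < 1 by rewrite ltr_pdivrMr// mul1r.
have Bs0 : 0 <= B / s by rewrite divr_ge0// ltW.
have [C hC] := ha.
have C0 : 0 <= C by have := hC 0%N; rewrite expr0 mulr1; apply: le_trans.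
(* The terms of the differential, which is the sum of the differentials of the
   monomials. *)
pose u k n := dpow q k n * a n.
have aB n : `|a n| * B ^+ n <= C * (B / s) ^+ n.
  rewrite expr_div_n mulrA ler_pdivlMr ?exprn_gt0// mulrAC ler_wpM2r//.
  by rewrite exprn_ge0// ltW.
have hu k n : `|u k n| <= C * (`|k| / d) * (B / s) ^+ n.
  rewrite /u qnormM.
  apply: (@le_trans _ _ (`|k| / d * B ^+ n * `|a n|)).
    by rewrite ler_wpM2r// BE dpow_le.
  rewrite -mulrA [B ^+ n * _]mulrC.
  apply: le_trans (ler_wpM2l _ (aB n)) _; first by rewrite divr_ge0// ltW.
  by rewrite mulrCA mulrA.
have cu k : series (u k) @ \oo --> lim (series (u k) @ \oo).
  exact: (geo_cvg Bs0 Bs1 (hu k)).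
exists (fun k => lim (series (u k) @ \oo)).
(* The two summands bound the differential and the remainder, respectively. *)
exists (C / d / (1 - B / s) + C / d ^+ 2 / (1 - B / s)), d.
have sB : 0 < 1 - B / s by rewrite subr_gt0.
have K1 : 0 <= C / d / (1 - B / s) by rewrite divr_ge0 ?(ltW sB)// divr_ge0// ltW.
have K2 : 0 <= C / d ^+ 2 / (1 - B / s) by rewrite divr_ge0 ?(ltW sB)// divr_ge0// exprn_ge0// ltW.
split => //.
- move=> x k k'; apply: cvg_lim => //.
  rewrite [X in X @ _](_ : _ = fun n => x *: series (u k) n + series (u k') n).
    by apply: cvgD => //; exact: cvgZl_tmp.
  apply/funext => n; rewrite /series /= scaler_sumr -big_split /=.
  by apply: eq_bigr => i _; rewrite /u dpowD dpowZ mulrDl scalerAl.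
- by rewrite addr_ge0.
- move=> k; apply: le_trans (geo_lim_le Bs0 Bs1 (hu k) (cu k)) _.
  rewrite mulrDl -[leLHS]addr0; apply: lerD; last exact: mulr_ge0 K2 (normr_ge0 k).
  by rewrite le_eqVlt; apply/orP; left; apply/eqP; ring.
split=> [k kd|k kq]; last first.
  apply: cvg_lim => //.
  rewrite [X in X @ _](_ : _ = fun n => k * series (u 1) n).
    exact: cvg_qmull.
  apply/funext => n; rewrite /series /= mulr_sumr.
  by apply: eq_bigr => i _; rewrite /u dpow_comm// mulrA.
have qks : `|q + k| < s.
  by apply: le_lt_trans (ler_normD _ _) _; apply: le_lt_trans Bs; rewrite BE lerD2l.
pose v n := ((q + k) ^+ n - q ^+ n - dpow q k n) * a n.
have cv : series v @ \oo --> psum a (q + k) - psum a q - lim (series (u k) @ \oo).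
  rewrite [X in X @ _](_ : _ = fun n => series (pterm a (q + k)) n -
    series (pterm a q) n - series (u k) n).
    by apply: cvgB => //; apply: cvgB; exact: (psum_cvg ha).
  apply/funext => n; rewrite /series /= -!sumrB.
  by apply: eq_bigr => i _; rewrite /v /u /pterm !mulrBl.
have hv n : `|v n| <= C * (`|k| / d) ^+ 2 * (B / s) ^+ n.
  rewrite /v qnormM.
  apply: (@le_trans _ _ ((`|k| / d) ^+ 2 * B ^+ n * `|a n|)).
    rewrite ler_wpM2r//; have [_ h] := pow_diff_le q n d0 kd.
    apply: le_trans h _; rewrite ler_wpM2l ?exprn_ge0 ?divr_ge0 ?(ltW d0)//.
    by rewrite BE lerBlDr lerDl exprn_ge0.
  rewrite -mulrA [B ^+ n * _]mulrC.
  apply: le_trans (ler_wpM2l _ (aB n)) _.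
    by rewrite exprn_ge0// divr_ge0// ltW.
  by rewrite mulrCA mulrA.
apply: le_trans (geo_lim_le Bs0 Bs1 hv cv) _.
rewrite mulrDl -[leLHS]add0r; apply: lerD.
  exact: mulr_ge0 K1 (exprn_ge0 _ (normr_ge0 k)).
rewrite le_eqVlt; apply/orP; left; apply/eqP; field.
by rewrite (gt_eqF s0) (gt_eqF d0) subr_eq0 (gt_eqF Bs).
Qed.

Lemma near_plane I z (P : set H) :
  (\forall w \near within (cplane I) (nbhs z), P w) <->
  exists2 d : R, 0 < d & forall w, cplane I w -> `|w - z| < d -> P w.
Proof.
rewrite near_withinE; split=> [/nbhs_ballP[d /= d0 h]|[d d0 h]].
  exists d => // w wI wz; apply: (h w) => //.
  by rewrite -ball_normE /= distrC.
apply/nbhs_ballP; exists d => // w; rewrite -ball_normE /= distrC => wz wI.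
exact: h.
Qed.

(** Complex differentiability on a slice, in Caratheodory's form: it turns the
    rules of calculus into continuity of sums and products. *)
Definition holo I (F : H -> H) z := exists phi : H -> H,
  (\forall w \near within (cplane I) (nbhs z), F w = F z + (w - z) * phi w) /\
  phi w @[w --> within (cplane I) (nbhs z)] --> phi z.

Section HoloTheory.
Variable I : H.
Hypothesis hI : imag_units I.

Lemma plane_near z : \forall w \near within (cplane I) (nbhs z), cplane I w.
Proof. exact: withinT. Qed.

Lemma cvg_plane_id z : (fun w : H => w) @ within (cplane I) (nbhs z) --> z.
Proof. exact: cvg_within. Qed.

(** The usual form of differentiability, with derivative [c] on the right. *)
Lemma holoP F z : holo I F z <-> exists c : H, forall e, 0 < e ->
  \forall w \near within (cplane I) (nbhs z),
    `|F w - F z - (w - z) * c| <= e * `|w - z|.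
Proof.
split=> [[phi [hphi cphi]]|[c hc]].
  exists (phi z) => e e0; have /cvgrPdist_le/(_ e e0) := cphi.
  move: hphi; apply: filterS2 => w -> h.
  by rewrite [F z + _]addrC addrK -mulrBr qnormM mulrC ler_wpM2r// distrC.
exists (fun w => if w == z then c else (w - z)^-1 * (F w - F z)); split.
  near=> w; have [->|wz] := eqVneq w z; first by rewrite subrr mul0r addr0.
  by rewrite mulrA qmulfV ?subr_eq0// mul1r addrC subrK.
rewrite eqxx; apply/cvgrPdist_le => e e0.
have /near_plane[d d0 hd] := hc e e0; apply/near_plane; exists d => // w wI wd.
have [_|wz] := eqVneq w z; first by rewrite subrr normr0 ltW.
have wz0 : 0 < `|w - z| by rewrite normr_gt0 subr_eq0.
rewrite distrC -(ler_pM2l wz0) -qnormM mulrBr mulrA qmulfV ?subr_eq0// mul1r.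
by rewrite [leRHS]mulrC; exact: hd.
Unshelve. all: by end_near. Qed.

Lemma holo_cvg F z : holo I F z -> F w @[w --> within (cplane I) (nbhs z)] --> F z.
Proof.
move=> [phi [hphi cphi]].
have h : (fun w => F z + (w - z) * phi w) @ within (cplane I) (nbhs z) -->
    F z + (z - z) * phi z.
  apply: cvgD; first exact: cvg_cst.
  by apply: cvg_qmul => //; apply: cvgB; [exact: cvg_plane_id|exact: cvg_cst].
rewrite subrr mul0r addr0 in h.
by apply: cvg_trans h; apply: near_eq_cvg; apply: filterS hphi.
Qed.

Lemma holo_near F G z : cplane I z ->
  (\forall w \near within (cplane I) (nbhs z), F w = G w) -> holo I F z -> holo I G z.
Proof.
move=> zI FG [phi [hphi cphi]]; exists phi; split => //.
have Gz : F z = G z by have /near_plane[d d0] := FG; apply=> //; rewrite subrr normr0.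
by move: FG hphi; apply: filterS2 => w <-; rewrite Gz.
Qed.

Lemma holo_cst c z : holo I (fun=> c) z.
Proof.
exists (fun=> 0); split; last exact: cvg_cst.
by near=> w; rewrite mulr0 addr0.
Unshelve. all: by end_near. Qed.

Lemma holo_id z : holo I id z.
Proof.
exists (fun=> 1); split; last exact: cvg_cst.
by near=> w; rewrite mulr1 addrC subrK.
Unshelve. all: by end_near. Qed.

Lemma holoD F G z : holo I F z -> holo I G z -> holo I (fun w => F w + G w) z.
Proof.
move=> [f [hf cf]] [g [hg cg]]; exists (fun w => f w + g w); split.
  by move: hf hg; apply: filterS2 => w -> ->; rewrite mulrDr addrACA.
exact: cvgD.
Qed.

Lemma holoMr F c z : holo I F z -> holo I (fun w => F w * c) z.
Proof.
move=> [f [hf cf]]; exists (fun w => f w * c); split; last exact: cvg_qmulr.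
by move: hf; apply: filterS => w ->; rewrite mulrDl mulrA.
Qed.

Lemma holoN F z : holo I F z -> holo I (fun w => - F w) z.
Proof.
by move=> /(holoMr (-1)); under [X in holo _ X]eq_fun do rewrite mulrN1.
Qed.

Lemma holoB F G z : holo I F z -> holo I G z -> holo I (fun w => F w - G w) z.
Proof. by move=> hF /holoN; exact: holoD. Qed.

(** Only left factors with values in the plane can be multiplied: they commute
    with the increments of the variable. *)
Lemma holoM T F z : cplane I z -> cplane I (T z) -> holo I T z -> holo I F z ->
  holo I (fun w => T w * F w) z.
Proof.
move=> zI TI hT hF; have cF := holo_cvg hF.
case: hT => t [ht ct]; case: hF => f [hf cf].
exists (fun w => t w * F w + T z * f w); split; last first.
  by apply: cvgD; [exact: cvg_qmul|exact: cvg_qmull].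
move: ht hf (plane_near z); apply: filterS3 => w ht hf wI.
have ew : (w - z) * f w = F w - F z by rewrite hf [F z + _]addrC addrK.
have et : (w - z) * t w = T w - T z by rewrite ht [T z + _]addrC addrK.
rewrite mulrDr [(w - z) * (t w * _)]mulrA et [(w - z) * (T z * _)]mulrA.
have -> : (w - z) * T z = T z * (w - z).
  by apply: (cplane_comm (I := I)) => //; exact: cplaneB.
by rewrite -[T z * _ * _]mulrA ew mulrBl mulrBr subrKA addrC subrK.
Qed.

Lemma holoV T z : cplane I z -> (\forall w \near within (cplane I) (nbhs z), cplane I (T w)) ->
  T z != 0 -> holo I T z -> holo I (fun w => (T w)^-1) z.
Proof.
move=> zI TI Tz0 hT; have cT := holo_cvg hT.
case: hT => t [ht ct].
exists (fun w => - ((T w)^-1 * t w * (T z)^-1)); split; last first.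
  by apply: cvgN; apply: cvg_qmulr; apply: cvg_qmul => //; exact: cvg_qinv.
have nT : \forall w \near within (cplane I) (nbhs z), cplane I w /\ T w != 0.
  by apply: filterI; [exact: plane_near|exact: cvgr_neq0 cT Tz0].
move: ht TI nT; apply: filterS3 => w ht TI [wI nTw].
have et : (w - z) * t w = T w - T z by rewrite ht [T z + _]addrC addrK.
rewrite mulrN !mulrA.
have -> : (w - z) * (T w)^-1 = (T w)^-1 * (w - z).
  by apply: (cplane_comm (I := I)) => //; [exact: cplaneB|exact: cplaneV].
rewrite -[_ * _ * t w]mulrA et mulrBr qmulVf// mulrBl mul1r -mulrA qmulfV// mulr1.
by rewrite opprB addrC subrK.
Qed.

Lemma psum_holo s a c z : cplane I c -> cplane I z -> gbound s a -> `|z - c| < s ->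
  holo I (fun w => psum a (w - c)) z.
Proof.
move=> cI zI ha zs.
have [L [C [d [_ d0 C0 _ [hE hc]]]]] := psum_expansion ha zs.
apply/holoP; exists (L 1) => e e0; apply/near_plane.
exists (Order.min d (e / (C + 1))); first by rewrite lt_min d0 divr_gt0// ltr_wpDl.
move=> w wI; rewrite lt_min => /andP[wd we].
have := hE (w - z) (ltW wd); rewrite -hc; last first.
  by apply: (cplane_comm (I := I)); apply: cplaneB.
rewrite [z - c + _]addrC addrA subrK => h; apply: le_trans h _.
rewrite expr2 mulrA ler_wpM2r//.
apply: (@le_trans _ _ (C * (e / (C + 1)))); first by rewrite ler_wpM2l// ltW.
by rewrite mulrCA ler_piMr ?(ltW e0)// ler_pdivrMr ?mul1r ?ltr_wpDl//; lra.
Qed.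

End HoloTheory.

(** * Regular functions *)

Lemma derive1_slice_x (f : H -> H) I x y :
  derive1 (fun s : R => f (slice I s y)) x = 'D_1 f (slice I x y).
Proof.
rewrite derive1E /derive; apply: (congr1 (fun g : R -> H => lim (g @ 0^'))).
by apply/funext => h /=; rewrite /slice qrealD addrA [h *: 1%R]mulr1.
Qed.

Lemma derive1_slice_y (f : H -> H) I x y :
  derive1 (fun t : R => f (slice I x t)) y = 'D_I f (slice I x y).
Proof.
rewrite derive1E /derive; apply: (congr1 (fun g : R -> H => lim (g @ 0^'))).
by apply/funext => h /=; rewrite /slice qrealD mulrDr addrCA mulr_algr [h *: 1%R]mulr1.
Qed.

Lemma differentiable_expansion (f : H -> H) z e : differentiable f z -> 0 < e ->
  exists2 d : R, 0 < d & forall k, `|k| < d ->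
    `|f (z + k) - f z - 'd f z k| <= e * `|k|.
Proof.
move=> /diff_locallyP[_ /eqaddoP hd] e0.
have /nbhs_ballP[d /= d0 h] := hd e e0; exists d => // k kd.
have /h : ball (0 : H) d k by rewrite -ball_normE /= sub0r normrN.
by rewrite /= !fctE /= opprD addrA [k + z]addrC.
Qed.

(** A linear map with the usual remainder estimate is the differential; the bound
    on [L] makes it continuous. *)
Lemma differentiable_intro (f L : H -> H) z (C : R) :
  (forall x k k', L (x *: k + k') = x *: L k + L k') ->
  (forall k, `|L k| <= C * `|k|) ->
  (forall e, 0 < e -> exists2 d : R, 0 < d & forall k, `|k| < d ->
    `|f (z + k) - f z - L k| <= e * `|k|) ->
  differentiable f z.
Proof.
move=> linL leL hL.
have cL : continuous L.
  move=> w; apply/(@cvgrPdist_le _ _ _ (nbhs w) (nbhs_filter w)) => e e0.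
  apply/nbhs_ballP.
  exists (e / (`|C| + 1)) => /=; first by rewrite divr_gt0// ltr_wpDl.
  move=> w'; rewrite -ball_normE /= => ww'.
  have -> : L w - L w' = L (w - w').
    by rewrite -[w in LHS](subrK w') -{1}[w - w']scale1r linL scale1r addrK.
  apply: le_trans (leL _) _; apply: (@le_trans _ _ ((`|C| + 1) * `|w - w'|)).
    by rewrite ler_wpM2r// (le_trans (ler_norm _))// lerDl.
  by rewrite mulrC -ler_pdivlMr ?ltr_wpDl// ltW.
pose dlM := GRing.isLinear.Build _ _ _ _ _ linL.
pose dL : {linear H -> H} := HB.pack L dlM.
have oL : f \o shift z = cst (f z) + dL +o_ (0 : H) id.
  apply/eqaddoP => e e0; have [d d0 hd] := hL e e0.
  apply/nbhs_ballP; exists d => // k; rewrite -ball_normE /= sub0r normrN => kd.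
  by rewrite !fctE /= opprD addrA [k + z]addrC; exact: hd.
have dE := diff_unique (cL : continuous dL) oL.
by apply/diff_locallyP; rewrite dE.
Qed.

(** The Cauchy-Riemann equation on the slice: since [I] squares to [-1], the
    vanishing of [dbar] determines the differential in the direction [I] from the
    one in the direction [1]. *)
Lemma diff_slice (f : H -> H) I x y : imag_units I ->
  differentiable f (slice I x y) -> dbar f I x y = 0 ->
  forall k, cplane I k -> 'd f (slice I x y) k = k * 'd f (slice I x y) 1.
Proof.
move=> hI df; rewrite /dbar derive1_slice_x derive1_slice_y.
rewrite !deriveE// => /eqP; rewrite scaler_eq0 invr_eq0 pnatr_eq0 /= => /eqP h.
have dI : 'd f (slice I x y) I = I * 'd f (slice I x y) 1.
  have : I * ('d f (slice I x y) 1 + I * 'd f (slice I x y) I) = 0.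
    by rewrite h mulr0.
  rewrite mulrDr mulrA imag_unit_sqr// mulN1r => /eqP.
  by rewrite subr_eq0 => /eqP.
move=> _ [a [b ->]]; have -> : slice I a b = a *: 1 + b *: I.
  by rewrite /slice mulr_algr.
by rewrite linearD !linearZ /= dI mulrDl -!scalerAl mul1r.
Qed.

Lemma regular_holo (D : set H) f I z : regular D f -> D z -> imag_units I ->
  cplane I z -> holo I f z.
Proof.
move=> [_ df db] Dz hI [x [y zE]]; subst z.
have dz := df _ Dz; have dk := diff_slice hI dz (db _ _ _ hI Dz).
apply/holoP; exists ('d f (slice I x y) 1) => e e0; apply/near_plane.
have [d d0 hd] := differentiable_expansion dz e0; exists d => // w wI wd.
have := hd _ wd; rewrite [slice I x y + _]addrC subrK dk//.
by apply: cplaneB => //; exact: cplane_slice.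
Qed.

(** The real differential agrees with the complex one on the directions [1] and
    [I] of the slice, where the latter is multiplication on the left. *)
Lemma regular_intro (D : set H) f : open D ->
  (forall q, D q -> differentiable f q) ->
  (forall I z, imag_units I -> D z -> cplane I z -> holo I f z) -> regular D f.
Proof.
move=> oD df hf; split => // I x y hI Dz.
have dz := df _ Dz; have /holoP[c hc] := hf _ _ hI Dz (cplane_slice I x y).
suff dk k : cplane I k -> `|k| = 1 -> 'd f (slice I x y) k = k * c.
  rewrite /dbar derive1_slice_x derive1_slice_y !deriveE// (dk 1 (cplane1 I) qnorm1).
  rewrite (dk I (cplane_unit I) (imag_unit_norm hI)).
  by rewrite mul1r mulrA imag_unit_sqr// mulN1r subrr scaler0.
move=> kI k1; apply/eqP; rewrite -subr_eq0 -normr_le0.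
apply/ler_addgt0Pl => e e0; rewrite addr0.
have e2 : 0 < e / 2 by rewrite divr_gt0.
have [d d0 hd] := differentiable_expansion dz e2.
have /near_plane[d' d'0 hd'] := hc _ e2.
pose t := Order.min d d' / 2.
have t0 : 0 < t by rewrite divr_gt0// lt_min d0.
have [td td'] : t < d /\ t < d'.
  have : t < Order.min d d' by rewrite ltr_pdivrMr// ltr_pMr ?ltr1n// lt_min d0.
  by rewrite lt_min => /andP[].
have ntk : `|t *: k| = t by rewrite normrZ k1 mulr1 gtr0_norm.
have h1 : `|f (slice I x y + t *: k) - f (slice I x y) -
    'd f (slice I x y) (t *: k)| <= e / 2 * t.
  by have := hd (t *: k); rewrite ntk; exact.
have h2 : `|f (slice I x y + t *: k) - f (slice I x y) - (t *: k) * c| <= e / 2 * t.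
  have := hd' (slice I x y + t *: k); rewrite addrC addrK ntk; apply=> //.
  by apply: cplaneD; [exact: cplaneZ|exact: cplane_slice].
rewrite -(ler_pM2l t0) -[X in X * `|_|](gtr0_norm t0) -normrZ.
rewrite scalerBr -linearZ scalerAl /=.
apply: (le_trans (ler_distD (f (slice I x y + t *: k) - f (slice I x y)) _ _)).
rewrite [t * e](_ : _ = e / 2 * t + e / 2 * t); last by field.
by apply: lerD; [rewrite distrC; exact: h1|exact: h2].
Qed.

Lemma psum_differentiable s a q : gbound s a -> `|q| < s ->
  differentiable (psum a) q.
Proof.
move=> ha qs; have [L [C [d [linL d0 C0 leL [hE _]]]]] := psum_expansion ha qs.
apply: (differentiable_intro linL leL) => e e0.
exists (Order.min d (e / (C + 1))); first by rewrite lt_min d0 divr_gt0// ltr_wpDl.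
move=> k; rewrite lt_min => /andP[kd ke]; apply: le_trans (hE k (ltW kd)) _.
rewrite expr2 mulrA ler_wpM2r//.
apply: (@le_trans _ _ (C * (e / (C + 1)))); first by rewrite ler_wpM2l// ltW.
by rewrite mulrCA ler_piMr ?(ltW e0)// ler_pdivrMr ?mul1r ?ltr_wpDl//; lra.
Qed.

Lemma qinv_differentiable (q : H) : q != 0 -> differentiable (fun w : H => w^-1) q.
Proof.
move=> q0; have nq : 0 < `|q| by rewrite normr_gt0.
apply: (@differentiable_intro _ (fun k => - (q^-1 * k * q^-1)) _ (`|q|^-1 * `|q|^-1)).
- move: q^-1 => u x k k'.
  by rewrite mulrDr mulrDl opprD -scalerAr -scalerAl scalerN.
- by move=> k; rewrite normrN !qnormM !qnormV mulrAC.
move=> e e0.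
exists (Order.min (`|q| / 2) (e * (`|q| ^+ 3 / 2))).
  by rewrite lt_min !mulr_gt0// ?invr_gt0// exprn_gt0.
move=> k; rewrite lt_min => /andP[kq ke].
have nqk : `|q| / 2 <= `|q + k|.
  have : `|q| - `|k| <= `|q + k| by have := lerB_normD q k.
  by apply: le_trans; lra.
have qk0 : q + k != 0 by rewrite -normr_gt0; apply: lt_le_trans nqk; rewrite divr_gt0.
have -> : (q + k)^-1 - q^-1 - - (q^-1 * k * q^-1) = (q + k)^-1 * k * q^-1 * k * q^-1.
  have e1 : (q + k)^-1 - q^-1 = - ((q + k)^-1 * k * q^-1).
    have {3}-> : k = (q + k) - q by rewrite addrC addKr.
    by rewrite mulrBr mulrBl qmulVf// mul1r -mulrA qmulfV// mulr1 opprB.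
  rewrite opprK e1 -mulNr -mulrDl -mulNr -mulrDl addrC.
  have -> : q^-1 + - (q + k)^-1 = (q + k)^-1 * k * q^-1.
    by rewrite -[LHS]opprB e1 opprK.
  by [].
rewrite !qnormM !qnormV.
apply: (@le_trans _ _ (2 / `|q| * `|k| / `|q| * `|k| / `|q|)).
  do 4 (rewrite ler_wpM2r ?invr_ge0//).
  by rewrite -(invf_div `|q|) lef_pV2 ?posrE ?divr_gt0// (lt_le_trans _ nqk)// divr_gt0.
rewrite [leLHS](_ : _ = `|k| / (`|q| ^+ 3 / 2) * `|k|); last first.
  by field; rewrite gt_eqF.
by rewrite ler_wpM2r// ler_pdivrMr ?divr_gt0 ?exprn_gt0// ltW.
Qed.

Lemma qmul_is_bilinear : bilinear_for
  (GRing.Scale.Law.clone R H *:%R _) (GRing.Scale.Law.clone R H *:%R _)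
  (@GRing.mul H).
Proof.
split=> [u'|u] a x y /=.
- by rewrite mulrDl scalerAl.
- by rewrite mulrDr scalerAr.
Qed.
Definition qmul_bilinear : {bilinear H -> H -> H} := HB.pack (@GRing.mul H) (bilinear_isBilinear.Build R H H H _ _ (@GRing.mul H)
  qmul_is_bilinear).
Lemma qmul_differentiable (F G : H -> H) q : differentiable F q ->
  differentiable G q -> differentiable (fun w => F w * G w) q.
Proof.
move=> dF dG.
have dm := @differentiable_bilin R H H H qmul_bilinear (F q, G q).
have cm : continuous (fun p : H * H => p.1 * p.2).
  by move=> -[u v]; apply: cvg_qmul; [exact: cvg_fst|exact: cvg_snd].
have dp := differentiable_pair dF dG.
have := differentiable_comp dp (dm cm).
done.
Qed.

End PowerSeriesDiff.

(** * Integrals *)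

Section Integral.
Context {R : realType}.
Local Notation H := (quat R).
Local Notation mu := (@lebesgue_measure R).
Implicit Types (a b x y t : R) (u v : R -> H).

Definition contab a b u := forall t, a <= t <= b -> u s @[s --> t] --> u t.

Definition qint a b u : H := Quat
  (\int[mu]_(t in `[a, b]) qre (u t)) (\int[mu]_(t in `[a, b]) qi (u t))
  (\int[mu]_(t in `[a, b]) qj (u t)) (\int[mu]_(t in `[a, b]) qk (u t)).

Lemma integrable_itv a b (f : R -> R) :
  (forall t, a <= t <= b -> f s @[s --> t] --> f t) ->
  mu.-integrable `[a, b] (EFin \o f).
Proof.
move=> cf; apply: continuous_compact_integrable; first exact: segment_compact.
apply: continuous_in_subspaceT => t; rewrite inE /= in_itv /= => tab.
exact: cf.
Qed.

Lemma integrable_comps a b u : contab a b u ->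
  [/\ mu.-integrable `[a, b] (EFin \o (@qre R \o u)),
      mu.-integrable `[a, b] (EFin \o (@qi R \o u)),
      mu.-integrable `[a, b] (EFin \o (@qj R \o u))
    & mu.-integrable `[a, b] (EFin \o (@qk R \o u))].
Proof.
move=> cu; split; apply: integrable_itv => t tab.
- by apply: cvg_qre; exact: cu.
- by apply: cvg_qi; exact: cu.
- by apply: cvg_qj; exact: cu.
- by apply: cvg_qk; exact: cu.
Qed.

Lemma Rintegral_lin4 a b (f1 f2 f3 f4 : R -> R) (c1 c2 c3 c4 : R) :
  mu.-integrable `[a, b] (EFin \o f1) -> mu.-integrable `[a, b] (EFin \o f2) ->
  mu.-integrable `[a, b] (EFin \o f3) -> mu.-integrable `[a, b] (EFin \o f4) ->
  \int[mu]_(t in `[a, b]) (c1 * f1 t + c2 * f2 t + c3 * f3 t + c4 * f4 t) =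
  c1 * \int[mu]_(t in `[a, b]) f1 t + c2 * \int[mu]_(t in `[a, b]) f2 t +
  c3 * \int[mu]_(t in `[a, b]) f3 t + c4 * \int[mu]_(t in `[a, b]) f4 t.
Proof.
move=> h1 h2 h3 h4.
have intZ f c : mu.-integrable `[a, b] (EFin \o f) ->
    mu.-integrable `[a, b] (EFin \o (fun t => c * f t)).
  move=> hf; rewrite (_ : _ \o _ = (fun t => c%:E * (EFin \o f) t)%E).
    exact: integrableZl.
  by apply/funext => t /=; rewrite EFinM.
have intD f g : mu.-integrable `[a, b] (EFin \o f) ->
    mu.-integrable `[a, b] (EFin \o g) ->
    mu.-integrable `[a, b] (EFin \o (fun t => f t + g t)).
  move=> hf hg; rewrite (_ : _ \o _ = ((EFin \o f) \+ (EFin \o g))%E).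
    exact: integrableD.
  by apply/funext => t /=; rewrite EFinD.
have k1 := intZ _ c1 h1; have k2 := intZ _ c2 h2; have k3 := intZ _ c3 h3.
have k4 := intZ _ c4 h4; have k12 := intD _ _ k1 k2; have k123 := intD _ _ k12 k3.
rewrite (RintegralD _ k123 k4)// (RintegralD _ k12 k3)// (RintegralD _ k1 k2)//.
by rewrite !RintegralZl.
Qed.

(** The integral is taken componentwise; hence it commutes with every real linear
    map, in particular with both multiplications by a quaternion. *)
Lemma qint_linear a b u (L : H -> H) : contab a b u ->
  (forall q, L q = qre q *: L 1 + qi q *: L qI + qj q *: L qJ + qk q *: L qK) ->
  qint a b (L \o u) = L (qint a b u).
Proof.
move=> /integrable_comps[h1 h2 h3 h4] hL.
have E (phi : H -> R) : (forall q q', phi (q + q') = phi q + phi q') ->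
   (forall x q, phi (x *: q) = x * phi q) ->
   \int[mu]_(t in `[a, b]) phi (L (u t)) = phi (L (qint a b u)).
  move=> phiD phiZ; rewrite hL !phiD !phiZ.
  rewrite ![_ * phi (L _)]mulrC -Rintegral_lin4//.
  apply: eq_Rintegral => t _; rewrite hL !phiD !phiZ.
  by rewrite ![_ * phi (L _)]mulrC.
by apply: quatP; split; rewrite /= E.
Qed.

Lemma qint_mull a b u (c : H) : contab a b u ->
  qint a b (fun t => c * u t) = c * qint a b u.
Proof.
move=> cu; apply: (@qint_linear _ _ _ (fun q => c * q)) => // q.
by rewrite {1}(quat_basis q) !mulrDr !scalerAr.
Qed.

Lemma qint_mulr a b u (c : H) : contab a b u ->
  qint a b (fun t => u t * c) = qint a b u * c.
Proof.
move=> cu; apply: (@qint_linear _ _ _ (fun q => q * c)) => // q.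
by rewrite {1}(quat_basis q) !mulrDl !scalerAl.
Qed.

Lemma qintB a b u v : contab a b u -> contab a b v ->
  qint a b (fun t => u t - v t) = qint a b u - qint a b v.
Proof.
move=> /integrable_comps[h1 h2 h3 h4] /integrable_comps[k1 k2 k3 k4].
by apply: quatP; split; rewrite /= RintegralB.
Qed.

Lemma qint_cst a b (c : H) : a <= b -> qint a b (fun=> c) = (b - a) *: c.
Proof.
move=> ab; have E r : \int[mu]_(t in `[a, b]) r = (b - a) * r.
  rewrite Rintegral_cst//= lebesgue_measure_itv /= lte_fin mulrC.
  by case: ltrP => // ba; have -> : b - a = 0 by lra.
by apply: quatP; split; rewrite /= E.
Qed.

Lemma eq_qint a b u v : (forall t, a <= t <= b -> u t = v t) ->
  qint a b u = qint a b v.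
Proof.
move=> uv; apply: quatP; split => /=; apply: eq_Rintegral => t;
  by rewrite inE /= in_itv /= => /uv ->.
Qed.

Lemma qint_cat a c b u : a <= c <= b -> contab a b u ->
  qint a b u = qint a c u + qint c b u.
Proof.
move=> /andP[ac cb] /integrable_comps[h1 h2 h3 h4].
have E f : mu.-integrable `[a, b] (EFin \o f) ->
    \int[mu]_(t in `[a, b]) f t =
    \int[mu]_(t in `[a, c]) f t + \int[mu]_(t in `[c, b]) f t.
  move=> hf; have := Rintegral_itvB hf (x := c).
  rewrite !bnd_simp => /(_ ac cb) h.
  rewrite -[X in _ = _ + X]Rintegral_itv_obnd_cbnd; first by rewrite -h addrC subrK.
  apply: integrableS hf => //; apply: subset_itvr; by rewrite bnd_simp.
by apply: quatP; split; rewrite /= E.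
Qed.

(** The factor 4 comes from bounding the four components separately. *)
Lemma qint_le a b u (M : R) : a <= b -> contab a b u ->
  (forall t, a <= t <= b -> `|u t| <= M) -> `|qint a b u| <= 4 * M * (b - a).
Proof.
move=> ab /integrable_comps[h1 h2 h3 h4] uM.
have E (phi : H -> R) : (forall q, `|phi q| <= `|q|) ->
    mu.-integrable `[a, b] (EFin \o (phi \o u)) ->
    `|\int[mu]_(t in `[a, b]) phi (u t)| <= M * (b - a).
  move=> hphi hi; apply: le_trans (le_normr_Rintegral _ _) _ => //.
  have -> : M * (b - a) = \int[mu]_(t in `[a, b]) M.
    have := congr1 (@qre R) (qint_cst (M%:A) ab); rewrite /= !mulr1 => ->.
    by rewrite mulrC.
  apply: le_Rintegral => //.
  - have := integrable_norm hi; rewrite (_ : _ \o _ = EFin \o (fun t => `|phi (u t)|))//.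
  - by apply: integrable_itv => t _; exact: cvg_cst.
  - by move=> t; rewrite /= in_itv /= => /uM; apply: le_trans.
apply: le_trans (qnorm_le4 _) _; rewrite /=.
have := E _ (@qre_le R) h1; have := E _ (@qi_le R) h2.
have := E _ (@qj_le R) h3; have := E _ (@qk_le R) h4; lra.
Qed.

End Integral.

(** * Bisection of rectangles *)

Section Cousin.
Context {R : realType}.
Variables (P : R -> R -> R -> Prop) (x0 y0 h k : R).
Hypotheses (h0 : 0 <= h) (k0 : 0 <= k).

(* The rectangle [x, x + h t] * [y, y + k t] lies in the given one. *)
Let inside x y t := [/\ x0 <= x, x + h * t <= x0 + h, y0 <= y & y + k * t <= y0 + k].

(** Bisection of rectangles of a fixed shape: a property which passes from the
    four quarters of a rectangle to the rectangle, and which holds for all small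
    rectangles around each point, holds. *)
Lemma rectangle_bisection :
  (forall x y t, 0 < t -> inside x y (2 * t) ->
    P x y t -> P (x + h * t) y t -> P x (y + k * t) t ->
    P (x + h * t) (y + k * t) t -> P x y (2 * t)) ->
  (forall x y, x0 <= x <= x0 + h -> y0 <= y <= y0 + k ->
    exists2 d, 0 < d & forall x' y' t, 0 < t < d -> inside x' y' t ->
      x' <= x <= x' + h * t -> y' <= y <= y' + k * t -> P x' y' t) ->
  P x0 y0 1.
Proof.
move=> Hsub Hloc; apply: contrapT => nP.
(* A sequence of nested bad rectangles, of relative size [T n]. *)
pose T (n : nat) : R := 2^-1 ^+ n.
have T0 n : 0 < T n by rewrite exprn_gt0.
have TS n : 2 * T n.+1 = T n by rewrite /T exprS mulrA divff// mul1r.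
pose good n (z : R * R) := inside z.1 z.2 (T n) /\ ~ P z.1 z.2 (T n).
have step (nz : nat * (R * R)) : exists z', good nz.1 nz.2 ->
   good nz.1.+1 z' /\
   [/\ nz.2.1 <= z'.1, z'.1 + h * T nz.1.+1 <= nz.2.1 + h * T nz.1,
       nz.2.2 <= z'.2 & z'.2 + k * T nz.1.+1 <= nz.2.2 + k * T nz.1].
  case: nz => n [x y] /=.
  have [[[/= i1 i2 i3 i4] nPz]|ng] := pselect (good n (x, y)); last by exists (x, y).
  have hT : 0 <= h * T n.+1 by rewrite mulr_ge0// ltW.
  have kT : 0 <= k * T n.+1 by rewrite mulr_ge0// ltW.
  have hTn : h * T n = h * T n.+1 + h * T n.+1 by rewrite -TS; ring.
  have kTn : k * T n = k * T n.+1 + k * T n.+1 by rewrite -TS; ring.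
  apply: contrapT => nex; apply: nPz; rewrite /= -TS.
  have key z : x <= z.1 -> z.1 + h * T n.+1 <= x + h * T n ->
      y <= z.2 -> z.2 + k * T n.+1 <= y + k * T n -> P z.1 z.2 (T n.+1).
    move=> a1 a2 a3 a4; apply: contrapT => nPz; apply: nex; exists z => _.
    split=> //; split=> //; split; lra.
  apply: Hsub => //.
  - by rewrite /inside TS.
  - by apply: (key (x, y)) => /=; lra.
  - by apply: (key (x + h * T n.+1, y)) => /=; lra.
  - by apply: (key (x, y + k * T n.+1)) => /=; lra.
  - by apply: (key (x + h * T n.+1, y + k * T n.+1)) => /=; lra.
have [next hnext] := choice step.
pose z := fix z n := if n is n'.+1 then next (n', z n') else (x0, y0).
have gz n : good n (z n).
  elim: n => [|n IH]; last by have [] := hnext (n, z n) IH.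
  by split; rewrite /T expr0 ?mulr1//; split; rewrite /= ?mulr1.
have zS n : [/\ (z n).1 <= (z n.+1).1, (z n.+1).1 + h * T n.+1 <= (z n).1 + h * T n,
    (z n).2 <= (z n.+1).2 & (z n.+1).2 + k * T n.+1 <= (z n).2 + k * T n].
  by have [] := hnext (n, z n) (gz n).
have lim1 (c : R) (s : nat -> R) : 0 <= c -> (forall n, s n <= s n.+1) ->
    (forall n, s n.+1 + c * T n.+1 <= s n + c * T n) ->
    exists l, forall n, s n <= l <= s n + c * T n.
  move=> c0 s1 s2.
  have s1' n m : (n <= m)%N -> s n <= s m.
    by move=> /subnKC <-; elim: (m - n)%N => [|i IH]; rewrite ?addn0// addnS (le_trans IH).
  have s2' n m : (n <= m)%N -> s m + c * T m <= s n + c * T n.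
    by move=> /subnKC <-; elim: (m - n)%N => [|i IH]; rewrite ?addn0// addnS; apply: le_trans IH.
  have cT n : 0 <= c * T n by rewrite mulr_ge0// ltW.
  have sub m n : s m <= s n + c * T n.
    have [nm|mn] := leqP n m; first by apply: le_trans (s2' _ _ nm); rewrite lerDl.
    by apply: le_trans (s1' _ _ (ltnW mn)) _; rewrite lerDl.
  exists (sup (range s)) => n; apply/andP; split.
    apply: ub_le_sup; last by exists n.
    by exists (s 0%N + c * T 0%N) => _ [m _ <-].
  by apply: ge_sup; [exists (s 0%N), 0%N|move=> _ [m _ <-]].
have [x hx] := lim1 h (fun n => (z n).1) h0 (fun n => let: And4 a _ _ _ := zS n in a)
  (fun n => let: And4 _ a _ _ := zS n in a).
have [y hy] := lim1 k (fun n => (z n).2) k0 (fun n => let: And4 _ _ a _ := zS n in a)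
  (fun n => let: And4 _ _ _ a := zS n in a).
have [d d0 hd] : exists2 d, 0 < d & forall x' y' t, 0 < t < d -> inside x' y' t ->
      x' <= x <= x' + h * t -> y' <= y <= y' + k * t -> P x' y' t.
  apply: Hloc; first by have := hx 0%N; rewrite /= /T expr0 mulr1.
  by have := hy 0%N; rewrite /= /T expr0 mulr1.
have [n nd] : exists n, T n < d.
  have h2 : `|2^-1 : R| < 1 by rewrite gtr0_norm// invf_lt1// ltr1n.
  have /cvgrPdist_lt/(_ d d0)[N _ /(_ N (leqnn N))] := cvg_expr h2.
  by rewrite /= sub0r normrN gtr0_norm; [exists N|exact: T0].
have [ins nPn] := gz n; apply: nPn; apply: hd => //; by rewrite T0.
Qed.

End Cousin.

(** * The theorem of Cauchy and Goursat *)

Section Goursat.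
Context {R : realType}.
Local Notation H := (quat R).
Implicit Types (a b x y t : R).
Variables (I : H) (Psi : R -> R -> H).
Hypothesis hI : imag_units I.

(** Complex differentiability of a function of [x + I y]. *)
Definition cdiff x y := exists D : H, forall e, 0 < e -> exists2 d, 0 < d &
  forall a b, `|a| < d -> `|b| < d ->
    `|Psi (x + a) (y + b) - Psi x y - slice I a b * D| <= e * (`|a| + `|b|).

Lemma cdiff_cont x y : cdiff x y -> forall e, 0 < e -> exists2 d, 0 < d &
  forall a b, `|a| < d -> `|b| < d -> `|Psi (x + a) (y + b) - Psi x y| <= e.
Proof.
move=> [D hD] e e0; have [d d0 hd] := hD 1 ltr01.
exists (Order.min d (e / (2 * (1 + `|D|)))).
  by rewrite lt_min d0 divr_gt0// mulr_gt0// ltr_wpDr.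
move=> a b; rewrite !lt_min => /andP[ad ae] /andP[bd be].
have := hd a b ad bd; rewrite mul1r => h.
rewrite -[X in `|X|](subrK (slice I a b * D)); apply: le_trans (ler_normD _ _) _.
have hs : `|slice I a b * D| <= (`|a| + `|b|) * `|D|.
  by rewrite qnormM ler_wpM2r// slice_norm_le.
have D0 : 0 < 1 + `|D| by rewrite ltr_wpDr.
have : (`|a| + `|b|) * (1 + `|D|) <= e.
  rewrite -ler_pdivlMr//.
  have -> : e / (1 + `|D|) = e / (2 * (1 + `|D|)) + e / (2 * (1 + `|D|)).
    by field; rewrite gt_eqF.
  by apply: lerD; exact: ltW.
lra.
Qed.

Lemma cdiff_contx x1 x2 y : (forall x, x1 <= x <= x2 -> cdiff x y) ->
  contab x1 x2 (fun x => Psi x y).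
Proof.
move=> h x xx; apply/cvgrPdist_le => e e0.
have [d d0 hd] := cdiff_cont (h x xx) e0; apply/nbhs_ballP; exists d => // s /=.
rewrite distrC => sx; rewrite distrC.
by have := hd (s - x) 0 sx; rewrite normr0 addr0 [x + _]addrC subrK; apply.
Qed.

Lemma cdiff_conty x y1 y2 : (forall y, y1 <= y <= y2 -> cdiff x y) ->
  contab y1 y2 (Psi x).
Proof.
move=> h y yy; apply/cvgrPdist_le => e e0.
have [d d0 hd] := cdiff_cont (h y yy) e0; apply/nbhs_ballP; exists d => // s /=.
rewrite distrC => sy; rewrite distrC.
have := hd 0 (s - y); rewrite normr0 addr0 [y + _]addrC subrK; exact.
Qed.

(** The integral of [Psi d(x + I y)] along the boundary of the rectangle; the
    differential is on the left of the values, hence [I] too. *)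
Definition rect_int x y h k : H :=
  qint x (x + h) (fun s => Psi s y) - qint x (x + h) (fun s => Psi s (y + k)) +
  I * (qint y (y + k) (Psi (x + h)) - qint y (y + k) (Psi x)).

Lemma rect_int_split x y h k : 0 <= h -> 0 <= k ->
  (forall x' y', x <= x' <= x + (h + h) -> y <= y' <= y + (k + k) -> cdiff x' y') ->
  rect_int x y (h + h) (k + k) = rect_int x y h k + rect_int (x + h) y h k +
    rect_int x (y + k) h k + rect_int (x + h) (y + k) h k.
Proof.
move=> h0 k0 hc; rewrite /rect_int.
have cx y' : y <= y' <= y + (k + k) -> qint x (x + (h + h)) (fun s => Psi s y') =
    qint x (x + h) (fun s => Psi s y') + qint (x + h) (x + h + h) (fun s => Psi s y').
  move=> hy; rewrite -[x + h + h]addrA; apply: qint_cat; first by apply/andP; lra.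
  by apply: cdiff_contx => x' hx; exact: hc.
have cy x' : x <= x' <= x + (h + h) -> qint y (y + (k + k)) (Psi x') =
    qint y (y + k) (Psi x') + qint (y + k) (y + k + k) (Psi x').
  move=> hx; rewrite -[y + k + k]addrA; apply: qint_cat; first by apply/andP; lra.
  by apply: cdiff_conty => y' hy; exact: hc.
rewrite !cx ?cy; try (by apply/andP; lra).
rewrite ?[x + (h + h)]addrA ?[y + (k + k)]addrA.
move: (qint _ _ _) (qint _ _ _) (qint _ _ _) (qint _ _ _) (qint _ _ _) (qint _ _ _).
move: (qint _ _ _) (qint _ _ _) (qint _ _ _) (qint _ _ _) (qint _ _ _) (qint _ _ _).
by move=> *; apply: quatP; split; rewrite /=; ring.
Qed.

(** Goursat's estimate: the affine part of [Psi] does not contribute. *)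
Lemma rect_int_local x y e h k : 0 < e -> 0 < h -> 0 < k -> cdiff x y ->
  exists2 d, 0 < d & forall x' y' t, 0 < t < d ->
    (forall x'' y'', x' <= x'' <= x' + h * t -> y' <= y'' <= y' + k * t ->
       cdiff x'' y'') ->
    x' <= x <= x' + h * t -> y' <= y <= y' + k * t ->
    `|rect_int x' y' (h * t) (k * t)| <= e * t ^+ 2.
Proof.
move=> e0 h0 k0 [D hD].
have hk0 : 0 < h + k by rewrite addr_gt0.
(* The constant is 4 from [qint_le] times 2 for the two sides of a difference. *)
pose e' := e / (8 * (h + k) ^+ 2).
have e'0 : 0 < e' by rewrite divr_gt0// mulr_gt0// exprn_gt0.
have [d d0 hd] := hD e' e'0.
exists (d / (h + k)); first by rewrite divr_gt0.
move=> x' y' t /andP[t0 td] hc /andP[x1 x2] /andP[y1 y2].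
have ht0 : 0 < h * t by rewrite mulr_gt0.
have kt0 : 0 < k * t by rewrite mulr_gt0.
have hkt : h * t + k * t < d by rewrite -mulrDl mulrC -ltr_pdivlMr.
have key x'' y'' : x' <= x'' <= x' + h * t -> y' <= y'' <= y' + k * t ->
    `|Psi x'' y'' - Psi x y - slice I (x'' - x) (y'' - y) * D| <= e' * (h * t + k * t).
  move=> /andP[x3 x4] /andP[y3 y4].
  have nx : `|x'' - x| <= h * t by rewrite ler_norml; apply/andP; lra.
  have ny : `|y'' - y| <= k * t by rewrite ler_norml; apply/andP; lra.
  have := hd (x'' - x) (y'' - y); rewrite [x + _]addrC [y + _]addrC !subrK.
  move=> hh; apply: le_trans (hh _ _) _; [lra|lra|].
  by rewrite ler_wpM2l ?(ltW e'0)// lerD.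
(* The constant differences of the affine part of [Psi] between opposite sides. *)
pose cu := - (I * ((k * t)%:A * D)); pose cv := (h * t)%:A * D.
have slE a b b' : slice I a b - slice I a b' = I * (b - b')%:A.
  by rewrite -sliceB subrr /slice scale0r add0r.
have slE' a a' b : slice I a b - slice I a' b = (a - a')%:A.
  by rewrite -sliceB subrr slice0.
have hu s : x' <= s <= x' + h * t ->
    `|Psi s y' - Psi s (y' + k * t) - cu| <= 2 * (e' * (h * t + k * t)).
  move=> hs; have h1 := key s y' hs ltac:(by apply/andP; lra).
  have h2 := key s (y' + k * t) hs ltac:(by apply/andP; lra).
  have -> : Psi s y' - Psi s (y' + k * t) - cu =
     (Psi s y' - Psi x y - slice I (s - x) (y' - y) * D) -
     (Psi s (y' + k * t) - Psi x y - slice I (s - x) (y' + k * t - y) * D).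
    have -> : cu = (slice I (s - x) (y' - y) - slice I (s - x) (y' + k * t - y)) * D.
      rewrite slE /cu mulrA -mulNr -mulrN -scaleNr; congr (_ * _%:A * _); ring.
    rewrite mulrBl; move: (slice _ _ _ * D) (slice _ _ _ * D) => *.
    by apply: quatP; split; rewrite /=; ring.
  by apply: le_trans (ler_normB _ _) _; lra.
have hv s : y' <= s <= y' + k * t ->
    `|Psi (x' + h * t) s - Psi x' s - cv| <= 2 * (e' * (h * t + k * t)).
  move=> hs; have h1 := key (x' + h * t) s ltac:(by apply/andP; lra) hs.
  have h2 := key x' s ltac:(by apply/andP; lra) hs.
  have -> : Psi (x' + h * t) s - Psi x' s - cv =
     (Psi (x' + h * t) s - Psi x y - slice I (x' + h * t - x) (s - y) * D) -
     (Psi x' s - Psi x y - slice I (x' - x) (s - y) * D).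
    have -> : cv = (slice I (x' + h * t - x) (s - y) - slice I (x' - x) (s - y)) * D.
      by rewrite slE' /cv; congr (_%:A * _); ring.
    rewrite mulrBl; move: (slice _ _ _ * D) (slice _ _ _ * D) => *.
    by apply: quatP; split; rewrite /=; ring.
  by apply: le_trans (ler_normB _ _) _; lra.
have c1 y'' : y' <= y'' <= y' + k * t -> contab x' (x' + h * t) (fun s => Psi s y'').
  by move=> hy; apply: cdiff_contx => s hs; exact: hc.
have c2 x'' : x' <= x'' <= x' + h * t -> contab y' (y' + k * t) (Psi x'').
  by move=> hx; apply: cdiff_conty => s hs; exact: hc.
have cy1 := c1 y' ltac:(by apply/andP; lra).
have cy2 := c1 (y' + k * t) ltac:(by apply/andP; lra).
have cx1 := c2 x' ltac:(by apply/andP; lra).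
have cx2 := c2 (x' + h * t) ltac:(by apply/andP; lra).
have ccst a b (c : H) : contab a b (fun=> c) by move=> s _; exact: cvg_cst.
have cB a b (u v : R -> H) : contab a b u -> contab a b v -> contab a b (fun s => u s - v s).
  by move=> hu' hv' s hs; apply: cvgB; [exact: hu'|exact: hv'].
have -> : rect_int x' y' (h * t) (k * t) =
    qint x' (x' + h * t) (fun s => Psi s y' - Psi s (y' + k * t) - cu) +
    I * qint y' (y' + k * t) (fun s => Psi (x' + h * t) s - Psi x' s - cv).
  rewrite (qintB (cB _ _ _ _ cy1 cy2) (ccst _ _ _)) (qintB cy1 cy2).
  rewrite (qintB (cB _ _ _ _ cx2 cx1) (ccst _ _ _)) (qintB cx2 cx1).
  rewrite !qint_cst ?lerDl ?(ltW ht0) ?(ltW kt0)//.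
  have -> : x' + h * t - x' = h * t by ring.
  have -> : y' + k * t - y' = k * t by ring.
  rewrite /rect_int /cu /cv !mulr_algl.
  move: (qint _ _ _) (qint _ _ _) (qint _ _ _) (qint _ _ _) => *.
  by apply: quatP; split; rewrite /=; ring.
apply: le_trans (ler_normD _ _) _; rewrite [X in _ + X]qnormM imag_unit_norm// mul1r.
have := qint_le (ltW _) (cB _ _ _ _ (cB _ _ _ _ cy1 cy2) (ccst _ _ cu)) hu.
rewrite ltrDl => /(_ ht0) q1.
have := qint_le (ltW _) (cB _ _ _ _ (cB _ _ _ _ cx2 cx1) (ccst _ _ cv)) hv.
rewrite ltrDl => /(_ kt0) q2.
apply: le_trans (lerD q1 q2) _; rewrite le_eqVlt; apply/orP; left; apply/eqP.
by rewrite /e'; field; rewrite gt_eqF.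
Qed.

(** An integral over a rectangle is the sum of those over its quarters, and the
    bound [e t^2] is reproduced, since [4 (t / 2)^2 = t^2]; so it holds for the
    whole rectangle as soon as it holds locally. *)
Lemma goursat x y h k : 0 < h -> 0 < k ->
  (forall x' y', x <= x' <= x + h -> y <= y' <= y + k -> cdiff x' y') ->
  rect_int x y h k = 0.
Proof.
move=> h0 k0 hc; apply/eqP; rewrite -normr_le0; apply/ler_addgt0Pl => e e0.
rewrite addr0.
have := @rectangle_bisection R (fun x y t => `|rect_int x y (h * t) (k * t)| <= e * t ^+ 2)
  x y h k (ltW h0) (ltW k0).
rewrite !mulr1 expr1n mulr1; apply.
- move=> x' y' t t0 [i1 i2 i3 i4] p1 p2 p3 p4.
  rewrite (_ : h * (2 * t) = h * t + h * t); last ring.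
  rewrite (_ : k * (2 * t) = k * t + k * t); last ring.
  rewrite rect_int_split ?mulr_ge0 ?(ltW h0) ?(ltW k0) ?(ltW t0)//; last first.
    move=> x'' y'' /andP[j1 j2] /andP[j3 j4].
    by apply: hc; apply/andP; lra.
  apply: le_trans (ler_normD _ _) _; rewrite exprMn expr2.
  apply: (@le_trans _ _ (e * t ^+ 2 + e * t ^+ 2 + e * t ^+ 2 + e * t ^+ 2)).
    apply: lerD => //; apply: le_trans (ler_normD _ _) _; apply: lerD => //.
    by apply: le_trans (ler_normD _ _) _; exact: lerD.
  by rewrite le_eqVlt; apply/orP; left; apply/eqP; ring.
- move=> x' y' hx hy; have [d d0 hd] := rect_int_local e0 h0 k0 (hc _ _ hx hy).
  exists d => // x'' y'' t td [i1 i2 i3 i4] hx' hy'; apply: hd => // x3 y3 hx3 hy3.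
  by apply: hc; move: hx3 hy3 => /andP[? ?] /andP[? ?]; apply/andP; lra.
Qed.

End Goursat.

(** * Polar coordinates *)

Section CircleMeans.
Context {R : realType}.
Local Notation H := (quat R).
Implicit Types (a b x y t s u th : R) (c z w : H).

Lemma real_expansion (f : R -> R) x (l : R) : is_derive x 1 f l ->
  forall e, 0 < e -> exists2 d, 0 < d & forall h, `|h| < d ->
    `|f (x + h) - f x - h * l| <= e * `|h|.
Proof.
move=> [df dE] e e0.
have /derivable1_diffP df' := df.
have /diff_locallyP[_ /eqaddoP hd] := df'.
have /nbhs_ballP[d /= d0 h] := hd e e0; exists d => // k kd.
have /h : ball (0 : R) d k by rewrite -ball_normE /= sub0r normrN.
rewrite /= !fctE /= opprD addrA [k + x]addrC.
have -> : 'd f x k = k * l.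
  by rewrite -{1}[k]mulr1 -[k * 1]/(k *: 1) linearZ /= -deriveE// dE.
done.
Qed.

Variable I : H.
Hypothesis hI : imag_units I.

Definition cis th : H := slice I (cos th) (sin th).
Definition circle c s th : H := c + s *: cis th.

Lemma cis_norm th : `|cis th| = 1.
Proof. by rewrite /cis slice_norm// cos2Dsin2 sqrtr1. Qed.

Lemma cis_plane th : cplane I (cis th).
Proof. exact: cplane_slice. Qed.

Lemma circle_plane c s th : cplane I c -> cplane I (circle c s th).
Proof. by move=> cI; apply: cplaneD => //; apply: cplaneZ; exact: cis_plane. Qed.

Lemma circle_dist c s th : 0 <= s -> `|circle c s th - c| = s.
Proof. by move=> s0; rewrite /circle addrC addKr normrZ cis_norm mulr1 ger0_norm. Qed.

Lemma cisD a b : cis (a + b) = cis a * cis b.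
Proof.
rewrite /cis /slice cosD sinD !mulr_algr mulrDl !mulrDr -!scalerAl -!scalerAr.
rewrite !mul1r !mulr1 imag_unit_sqr// !scalerA !scalerDl scalerN scaleNr.
by rewrite -!addrA; congr (_ + _); rewrite [RHS]addrC -addrA [RHS]addrCA addrA;
   rewrite [RHS]addrC [_ *: I + _]addrC.
Qed.

(** The derivative of the complex exponential at the origin is 1. *)
Lemma expcis_expansion e : 0 < e -> exists2 d, 0 < d & forall a b,
  `|a| < d -> `|b| < d ->
  `|expR a *: cis b - 1 - slice I a b| <= e * (`|a| + `|b|).
Proof.
move=> e0; have [e' [e'0 e'1 e'3]] : exists e', [/\ 0 < e', e' <= 1 & e' <= e / 3].
  by exists (Order.min 1 (e / 3)); rewrite lt_min ltr01 divr_gt0// !ge_min !lexx orbT.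
have [d1 d10 h1] := real_expansion (is_derive_expR 0) e'0.
have [d2 d20 h2] := real_expansion (is_derive_cos 0) e'0.
have [d3 d30 h3] := real_expansion (is_derive_sin 0) e'0.
exists (Order.min (Order.min d1 d2) (Order.min d3 (Order.min 1 (e' / 4)))).
  by rewrite !lt_min d10 d20 d30 ltr01 divr_gt0.
move=> a b; rewrite !lt_min => /andP[/andP[a1 _] /andP[_ /andP[a4 a5]]].
move=> /andP[/andP[_ b2] /andP[b3 /andP[_ b5]]].
have {h1} := h1 a a1; rewrite add0r expR0 mulr1 => h1.
have {h2} := h2 b b2; rewrite add0r cos0 sin0 oppr0 mulr0 subr0 => h2.
have {h3} := h3 b b3; rewrite add0r sin0 cos0 mulr1 subr0 => h3.
have -> : expR a *: cis b - 1 - slice I a b =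
    slice I ((expR a - 1 - a) * cos b + (1 + a) * (cos b - 1))
            ((expR a - 1) * sin b + (sin b - b)).
  have -> : expR a *: cis b = slice I (expR a * cos b) (expR a * sin b).
    by rewrite /cis /slice scalerDr scalerAr !scalerA.
  have -> : (1 : H) = slice I 1 0 by rewrite slice0 scale1r.
  by rewrite -!sliceB; congr slice; ring.
apply: le_trans (slice_norm_le hI _ _) _.
have na := normr_ge0 a; have nb := normr_ge0 b.
have c1 : `|cos b| <= 1 by rewrite ler_norml cos_geN1 cos_le1.
have r1 : `|(expR a - 1 - a) * cos b| <= e' * `|a|.
  by rewrite normrM -[leRHS]mulr1; apply: ler_pM.
have r2 : `|(1 + a) * (cos b - 1)| <= 2 * (e' * `|b|).
  rewrite normrM; apply: ler_pM => //.
  by apply: le_trans (ler_normD _ _) _; rewrite normr1; lra.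
have ea : `|expR a - 1| <= 2 * `|a|.
  have -> : expR a - 1 = (expR a - 1 - a) + a by ring.
  apply: le_trans (ler_normD _ _) _.
  have : e' * `|a| <= 1 * `|a| by rewrite ler_wpM2r.
  lra.
have sb : `|sin b| <= 2 * `|b|.
  have -> : sin b = (sin b - b) + b by ring.
  apply: le_trans (ler_normD _ _) _.
  have : e' * `|b| <= 1 * `|b| by rewrite ler_wpM2r.
  lra.
have r3 : `|(expR a - 1) * sin b| <= e' * `|a|.
  rewrite normrM; apply: (@le_trans _ _ (2 * `|a| * (2 * (e' / 4)))).
    by apply: ler_pM => //; lra.
  by rewrite le_eqVlt; apply/orP; left; apply/eqP; field.
have ee : e' * (`|a| + `|b|) <= e / 3 * (`|a| + `|b|) by rewrite ler_wpM2r// addr_ge0.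
have := ler_normD ((expR a - 1 - a) * cos b) ((1 + a) * (cos b - 1)).
have := ler_normD ((expR a - 1) * sin b) (sin b - b).
have := mulr_ge0 (ltW e'0) na.
lra.
Qed.

(** The chain rule for [G] and [c + exp (u + I th)], the derivative of which is
    [E = exp (u + I th)]. *)
Lemma polar_cdiff (G : H -> H) c u th : cplane I c ->
  holo I G (circle c (expR u) th) ->
  cdiff I (fun u th => G (circle c (expR u) th)) u th.
Proof.
move=> cI [phi [hphi cphi]]; set z := circle c (expR u) th in hphi cphi *.
pose E := expR u *: cis th.
have EI : cplane I E by apply: cplaneZ; exact: cis_plane.
exists (E * phi z) => e e0.
have nE : 0 < `|E| by rewrite normrZ cis_norm mulr1 gtr0_norm ?expR_gt0.
have /cvgrPdist_le/(_ (e / 2 / `|E|)) := cphi.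
rewrite !divr_gt0// => /(_ isT) /near_plane[d1 d10 h1].
have /near_plane[d2 d20 h2] := hphi.
pose K := `|phi z| + e / 2 / `|E|.
have K0 : 0 < K by rewrite ltr_wpDl// !divr_gt0.
have [e1 [e10 e11 e12]] : exists e1, [/\ 0 < e1, e1 <= 1 & e1 <= e / 2 / `|E| / K].
  exists (Order.min 1 (e / 2 / `|E| / K)).
  by rewrite lt_min ltr01 !divr_gt0// !ge_min !lexx orbT.
have [d3 d30 h3] := expcis_expansion e10.
pose d := Order.min d3 (Order.min d1 d2 / (4 * `|E|)).
exists d; first by rewrite lt_min d30 divr_gt0// ?lt_min ?d10 ?d20// mulr_gt0.
move=> a b; rewrite !lt_min => /andP[a1 a2] /andP[b1 b2].
set z' := circle c _ _.
have z'I : cplane I z' by exact: circle_plane.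
have {h3} := h3 a b a1 b1; set X := expR a *: cis b => h3.
have zz' : z' - z = E * (X - 1).
  rewrite /z' /z /circle opprD addrACA subrr add0r mulrBr mulr1; congr (_ - _).
  by rewrite expRD cisD /E /X -scalerAl -scalerAr scalerA.
have nX : `|X - 1| <= 2 * (`|a| + `|b|).
  rewrite -[X - 1](subrK (slice I a b)); apply: le_trans (ler_normD _ _) _.
  have := slice_norm_le hI a b.
  have : e1 * (`|a| + `|b|) <= 1 * (`|a| + `|b|) by rewrite ler_wpM2r// addr_ge0.
  lra.
have nzz : `|z' - z| < Order.min d1 d2.
  rewrite zz' qnormM; apply: le_lt_trans (ler_wpM2l (ltW nE) nX) _.
  rewrite mulrCA mulrDr.
  have ab : `|a| + `|b| < Order.min d1 d2 / (4 * `|E|) + Order.min d1 d2 / (4 * `|E|).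
    exact: ltrD.
  rewrite -mulrDr; rewrite mulrCA -ltr_pdivlMl// mulrC -ltr_pdivlMr//.
  apply: lt_le_trans ab _; rewrite le_eqVlt; apply/orP; left; apply/eqP.
  by field; rewrite gt_eqF.
move: nzz; rewrite lt_min => /andP[zd1 zd2].
rewrite (h2 z' z'I zd2) [G z + _]addrC addrK zz'.
have -> : E * (X - 1) * phi z' - slice I a b * (E * phi z) =
   E * ((X - 1 - slice I a b) * phi z' + slice I a b * (phi z' - phi z)).
  rewrite [slice I a b * (E * _)]mulrA.
  rewrite (cplane_comm (cplane_slice I a b) EI) -!mulrA -mulrBr; congr (_ * _).
  by rewrite mulrBr [X in _ = X + _]mulrBl subrKA.
rewrite qnormM mulrC -ler_pdivlMr//.
apply: le_trans (ler_normD _ _) _; rewrite !qnormM.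
have p1 : `|phi z' - phi z| <= e / 2 / `|E| by rewrite distrC; exact: h1.
have p2 : `|phi z'| <= K.
  by rewrite -[phi z'](subrK (phi z)) addrC; apply: le_trans (ler_normD _ _) _; rewrite lerD2l.
have ab0 : 0 <= `|a| + `|b| by rewrite addr_ge0.
have q1 : `|X - 1 - slice I a b| * `|phi z'| <= e1 * (`|a| + `|b|) * K.
  exact: ler_pM.
have q2 : `|slice I a b| * `|phi z' - phi z| <= (`|a| + `|b|) * (e / 2 / `|E|).
  by apply: ler_pM => //; exact: slice_norm_le.
have q3 : e1 * (`|a| + `|b|) * K <= e / 2 / `|E| / K * (`|a| + `|b|) * K.
  by rewrite ler_wpM2r ?(ltW K0)// ler_wpM2r.
apply: le_trans (lerD q1 q2) _; apply: le_trans (lerD q3 (lexx _)) _.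
rewrite le_eqVlt; apply/orP; left; apply/eqP; field.
by rewrite !gt_eqF.
Qed.

End CircleMeans.

(** * Means on circles *)

Section Means.
Context {R : realType}.
Local Notation H := (quat R).
Implicit Types (a b x y t s u th : R) (c z w : H).
Variable I : H.
Hypothesis hI : imag_units I.
Local Notation T2 := ((@pi R) *+ 2).
Local Notation circle := (circle I).

Definition pcont (G : H -> H) z := G w @[w --> within (cplane I) (nbhs z)] --> G z.

Definition cmean (G : H -> H) c s : H := qint 0 T2 (fun th => G (circle c s th)).

Lemma T2_gt0 : 0 < T2.
Proof. by rewrite mulr2n addr_gt0// pi_gt0. Qed.

Lemma cis_T2 : cis I T2 = cis I 0.
Proof. by rewrite /cis cos2pi sin2pi cos0 sin0. Qed.

(** Cauchy's theorem for annuli: in logarithmic polar coordinates the annulus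
    is a rectangle, and the two sides on which the angle is constant cancel. *)
Lemma cmean_const G c s1 s2 : cplane I c -> 0 < s1 -> s1 <= s2 ->
  (forall z, cplane I z -> s1 <= `|z - c| <= s2 -> holo I G z) ->
  cmean G c s1 = cmean G c s2.
Proof.
move=> cI s10; rewrite le_eqVlt => /predU1P[->//|s12] hG.
have s20 : 0 < s2 by exact: lt_trans s12.
have ln12 : 0 < ln s2 - ln s1 by rewrite subr_gt0 ltr_ln.
have := @goursat R I (fun u th => G (circle c (expR u) th)) hI (ln s1) 0
  (ln s2 - ln s1) T2 ln12 T2_gt0.
rewrite /rect_int add0r [ln s1 + _]addrC subrK !lnK ?posrE// => h.
have {h} := h _; rewrite [X in X - _](_ : _ =
  qint (ln s1) (ln s2) (fun s => G (circle c (expR s) T2))); last first.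
  by apply: eq_qint => t _; rewrite /circle cis_T2.
rewrite subrr add0r => h; apply/esym/eqP; rewrite -subr_eq0.
have I0 : I != 0 by rewrite -normr_eq0 imag_unit_norm// oner_eq0.
suff /eqP : I * (cmean G c s2 - cmean G c s1) = 0.
  by rewrite qmulf_eq0 (negbTE I0).
apply: h => x y /andP[x1 x2] _; apply: polar_cdiff => //; apply: hG.
  exact: circle_plane.
rewrite circle_dist ?expR_ge0//; apply/andP; split.
  by rewrite -[s1]lnK ?posrE// ler_expR.
by rewrite -[s2]lnK ?posrE// ler_expR.
Qed.

Lemma circle_close c s th d : 0 < d -> exists2 d', 0 < d' & forall s' th',
  `|s' - s| < d' -> `|th' - th| < d' -> `|circle c s' th' - circle c s th| < d.
Proof.
move=> d0; pose e := d / (4 * (1 + `|s|)).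
have s1 : 0 < 1 + `|s| by rewrite ltr_wpDr.
have e0 : 0 < e by rewrite divr_gt0// mulr_gt0.
have /cvgrPdist_lt/(_ e e0)/nbhs_ballP[d1 /= d10 h1] := @continuous_cos R th.
have /cvgrPdist_lt/(_ e e0)/nbhs_ballP[d2 /= d20 h2] := @continuous_sin R th.
exists (Order.min (d / 2) (Order.min d1 d2)).
  by rewrite !lt_min d10 d20 divr_gt0.
move=> s' th'; rewrite !lt_min => /and3P[sd _ _] /and3P[_ t1 t2].
have k1 : `|cos th - cos th'| < e by apply: h1; rewrite -ball_normE /= distrC.
have k2 : `|sin th - sin th'| < e by apply: h2; rewrite -ball_normE /= distrC.
have -> : circle c s' th' - circle c s th =
    (s' - s) *: cis I th' + s *: (cis I th' - cis I th).
  rewrite /circle opprD addrACA subrr add0r scalerBl scalerBr addrA subrK.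
  by [].
apply: le_lt_trans (ler_normD _ _) _; rewrite !normrZ cis_norm// mulr1.
have k3 : `|cis I th' - cis I th| <= 2 * e.
  rewrite /cis -sliceB; apply: le_trans (slice_norm_le hI _ _) _.
  by rewrite mulr_natl mulr2n; apply: lerD; rewrite distrC ltW.
have : `|s| * `|cis I th' - cis I th| <= (1 + `|s|) * (2 * e).
  by apply: ler_pM => //; rewrite lerDr.
have -> : (1 + `|s|) * (2 * e) = d / 2 by rewrite /e; field; rewrite gt_eqF.
lra.
Qed.

Lemma circle_jcont G c s th : cplane I c -> pcont G (circle c s th) ->
  forall e, 0 < e -> exists2 d, 0 < d & forall s' th',
    `|s' - s| < d -> `|th' - th| < d ->
    `|G (circle c s' th') - G (circle c s th)| <= e.
Proof.
move=> cI cG e e0; have /cvgrPdist_le/(_ e e0)/near_plane[d d0 hd] := cG.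
have [d' d'0 hd'] := circle_close c s th d0; exists d' => // s' th' h1 h2.
rewrite distrC; apply: hd; first exact: circle_plane.
exact: hd'.
Qed.

Lemma circle_contab G c s a b : cplane I c -> (forall th, pcont G (circle c s th)) ->
  contab a b (fun th => G (circle c s th)).
Proof.
move=> cI cG th _; apply/cvgrPdist_le => e e0.
have [d d0 hd] := circle_jcont cI (cG th) e0; apply/nbhs_ballP; exists d => // th' /=.
by rewrite distrC => h; rewrite distrC; apply: hd => //; rewrite subrr normr0.
Qed.

(** Uniform continuity in the angle, by bisection; the first side of the
    rectangles is degenerate. *)
Lemma cmean_cont G c s : cplane I c -> (forall th, pcont G (circle c s th)) ->
  forall e, 0 < e -> exists2 d, 0 < d & forall s', `|s' - s| < d ->
    (forall th, pcont G (circle c s' th)) -> `|cmean G c s' - cmean G c s| <= e.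
Proof.
move=> cI cG e e0; pose e' := e / (4 * T2).
have T20 := T2_gt0.
have e'0 : 0 < e' by rewrite divr_gt0// mulr_gt0.
have [d d0 hd] : exists2 d, 0 < d & forall s' th, `|s' - s| < d -> 0 <= th <= 0 + T2 * 1 ->
    `|G (circle c s' th) - G (circle c s th)| <= e'.
  apply: (@rectangle_bisection R (fun x y t => exists2 d, 0 < d & forall s' th,
    `|s' - s| < d -> y <= th <= y + T2 * t ->
    `|G (circle c s' th) - G (circle c s th)| <= e') 0 0 0 T2) => //.
  - exact: ltW.
  - move=> x y t t0 _ [d1 d10 h1] _ [d2 d20 h2] _.
    exists (Order.min d1 d2) => [|s' th]; first by rewrite lt_min d10.
    rewrite lt_min => /andP[sd1 sd2] /andP[th1 th2].
    have [tht|tht] := leP th (y + T2 * t); first by apply: h1 => //; apply/andP.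
    apply: h2 => //; apply/andP; split; first exact: ltW.
    by apply: le_trans th2 _; rewrite le_eqVlt; apply/orP; left; apply/eqP; ring.
  - move=> x y _ _; have e20 : 0 < e' / 2 by rewrite divr_gt0.
    have [d d0 hd] := circle_jcont cI (cG y) e20.
    exists (d / T2) => [|x' y' t /andP[t0 td] _ _ /andP[y1 y2]]; first by rewrite divr_gt0.
    exists d => // s' th sd /andP[th1 th2].
    have thd : `|th - y| < d.
      have : T2 * t < d by rewrite mulrC -ltr_pdivlMr.
      by move=> ?; rewrite ltr_norml; apply/andP; split; lra.
    have := hd s' th sd thd; have := hd s th; rewrite subrr normr0 => /(_ d0 thd) k1 k2.
    rewrite -(subrKA (G (circle c s y))) ; apply: le_trans (ler_normD _ _) _.
    by rewrite [X in _ + X]distrC; lra.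
exists d => // s' sd cG'.
rewrite /cmean -qintB; [|exact: circle_contab|exact: circle_contab].
have cB : contab 0 T2 (fun th => G (circle c s' th) - G (circle c s th)).
  by move=> th hth; apply: cvgB; [exact: (circle_contab cI cG' hth)|exact: (circle_contab cI cG hth)].
apply: le_trans (qint_le (ltW T20) cB (M := e') _) _.
  by move=> th hth; apply: hd; rewrite ?mulr1 ?add0r.
rewrite subr0 /e' le_eqVlt; apply/orP; left; apply/eqP.
by move: T20; move: (pi *+ 2) => T T0; field; rewrite gt_eqF.
Qed.

Lemma holo_pcont G z : holo I G z -> pcont G z.
Proof. exact: holo_cvg. Qed.

(** Means over circles of radius tending to the distance of [w] are all equal, and
    by continuity they tend to the mean over the circle through [w]. *)
Lemma cmean_except_side G c s w : cplane I c -> 0 < s -> 0 < `|w - c| ->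
  (forall z, cplane I z -> Order.min s `|w - c| <= `|z - c| <= Order.max s `|w - c| ->
     z != w -> holo I G z) -> pcont G w ->
  cmean G c s = cmean G c `|w - c|.
Proof.
move=> cI s0 r0 hG cG; set r := `|w - c| in r0 hG *.
have cont s' th : 0 <= s' -> Order.min s r <= s' <= Order.max s r ->
    pcont G (circle c s' th).
  move=> s'0 s'r; have [->//|zw] := eqVneq (circle c s' th) w.
  apply: holo_pcont; apply: hG => //; first exact: circle_plane.
  by rewrite circle_dist.
apply/eqP; rewrite -subr_eq0 -normr_le0; apply/ler_addgt0Pl => e e0; rewrite addr0.
have [sr|rs|->] := ltgtP s r; last by rewrite subrr normr0 ltW.
- rewrite (min_l (ltW sr)) (max_r (ltW sr)) in hG cont.
  have cr th : pcont G (circle c r th) by apply: cont; rewrite ?lexx ltW.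
  have [d d0 hd] := cmean_cont cI cr e0.
  have [s' [s1 s2 s3]] : exists s', [/\ s <= s', s' < r & `|s' - r| < d].
    exists (Order.max s (r - d / 2)); rewrite le_max lexx gt_max sr; split => //.
      by lra.
    rewrite distrC ger0_norm; last by rewrite subr_ge0 ge_max (ltW sr)/=; lra.
    by rewrite ltrBlDl -ltrBlDr lt_max; apply/orP; right; lra.
  rewrite (@cmean_const G c s s')//; last first.
    move=> z zI /andP[z1 z2]; apply: hG => //; first by rewrite z1 (le_trans z2)// ltW.
    by apply: contraTneq z2 => ->; rewrite -ltNge.
  apply: hd => // th; apply: cont; first by apply: le_trans s1; exact: ltW.
  by rewrite s1 ltW.
- rewrite (min_r (ltW rs)) (max_l (ltW rs)) in hG cont.
  have cr th : pcont G (circle c r th) by apply: cont; rewrite ?lexx ltW.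
  have [d d0 hd] := cmean_cont cI cr e0.
  have [s' [s1 s2 s3]] : exists s', [/\ s' <= s, r < s' & `|s' - r| < d].
    exists (Order.min s (r + d / 2)); rewrite ge_min lexx lt_min rs; split => //.
      by lra.
    rewrite ger0_norm; last by rewrite subr_ge0 le_min (ltW rs)/=; lra.
    by rewrite ltrBlDl gt_min; apply/orP; right; lra.
  have s'0 : 0 < s' by exact: lt_trans s2.
  rewrite -(@cmean_const G c s' s)//; last first.
    move=> z zI /andP[z1 z2]; apply: hG => //; first by rewrite z2 (le_trans _ z1)// ltW.
    by apply: contraTneq z1 => ->; rewrite -ltNge.
  apply: hd => // th; apply: cont; first exact: ltW.
  by rewrite s1 ltW.
Qed.

(** The two annuli on both sides of the circle through [w] are joined along it. *)
Lemma cmean_except G c s1 s2 w : cplane I c -> 0 < s1 -> 0 < `|w - c| ->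
  s1 <= `|w - c| <= s2 ->
  (forall z, cplane I z -> s1 <= `|z - c| <= s2 -> z != w -> holo I G z) ->
  pcont G w -> cmean G c s1 = cmean G c s2.
Proof.
move=> cI s10 r0 /andP[r1 r2] hG cG.
rewrite (@cmean_except_side G c s1 w)//; last first.
  move=> z zI; rewrite (min_l r1) (max_r r1) => /andP[z1 z2]; apply: hG => //.
  by rewrite z1 (le_trans z2).
rewrite [RHS](@cmean_except_side G c s2 w)//; first exact: lt_le_trans r2.
move=> z zI; rewrite (min_r r2) (max_l r2) => /andP[z1 z2]; apply: hG => //.
by rewrite z2 (le_trans r1).
Qed.

Lemma contab_bounded a b (u : R -> H) : a <= b -> contab a b u ->
  exists2 B, 0 <= B & forall t, a <= t <= b -> `|u t| <= B.
Proof.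
move=> ab cu.
have cn : {within `[a, b], continuous (fun t => `|u t|)}.
  apply: continuous_in_subspaceT => t; rewrite inE /= in_itv /= => tab.
  by apply: cvg_norm; exact: cu.
have [t0 _ ht0] := EVT_max ab cn.
by exists `|u t0| => // t tab; apply: ht0; rewrite in_itv.
Qed.

Lemma cmean_bound G c s B : cplane I c -> (forall th, pcont G (circle c s th)) ->
  (forall th, `|G (circle c s th)| <= B) -> `|cmean G c s| <= 4 * B * T2.
Proof.
move=> cI cG GB; rewrite -[X in _ * X]subr0; apply: qint_le => //; first exact: ltW T2_gt0.
exact: circle_contab.
Qed.

Lemma holoX T n z : cplane I z -> (\forall w \near within (cplane I) (nbhs z), cplane I (T w)) ->
  cplane I (T z) -> holo I T z -> holo I (fun w => T w ^+ n) z.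
Proof.
move=> zI TI Tz hT; elim: n => [|n IH].
  by under [X in holo _ X]eq_fun do rewrite expr0; exact: holo_cst.
under [X in holo _ X]eq_fun do rewrite exprS.
exact: holoM.
Qed.

Lemma holo_subc c z : cplane I z -> holo I (fun w => w - c) z.
Proof. by move=> zI; apply: holoB; [exact: holo_id|exact: holo_cst]. Qed.

Lemma holo_subV c z : cplane I c -> cplane I z -> z != c -> holo I (fun w => (w - c)^-1) z.
Proof.
move=> cI zI zc; apply: holoV => //; last exact: holo_subc.
  by near=> w; apply: cplaneB => //; near: w; exact: plane_near.
by rewrite subr_eq0.
Unshelve. all: by end_near. Qed.

Lemma holo_ipow c n z : cplane I c -> cplane I z -> z != c ->
  holo I (fun w => (w - c)^-1 ^+ n) z.
Proof.
move=> cI zI zc; apply: (@holoX (fun w => (w - c)^-1)) => //; last exact: holo_subV.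
  by near=> w; apply: cplaneV => //; apply: cplaneB => //; near: w; exact: plane_near.
by apply: cplaneV => //; exact: cplaneB.
Unshelve. all: by end_near. Qed.

End Means.

(** * Taylor expansion *)

Section Taylor.
Context {R : realType}.
Local Notation H := (quat R).
Implicit Types (a b x y t s u th : R) (z w : H).
Local Notation T2 := ((@pi R) *+ 2).
Variable I : H.
Hypothesis hI : imag_units I.
Local Notation circle := (circle I).
Local Notation pcont := (pcont I).
Local Notation cmean := (cmean I).
Variables (F : H -> H) (c : H) (r : R).
Hypotheses (cI : cplane I c) (r0 : 0 < r).
Hypothesis hF : forall z, cplane I z -> 0 < `|z - c| < r -> holo I F z.
Hypothesis cF : pcont F c.

Let ipow n z := (z - c)^-1 ^+ n.

(** Cauchy's formula for the coefficients, on the circle of radius [r / 2]. *)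
Definition taylor_coef n : H := T2^-1 *: cmean (fun z => ipow n z * F z) c (r / 2).

Let circleN s th : 0 < s -> circle c s th != c.
Proof. by move=> s0; rewrite -subr_eq0 -normr_gt0 circle_dist// ltW. Qed.

Let ipow_plane n z : cplane I z -> cplane I (ipow n z).
Proof. by move=> zI; apply: cplaneX => //; apply: cplaneV => //; exact: cplaneB. Qed.

Let ipowF_holo n z : cplane I z -> 0 < `|z - c| < r -> holo I (fun z => ipow n z * F z) z.
Proof.
move=> zI zr; apply: holoM => //; [exact: ipow_plane| |exact: hF].
by apply: holo_ipow => //; rewrite -subr_eq0 -normr_gt0; case/andP: zr.
Qed.

(** By Cauchy's theorem for annuli every circle gives the same coefficients. *)
Lemma taylor_coefE n s : 0 < s < r ->
  cmean (fun z => ipow n z * F z) c s = T2 *: taylor_coef n.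
Proof.
move=> /andP[s0 sr]; rewrite /taylor_coef scalerA divff ?gt_eqF ?T2_gt0// scale1r.
have hr : 0 < r / 2 < r by apply/andP; lra.
have [h|h] := leP s (r / 2).
  apply: cmean_const => // z zI /andP[z1 z2]; apply: ipowF_holo => //.
  by apply/andP; split; lra.
apply/esym; apply: cmean_const => //; [by case/andP: hr|exact: ltW|].
move=> z zI /andP[z1 z2]; apply: ipowF_holo => //.
by apply/andP; split; lra.
Qed.

Lemma taylor_gbound s : 0 < s < r -> gbound s taylor_coef.
Proof.
move=> sr; have [s0 _] := andP sr; have T0 := @T2_gt0 R.
have cc th : pcont F (circle c s th).
  by apply: holo_pcont; apply: hF; [exact: circle_plane|rewrite circle_dist// ltW].
have [B B0 hB] := contab_bounded (ltW T0) (circle_contab (a := 0) (b := T2) hI cI cc).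
exists (4 * B) => n.
have cn : contab 0 T2 (fun th => ipow n (circle c s th) * F (circle c s th)).
  apply: (@circle_contab _ _ hI (fun z => ipow n z * F z)) => // th.
  apply: holo_pcont; apply: ipowF_holo; first exact: circle_plane.
  by rewrite circle_dist// ltW.
have := qint_le (ltW T0) cn (M := (s ^+ n)^-1 * B).
rewrite -/(cmean (fun z => ipow n z * F z) c s) taylor_coefE// subr0 normrZ.
rewrite (gtr0_norm T0) => h.
have {h} : T2 * `|taylor_coef n| <= T2 * (4 * ((s ^+ n)^-1 * B)).
  rewrite [leRHS]mulrC; apply: h => th hth.
  rewrite qnormM qnormX qnormV circle_dist ?(ltW s0)// exprVn.
  by rewrite ler_wpM2l ?invr_ge0 ?exprn_ge0 ?(ltW s0)//; exact: hB.
rewrite ler_pM2l// mulrCA mulrC => h.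
by rewrite -ler_pdivlMr ?exprn_gt0// [leRHS]mulrC mulrC.
Qed.

(** The difference quotient at [w], times [z - c], has mean zero over circles:
    the means are equal, also across the circle through [w], and they tend to zero
    at the center. Expanding the Cauchy kernel turns this into the power series
    at [w]. *)
Lemma taylor_punctured w : cplane I w -> 0 < `|w - c| < r ->
  F w = psum taylor_coef (w - c).
Proof.
move=> wI /andP[w0 wr].
have T0 := @T2_gt0 R.
have [phi [hphi cphi]] := hF wI ltac:(by rewrite w0).
(* The difference quotient of [F] at [w], continued by the derivative. *)
pose g z := if z == w then phi w else (z - w)^-1 * (F z - F w).
pose G z := (z - c) * g z.
have hG z : cplane I z -> 0 < `|z - c| < r -> z != w -> holo I G z.
  move=> zI zr zw; apply: holoM => //; [exact: cplaneB|exact: holo_subc|].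
  apply: (@holo_near _ I (fun z => (z - w)^-1 * (F z - F w))) => //.
    apply/near_plane; exists `|z - w|; first by rewrite normr_gt0 subr_eq0.
    move=> z' _ zz'; rewrite /g; case: eqP => // z'w.
    by move: zz'; rewrite z'w distrC ltxx.
  apply: holoM => //; first by apply: cplaneV => //; exact: cplaneB.
    exact: holo_subV.
  by apply: holoB; [exact: hF|exact: holo_cst].
have cG : pcont G w.
  rewrite /pcont /G; apply: cvg_qmul.
    by apply: cvgB; [exact: cvg_plane_id|exact: cvg_cst].
  rewrite [X in _ --> X](_ : _ = phi w); last by rewrite /g eqxx.
  apply: cvg_trans cphi; apply: near_eq_cvg; move: hphi; apply: filterS => z hz.
  rewrite /g; case: eqP => [->//|/eqP zw].
  by rewrite hz [F w + _]addrC addrK mulrA qmulVf ?subr_eq0// mul1r.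
have cGc s th : 0 < s < r -> pcont G (circle c s th).
  move=> /andP[s0 sr]; have [->//|cw] := eqVneq (circle c s th) w.
  apply: holo_pcont; apply: hG => //; first exact: circle_plane.
  by rewrite circle_dist ?(ltW s0)// s0.
have G0 s : `|w - c| < s -> s < r -> cmean G c s = 0.
  move=> ws sr; apply/eqP; rewrite -normr_le0; apply/ler_addgt0Pl => e e0.
  rewrite addr0.
  have /cvgrPdist_le/(_ 1 ltr01)/near_plane[d d0 hd] := cF.
  pose K := (`|w - c| / 2)^-1 * (`|F c| + 1 + `|F w|).
  have K0 : 0 < K.
    by rewrite mulr_gt0// ?invr_gt0 ?divr_gt0// -addrA ltr_wpDl// ltr_wpDr.
  pose s' := Order.min (d / 2) (Order.min (`|w - c| / 2) (e / (4 * K * T2))).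
  have E0 : 0 < e / (4 * K * T2) by rewrite divr_gt0// mulr_gt0// mulr_gt0.
  have s'0 : 0 < s' by rewrite !lt_min E0 !divr_gt0.
  have [s'd [s'w s'e]] : s' <= d / 2 /\ (s' <= `|w - c| / 2 /\ s' <= e / (4 * K * T2)).
    by rewrite !ge_min !lexx !orbT.
  rewrite -(@cmean_except R I hI G c s' s w)//; last first.
  - move=> z zI /andP[z1 z2] zw; apply: hG => //; apply/andP; split.
      exact: lt_le_trans z1.
    exact: le_lt_trans sr.
  - by apply/andP; split; [lra|exact: ltW].
  have s'r : 0 < s' < r by apply/andP; split => //; lra.
  apply: le_trans (cmean_bound (B := s' * K) hI cI _ _) _.
  - by move=> th; exact: cGc.
  - move=> th; have zw : circle c s' th != w.
      apply/eqP => zw; have := circle_dist hI c th (ltW s'0).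
      by rewrite zw => ww; move: s'w; rewrite -ww; lra.
    rewrite /G /g (negbTE zw) !qnormM circle_dist ?(ltW s'0)// ler_wpM2l ?(ltW s'0)//.
    rewrite qnormV; apply: ler_pM; rewrite ?invr_ge0//.
      rewrite lef_pV2 ?posrE ?divr_gt0//; last by rewrite normr_gt0 subr_eq0.
      have := circle_dist hI c th (ltW s'0) => cd.
      have := ler_distD (circle c s' th) w c.
      by rewrite [`|w - circle _ _ _|]distrC cd; lra.
    apply: le_trans (ler_normB _ _) _; rewrite lerD2r.
    rewrite -[F (circle _ _ _)](subrK (F c)) addrC.
    apply: le_trans (ler_normD _ _) _; rewrite lerD2l distrC.
    apply: hd; first exact: circle_plane.
    by rewrite circle_dist ?(ltW s'0)//; lra.
  rewrite (_ : 4 * (s' * K) * T2 = s' * (4 * K * T2)); last first.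
    by rewrite [4 * (s' * K)]mulrCA [RHS]mulrA.
  by rewrite -ler_pdivlMr// mulr_gt0// mulr_gt0.
have [s /andP[ws sr]] : exists s, `|w - c| < s < r by exists ((`|w - c| + r) / 2); apply/andP; lra.
have s0 : 0 < s by exact: lt_trans ws.
have ssr : 0 < s < r by rewrite s0.
set om := w - c in w0 wr ws *.
have omI : cplane I om by exact: cplaneB.
(* The mean of [(om / (z - c))^N G]: it vanishes for [N = 0], tends to zero as [N]
   grows, and its increments give the terms of the Taylor series at [w]. *)
pose Tm N := cmean (fun z => om ^+ N * (ipow N z * G z)) c s.
have contm (A : H -> H) : (forall z, cplane I z -> 0 < `|z - c| < r -> pcont A z) ->
    contab 0 T2 (fun th => A (circle c s th)).
  move=> hA; apply: circle_contab => // th; apply: hA; first exact: circle_plane.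
  by rewrite circle_dist// ltW.
have zc z : 0 < `|z - c| -> z != c by rewrite normr_gt0 subr_eq0.
have cipow N : contab 0 T2 (fun th => ipow N (circle c s th)).
  apply: (contm (ipow N)) => z zI /andP[z0 _].
  by apply: holo_pcont; apply: holo_ipow => //; exact: zc.
(* Doubling the radius multiplies the mean by a power of one half, but it does
   not change it by Cauchy's theorem. *)
have ipow_mean N : cmean (ipow N.+1) c s = 0.
  have M2 : cmean (ipow N.+1) c (2 * s) = (2^-1 ^+ N.+1)%:A * cmean (ipow N.+1) c s.
    rewrite /cmean -qint_mull//; apply: eq_qint => th _.
    rewrite /ipow /circle ![_ + _ - c]addrC !addKr -scalerA.
    have u0 : s *: cis I th \is a GRing.unit.
      by rewrite qunitE -normr_gt0 normrZ cis_norm// mulr1 normr_gt0 gt_eqF.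
    by rewrite invrZ ?unitfE ?pnatr_eq0// exprZn mulr_algl.
  have := cmean_const hI cI s0 (s2 := 2 * s) (G := ipow N.+1).
  rewrite M2 => h; have {h} := h _ _.
  have t1 : s <= 2 * s by lra.
  move=> /(_ t1) h; have {h} := h _.
  have hh z : cplane I z -> s <= `|z - c| <= 2 * s -> holo I (ipow N.+1) z.
    move=> zI /andP[z0 _]; apply: holo_ipow => //; apply: zc; exact: lt_le_trans z0.
  move=> /(_ hh) /eqP; rewrite -subr_eq0 -{1}[cmean _ _ _]mul1r -mulrBl qmulf_eq0.
  rewrite -[X in X - _]scale1r -scalerBl qreal_eq0 => /orP[|/eqP//].
  by rewrite subr_eq0 eq_sym lt_eqF// exprn_ilt1// ?invr_ge0// invf_lt1// ltr1n.
have ipowK N : cmean (fun z => ipow N z * F w) c s =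
    (if N is 0%N then T2%:A else 0) * F w.
  case: N => [|N].
    rewrite mulr_algl; have := qint_cst (F w) (ltW T0); rewrite subr0 => <-.
    by apply: eq_qint => th _; rewrite /ipow expr0 mul1r.
  rewrite mul0r /cmean (qint_mulr (u := fun th => ipow N.+1 (circle c s th)))//.
  by rewrite -/(cmean (ipow N.+1) c s) ipow_mean mul0r.
have cGs : contab 0 T2 (fun th => G (circle c s th)).
  by apply: circle_contab => // th; exact: cGc.
have cipG N : contab 0 T2 (fun th => ipow N (circle c s th) * G (circle c s th)).
  by move=> th hth; apply: cvg_qmul; [exact: (cipow N th hth)|exact: (cGs th hth)].
have cipF N : contab 0 T2 (fun th => ipow N (circle c s th) * F (circle c s th)).
  apply: (contm (fun z => ipow N z * F z)) => z zI zr.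
  by apply: holo_pcont; exact: ipowF_holo.
have cipw N : contab 0 T2 (fun th => ipow N (circle c s th) * F w).
  by move=> th hth; apply: cvg_qmulr; exact: (cipow N th hth).
have cmul (u : R -> H) q : contab 0 T2 u -> contab 0 T2 (fun th => q * u th).
  by move=> cu th hth; apply: cvg_qmull; exact: cu.
have TmS N : Tm N - Tm N.+1 = om ^+ N * (T2 *: taylor_coef N -
   (if N is 0%N then T2%:A else 0) * F w).
  rewrite -(taylor_coefE N ssr) -ipowK /Tm /cmean -qintB; [|exact: cmul|exact: cmul].
  rewrite -[in RHS]qintB// -qint_mull; last first.
    by move=> th hth; apply: cvgB; [exact: (cipF N th hth)|exact: (cipw N th hth)].
  apply: eq_qint => th _; set z := circle c s th.
  have zI : cplane I z by exact: circle_plane.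
  have zw : z - w != 0.
    rewrite subr_eq0; apply/eqP => zw; have := circle_dist hI c th (ltW s0).
    by rewrite -/z zw => h; move: ws; rewrite /om h ltxx.
  have zc0 : z - c != 0 by rewrite subr_eq0 circleN.
  have -> : om ^+ N.+1 * (ipow N.+1 z * G z) =
      om ^+ N * (ipow N z * (om * ((z - c)^-1 * G z))).
    have comm := cplane_comm omI (ipow_plane N zI).
    have -> : ipow N.+1 z = ipow N z * (z - c)^-1 by rewrite /ipow exprSr.
    move: (G z) => X; rewrite exprSr -mulrA; congr (_ * _).
    by rewrite [RHS]mulrA -comm !mulrA.
  rewrite -mulrBr -!mulrBr; do 2 congr (_ * _).
  have eG : (z - c)^-1 * G z = (z - w)^-1 * (F z - F w).
    by rewrite /G mulrA qmulVf// mul1r /g -subr_eq0 (negbTE zw).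
  have eG' : G z = (z - c) * ((z - w)^-1 * (F z - F w)).
    by rewrite -eG mulrA qmulfV// mul1r.
  rewrite eG eG' -mulrBl /om opprB addrA subrK mulrA qmulfV// mul1r.
  by [].
have TmE N : Tm N = (if N is 0%N then 0 else T2 *: F w) -
    T2 *: series (pterm taylor_coef om) N.
  elim: N => [|N IH].
    rewrite /series /= big_geq// scaler0 subr0 /Tm -[RHS](G0 s)//.
    by apply: eq_qint => th _; rewrite /ipow !expr0 !mul1r.
  have -> : Tm N.+1 = Tm N - (Tm N - Tm N.+1) by rewrite opprB addrC subrK.
  rewrite TmS IH seriesSr mulrBr -scalerAr scalerDr.
  case: N {IH} => [|N]; last by rewrite mul0r mulr0 subr0 opprD addrA.
  move: (T2 *: series _ _) => X; rewrite /pterm expr0 !mul1r mulr_algl.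
  by rewrite sub0r opprB opprD addrCA.
have [B B0 hB] := contab_bounded (ltW T0) cGs.
have om1 : 0 <= `|om| / s by rewrite divr_ge0// ltW.
have om2 : `|om| / s < 1 by rewrite ltr_pdivrMr// mul1r.
have TmB N : `|F w - series (pterm taylor_coef om) N.+1| <= 4 * B * (`|om| / s) ^+ N.+1.
  have -> : F w - series (pterm taylor_coef om) N.+1 = T2^-1 *: Tm N.+1.
    by rewrite TmE -scalerBr scalerA mulVf ?scale1r// gt_eqF.
  rewrite normrZ gtr0_norm ?invr_gt0// mulrC ler_pdivrMr//.
  have := qint_le (ltW T0) (cmul _ (om ^+ N.+1) (cipG N.+1)) (M := (`|om| / s) ^+ N.+1 * B).
  rewrite subr0 -/(cmean (fun z => om ^+ N.+1 * (ipow N.+1 z * G z)) c s) -/(Tm N.+1).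
  move=> h; rewrite -[4 * B * _]mulrA [B * _]mulrC; apply: h => th hth.
  move: (hB th hth); move: (G _) => X hX.
  rewrite !qnormM !qnormX qnormV circle_dist ?(ltW s0)// mulrA -exprMn.
  by apply: ler_wpM2l => //; exact: exprn_ge0.
have Sl : (fun N => series (pterm taylor_coef om) N.+1) @ \oo --> F w.
  apply/(cvg_dist0 (F := \oo)).
  apply: (@squeeze_cvgr _ _ _ _ (fun=> 0) (fun N => 4 * B * (`|om| / s) ^+ N.+1)).
  - by near=> N; rewrite normr_ge0 distrC TmB.
  - exact: cvg_cst.
  - rewrite -[X in _ --> X](mulr0 (4 * B)); apply: cvgM; first exact: cvg_cst.
    by rewrite cvg_shiftS; exact: cvg_exprn.
by move: Sl; rewrite cvg_shiftS => Sl;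
  apply: (qcvg_unique Sl); apply: psum_cvg (taylor_gbound ssr) ws.
Unshelve. all: by end_near. Qed.

(** The value at the center is the limit of both sides. *)
Lemma taylor : (forall s, 0 < s < r -> gbound s taylor_coef) /\
  forall z, cplane I z -> `|z - c| < r -> F z = psum taylor_coef (z - c).
Proof.
split=> [|z zI zr]; first exact: taylor_gbound.
have hr : 0 < r / 2 < r by rewrite divr_gt0//= ltr_pdivrMr// ltr_pMr// ltr1n.
have [zc|zc] := eqVneq z c; last first.
  by apply: taylor_punctured => //; rewrite normr_gt0 subr_eq0 zc.
apply/eqP; rewrite zc -subr_eq0 -normr_le0; apply/ler_addgt0Pl => e e0; rewrite addr0.
have e20 : 0 < e / 2 by rewrite divr_gt0.
have hp : holo I (fun w => psum taylor_coef (w - c)) c.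
  by apply: psum_holo (taylor_gbound hr) _ => //; rewrite subrr normr0; case/andP: hr.
have /cvgrPdist_le/(_ _ e20)/near_plane[d1 d10 h1] := cF.
have /cvgrPdist_le/(_ _ e20)/near_plane[d2 d20 h2] := holo_cvg hp.
pose t := Order.min r (Order.min d1 d2) / 2.
have t0 : 0 < Order.min r (Order.min d1 d2) by rewrite !lt_min r0 d10.
have tt : t < Order.min r (Order.min d1 d2) by rewrite /t; lra.
have t00 : 0 < t by rewrite divr_gt0.
move: tt; rewrite !lt_min => /and3P[tr td1 td2].
pose w := c + t%:A.
have wI : cplane I w by apply: cplaneD => //; exact: cplane_real.
have wc : `|w - c| = t by rewrite /w addrC addKr qnorm_real gtr0_norm.
have k1 := h1 w wI ltac:(by rewrite wc).
have k2 := h2 w wI ltac:(by rewrite wc).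
have k3 := @taylor_punctured w wI ltac:(by rewrite wc t00).
apply: le_trans (ler_distD (F w) _ _) _.
by rewrite {2}k3 [X in _ + X]distrC; lra.
Qed.

End Taylor.

(** * The identity principle on a slice *)

Section Identity.
Context {R : realType}.
Local Notation H := (quat R).
Implicit Types (x y s t e : R) (z w c : H).

Lemma psum0 (a : nat -> H) q : (forall n, a n = 0) -> psum a q = 0.
Proof. by move=> a0; rewrite (psum_finite (N := 0))// big_geq. Qed.

Lemma notin_dist (T : seq H) z : z \notin T ->
  exists2 d : R, 0 < d & forall w, `|w - z| < d -> w \notin T.
Proof.
elim: T => [|s T IH] zT; first by exists 1.
move: zT; rewrite inE negb_or => /andP[zs /IH[d d0 hd]].
exists (Order.min d `|s - z|) => [|w]; first by rewrite lt_min d0 normr_gt0 subr_eq0 eq_sym.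
rewrite lt_min inE negb_or => /andP[wd ws]; rewrite hd// andbT.
by apply: contraTneq ws => ->; rewrite ltxx.
Qed.

Variable I : H.
Hypothesis hI : imag_units I.

Lemma holo_taylor (u : H -> H) c r : cplane I c -> 0 < r ->
  (forall z, cplane I z -> `|z - c| < r -> holo I u z) ->
  exists2 a : nat -> H, (forall s, 0 < s < r -> gbound s a) &
    forall z, cplane I z -> `|z - c| < r -> u z = psum a (z - c).
Proof.
move=> cI r0 hu; have cu : holo I u c by apply: hu => //; rewrite subrr normr0.
have hu' z : cplane I z -> 0 < `|z - c| < r -> holo I u z.
  by move=> zI /andP[_]; exact: hu.
have [h1 h2] := taylor hI cI r0 hu' (holo_cvg cu).
by exists (taylor_coef I u c r).
Qed.

(** Zeros accumulating at the center annihilate all Taylor coefficients. *)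
Lemma holo_zero_disc (u : H -> H) c r : cplane I c -> 0 < r ->
  (forall z, cplane I z -> `|z - c| < r -> holo I u z) ->
  (forall e, 0 < e -> exists w, [/\ cplane I w, 0 < `|w - c| < e & u w = 0]) ->
  forall z, cplane I z -> `|z - c| < r -> u z = 0.
Proof.
move=> cI r0 hu hz; have [a ha au] := holo_taylor cI r0 hu.
have hr : 0 < r / 2 < r by rewrite divr_gt0//= ltr_pdivrMr// ltr_pMr// ltr1n.
have a0 : forall n, a n = 0.
  apply: (psum_zero (s := r / 2)); [by case/andP: hr|exact: ha|].
  move=> e e0; have [|w [wI]] := hz (Order.min e r); first by rewrite lt_min e0.
  rewrite lt_min => /and3P[w0 we wr] uw; exists (w - c); first by rewrite w0.
  by rewrite -au.
by move=> z zI zr; rewrite au// psum0.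
Qed.

Section Segment.
Variables (u : H -> H) (x0 r : R) (T : seq H).
Hypothesis r0 : 0 < r.
Local Notation c := (x0%:A : H).
Hypothesis hu : forall z, cplane I z -> `|z - c| < r -> z \notin T -> holo I u z.

Let seg (p q : H) t := p + t *: (q - p).

(** Segments from different real points to the same nonreal point meet at no other
    point. So each exceptional point lies on the segment from at most one real
    starting point, and all starting points to the right of [x0] and close enough
    to it are good. *)
Lemma segment_unblocked x y e : 0 < e -> y != 0 -> slice I x y \notin T ->
  exists2 e', 0 < e' <= e & forall t tau, 0 < t < e' -> 0 <= tau <= 1 ->
    seg ((x0 + t)%:A) (slice I x y) tau \notin T.
Proof.
move=> e0 y0; elim: T => [|s S IH]; first by exists e; rewrite ?e0 ?lexx.
rewrite inE negb_or => /andP[zs /IH[e1 /andP[e10 e1e] h1]].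
have segE t tau : seg ((x0 + t)%:A) (slice I x y) tau =
    slice I (x0 + t + tau * (x - (x0 + t))) (tau * y).
  rewrite /seg -[in LHS](slice0 I (x0 + t)) -sliceB subr0.
  have -> : tau *: slice I (x - (x0 + t)) y = slice I (tau * (x - (x0 + t))) (tau * y).
    by rewrite /slice scalerDr scalerAr !scalerA.
  by rewrite -sliceD add0r.
have uniq_t t t' tau tau' : seg ((x0 + t)%:A) (slice I x y) tau = s ->
    seg ((x0 + t')%:A) (slice I x y) tau' = s -> t = t'.
  move=> hs hs'; have [h2 /(mulIf y0) h3] : x0 + t + tau * (x - (x0 + t)) =
      x0 + t' + tau' * (x - (x0 + t')) /\ tau * y = tau' * y.
    by apply: (slice_inj hI); rewrite -!segE hs hs'.
  have tau1 : 1 - tau != 0.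
    rewrite subr_eq0; apply: contraNneq zs => t1; rewrite -hs segE -t1 !mul1r.
    by rewrite addrC subrK.
  by apply: (mulfI tau1); move: h2; rewrite -h3 => h2; lra.
have [[tb [taub [tb0 tbs]]]|nb] := pselect (exists t tau, 0 < t /\
    seg ((x0 + t)%:A) (slice I x y) tau = s).
  exists (Order.min e1 tb) => [|t tau].
    by rewrite lt_min e10 tb0 ge_min e1e.
  rewrite lt_min inE negb_or => /and3P[t0 te tt] tau01; apply/andP; split.
    by apply/eqP => hs; move: tt; rewrite (uniq_t _ _ _ _ hs tbs) ltxx.
  by apply: h1 => //; rewrite t0.
exists e1 => [|t tau /andP[t0 te] tau01]; first by rewrite e10.
rewrite inE negb_or; apply/andP; split; last by apply: h1; rewrite ?t0.
by apply/eqP => hs; apply: nb; exists t, tau.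
Qed.

(** Zeros propagate along a segment which avoids the exceptional points: the
    set of parameters up to which the function vanishes is open and closed. *)
Lemma identity_segment (p z : H) : cplane I p -> cplane I z -> p != z ->
  `|p - c| < r -> `|z - c| < r ->
  (forall tau, 0 <= tau <= 1 -> seg p z tau \notin T) ->
  (forall e, 0 < e -> exists w, [/\ cplane I w, 0 < `|w - p| < e & u w = 0]) ->
  u p = 0 -> u z = 0.
Proof.
move=> pI zI pz pr zr hT hp up.
have K0 : 0 < `|z - p| by rewrite normr_gt0 subr_eq0 eq_sym.
have segI tau : cplane I (seg p z tau).
  by apply: cplaneD => //; apply: cplaneZ; exact: cplaneB.
have segr tau : 0 <= tau <= 1 -> `|seg p z tau - c| < r.
  move=> /andP[t0 t1]; have -> : seg p z tau - c = (1 - tau) *: (p - c) + tau *: (z - c).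
    rewrite /seg !scalerBr !scalerBl !scale1r; move: (tau *: p) (tau *: z) (tau *: c) (c : H).
    by move=> *; apply: quatP; split; rewrite /=; ring.
  pose m := Order.max `|p - c| `|z - c|.
  have mr : m < r by rewrite gt_max pr.
  have [m1 m2] : `|p - c| <= m /\ `|z - c| <= m by rewrite !le_max !lexx orbT.
  apply: le_lt_trans (ler_normD _ _) _; rewrite !normrZ (ger0_norm t0) ger0_norm ?subr_ge0//.
  apply: le_lt_trans mr; have -> : m = (1 - tau) * m + tau * m by ring.
  by apply: lerD; apply: ler_wpM2l; rewrite ?subr_ge0.
have segB s t : `|seg p z s - seg p z t| = `|s - t| * `|z - p|.
  by rewrite /seg opprD addrACA subrr add0r -scalerBl normrZ.
(* The parameters up to which the function vanishes. *)
pose A := [set tau : R | 0 <= tau <= 1 /\ forall s, 0 <= s <= tau -> u (seg p z s) = 0].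
have A0 : A 0.
  split; first by rewrite lexx ler01.
  by move=> s; rewrite -eq_le => /eqP <-; rewrite /seg scale0r addr0.
have supA : has_sup A.
  by split; [exists 0|exists 1 => tau [/andP[]]].
pose S := sup A.
have S0 : 0 <= S by apply: ub_le_sup => //; case: supA.
have S1 : S <= 1 by apply: ge_sup; [exists 0|move=> tau [/andP[]]].
have below s : 0 <= s -> s < S -> u (seg p z s) = 0.
  move=> s0 sS; have Ss : 0 < S - s by rewrite subr_gt0.
  have [tau [_ htau] st] := sup_adherent Ss supA.
  by apply: htau; rewrite s0 /= ltW//; move: st; rewrite -/S; lra.
have [d d0 hd] := notin_dist (hT S ltac:(by rewrite S0)).
have rS := segr S ltac:(by rewrite S0).
pose eta := Order.min d (r - `|seg p z S - c|).
have eta0 : 0 < eta by rewrite lt_min d0 subr_gt0.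
have disc : forall w, cplane I w -> `|w - seg p z S| < eta -> u w = 0.
  apply: holo_zero_disc => //.
    move=> w wI; rewrite lt_min => /andP[wd wr]; apply: hu => //; last exact: hd.
    rewrite -(subrK (seg p z S) w) -addrA; apply: le_lt_trans (ler_normD _ _) _.
    by rewrite -ltrBrDr.
  move=> e e0; have [S00|S00] := eqVneq S 0.
    have [w [wI we uw]] := hp e e0; exists w; split=> //.
    by rewrite S00 /seg scale0r addr0.
  have Sgt : 0 < S by rewrite lt_neqAle eq_sym S00.
  pose h := Order.min S (e / (2 * `|z - p|)).
  have h0 : 0 < h by rewrite lt_min Sgt divr_gt0// mulr_gt0.
  have hS : h <= S by rewrite ge_min lexx.
  have he : h <= e / (2 * `|z - p|) by rewrite ge_min lexx orbT.
  exists (seg p z (S - h)); split; [exact: segI| |apply: below; lra].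
  rewrite segB (_ : S - h - S = - h); last ring.
  rewrite normrN gtr0_norm// mulr_gt0//= -ltr_pdivlMr//.
  apply: le_lt_trans he _; rewrite invfM mulrA ltr_pM2r ?invr_gt0//.
  by rewrite ltr_pdivrMr// ltr_pMr// ltr1n.
have near_S s : `|s - S| * `|z - p| < eta -> u (seg p z s) = 0.
  by move=> h; apply: disc => //; rewrite segB.
pose h := eta / (2 * `|z - p|).
have h0 : 0 < h by rewrite divr_gt0// mulr_gt0.
have hK : h * `|z - p| < eta.
  rewrite -ltr_pdivlMr// /h invfM mulrA ltr_pM2r ?invr_gt0//.
  by rewrite ltr_pdivrMr// ltr_pMr// ltr1n.
have AS : A (Order.min 1 (S + h)).
  split; first by rewrite ge_min lexx /= le_min ler01 addr_ge0// ltW.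
  move=> s /andP[s0]; rewrite le_min => /andP[s1 sh].
  have [sS|Ss] := ltP s S; first exact: below.
  apply: near_S; apply: le_lt_trans hK; rewrite ler_wpM2r//.
  by rewrite ger0_norm; lra.
have := ub_le_sup (proj2 supA) AS; rewrite -/S ge_min => /orP[S1'|].
  have SE : S = 1 by lra.
  have <- : seg p z 1 = z by rewrite /seg scale1r addrC subrK.
  by apply: near_S; rewrite SE subrr normr0 mul0r.
by rewrite gerDl leNgt h0.
Qed.

End Segment.

(** A nonreal point is joined by a good segment to a small real point; real points
    are limits of nonreal ones. *)
Lemma identity_slice (u : H -> H) (x0 r e : R) (T : seq H) : 0 < r -> 0 < e ->
  (forall z, cplane I z -> `|z - x0%:A| < r -> z \notin T -> holo I u z) ->
  (forall x, 0 < `|x - x0| < e -> u x%:A = 0) ->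
  forall z, cplane I z -> `|z - x0%:A| < r -> z \notin T -> u z = 0.
Proof.
move=> r0 e0 hu hz.
have nonreal x y : y != 0 -> `|slice I x y - x0%:A| < r -> slice I x y \notin T ->
    u (slice I x y) = 0.
  move=> y0 zr zT; have er0 : 0 < Order.min e r by rewrite lt_min e0.
  have [e' /andP[e'0 e'er] he'] := segment_unblocked x0 er0 y0 zT.
  pose t := e' / 2.
  have t0 : 0 < t by rewrite divr_gt0.
  have te' : t < e' by rewrite /t; lra.
  have [te tr] : t < e /\ t < r.
    by have := lt_le_trans te' e'er; rewrite lt_min => /andP[].
  have nt : `|t| = t by rewrite gtr0_norm.
  apply: (@identity_segment u x0 r T hu ((x0 + t)%:A)) => //.
  - exact: cplane_real.
  - exact: cplane_slice.
  - rewrite -(slice0 I); apply/eqP => /(slice_inj hI)[_ /esym/eqP].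
    by rewrite (negbTE y0).
  - by rewrite -scalerBl addrC addKr qnorm_real nt.
  - by move=> tau tau01; apply: he' => //; rewrite t0.
  - move=> d d0; pose h := Order.min d (e - t) / 2.
    have m0 : 0 < Order.min d (e - t) by rewrite lt_min d0 subr_gt0.
    have h0 : 0 < h by rewrite divr_gt0.
    have hm : h < Order.min d (e - t) by rewrite /h; lra.
    move: hm; rewrite lt_min => /andP[hd he].
    exists ((x0 + t + h)%:A); split; first exact: cplane_real.
      by rewrite -scalerBl addrC addKr qnorm_real gtr0_norm// h0.
    apply: hz; have -> : x0 + t + h - x0 = t + h by ring.
    by rewrite gtr0_norm ?addr_gt0//=; lra.
  - by apply: hz; rewrite [x0 + t]addrC addrK nt t0.
move=> z [x [y ->]] zr zT; have [y0|y0] := eqVneq y 0; last exact: nonreal.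
set z0 := slice I x 0.
have z0I : cplane I z0 by exact: cplane_slice.
move: zr zT; rewrite y0 -/z0 => zr zT.
apply/eqP; rewrite -normr_le0; apply/ler_addgt0Pl => d d0; rewrite addr0.
have /cvgrPdist_le/(_ d d0)/near_plane[d1 d10 hd1] := holo_cvg (hu _ z0I zr zT).
have [d2 d20 hd2] := notin_dist zT.
pose m := Order.min d1 (Order.min d2 (r - `|z0 - x0%:A|)).
have m0 : 0 < m by rewrite !lt_min d10 d20 subr_gt0.
pose h := m / 2; have h0 : 0 < h by rewrite divr_gt0.
have hm : h < m by rewrite /h; lra.
move: hm; rewrite !lt_min => /and3P[h1 h2 h3].
have zh : `|slice I x h - z0| = h.
  by rewrite /z0 -sliceB subrr subr0 slice_norm// expr0n add0r sqrtr_sqr gtr0_norm.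
have := hd1 (slice I x h) (cplane_slice I x h); rewrite zh => /(_ h1).
rewrite nonreal ?gt_eqF ?subr0//; last by apply: hd2; rewrite zh.
rewrite -(subrK z0 (slice I x h)) -addrA; apply: le_lt_trans (ler_normD _ _) _.
by rewrite zh -ltrBrDr.
Qed.

End Identity.

(** * Laurent series with finite principal part *)

Section Laurent.
Context {R : realType}.
Local Notation H := (quat R).
Implicit Types (x y s t e : R) (z w c q : H).

(** The coefficients of the Laurent series multiplied by the [N]-th power of the
    variable, as a power series. *)
Definition lcoef (a : int -> H) (N : nat) (k : nat) : H := a (k%:Z - N%:Z).

Lemma shift_lcoef a N : shiftc (lcoef a N.+1) = lcoef a N.
Proof.
by apply/funext => k; rewrite /shiftc /lcoef -!natz !mulrSr opprD addrACA subrr addr0.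
Qed.

Lemma gbound_unshift s (b : nat -> H) : 0 < s -> gbound s (shiftc b) -> gbound s b.
Proof.
move=> s0 [C hC]; exists (Order.max `|b 0%N| (C * s)) => -[|n].
  by rewrite expr0 mulr1 le_max lexx.
rewrite le_max; apply/orP; right; rewrite exprSr mulrA ler_wpM2r ?(ltW s0)//.
exact: hC.
Qed.

Lemma gbound_lcoef s a N : 0 < s -> gbound s (lcoef a 0) -> gbound s (lcoef a N).
Proof.
move=> s0 h; elim: N => [//|N IH]; apply: gbound_unshift => //.
by rewrite shift_lcoef.
Qed.

Lemma gbound_lcoef0 s a N : 0 < s -> gbound s (lcoef a N) -> gbound s (lcoef a 0).
Proof.
move=> s0; elim: N => [//|N IH] h; apply: IH.
by rewrite -shift_lcoef; exact: gbound_shift.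
Qed.

(** The principal part is a finite sum, whose terms become monomials after
    multiplication by the [N]-th power of the variable. *)
Lemma laurent_sum a N s w : vanishes_below a N -> gbound s (lcoef a 0) ->
  0 < `|w| < s -> exists u v : H,
  [/\ series (fun k : nat => w ^ k%:Z * a k%:Z) @ \oo --> u,
      series (fun k : nat => w ^ (- k.+1%:Z) * a (- k.+1%:Z)) @ \oo --> v
    & w ^+ N * (u + v) = psum (lcoef a N) w].
Proof.
move=> van ha /andP[w0 ws]; have s0 : 0 < s by exact: lt_trans ws.
have wn0 : w != 0 by rewrite -normr_gt0.
exists (psum (lcoef a 0) w).
exists (\sum_(0 <= k < N) w ^ (- k.+1%:Z) * a (- k.+1%:Z)); split.
- have := psum_cvg ha ws; rewrite /pterm.
  rewrite [X in series X @ _ --> _ -> _](_ : _ =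
    fun k : nat => w ^ k%:Z * a k%:Z) // ; apply/funext => k.
  by rewrite /lcoef subr0.
- apply: cvg_near_cst; near=> n; rewrite /series /=.
  have Nn : (N <= n)%N by near: n; exact: nbhs_infty_ge.
  rewrite (big_cat_nat (n := N))//= [X in _ + X]big1_seq ?addr0// => k.
  by rewrite mem_index_iota => /andP[_ /andP[Nk _]]; rewrite van ?mulr0.
elim: N {van} => [|N IH].
  by rewrite big_geq// addr0 expr0 mul1r.
have hN := gbound_lcoef N.+1 s0 ha.
rewrite (psum_shift hN ws) shift_lcoef -IH big_nat_recr//= addrA mulrDr [LHS]addrC.
congr (_ + _); last by rewrite exprS mulrA.
by rewrite mulrA /lcoef sub0r -exprnN qmulfV ?mul1r// qexpf_neq0.
Unshelve. all: by end_near. Qed.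

(** A function has at most a pole at [z] in the slice: a power of the variable
    extends it holomorphically. *)
Definition mero I (F G : H -> H) z N := exists2 d : R, 0 < d &
  (forall w, cplane I w -> `|w - z| < d -> holo I G w) /\
  (forall w, cplane I w -> 0 < `|w - z| < d -> (w - z) ^+ N * F w = G w).

(** The part of the series with nonnegative exponents converges at points at
    every distance less than the radius, which bounds its coefficients. *)
Lemma laurent_mero f z I a N : imag_units I -> laurent f z I a ->
  vanishes_below a N ->
  mero I f (fun w => psum (lcoef a N) (w - z)) z N /\
  exists2 s, 0 < s & gbound s (lcoef a 0).
Proof.
move=> hI [zI [r r0 hr]] van.
have ga s : 0 < s < r -> gbound s (lcoef a 0).
  move=> /andP[s0 sr].
  have zsI : cplane I (z + s%:A) by apply: cplaneD => //; exact: cplane_real.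
  have nzs : `|z + s%:A - z| = s by rewrite addrC addKr qnorm_real gtr0_norm.
  have [|_ [u [v [hu _ _]]]] := hr _ zsI; first by rewrite nzs s0.
  have [M [Mr hM]] := cvg_seq_bounded (cvgP _ (cvg_series_cvg_0 (cvgP _ hu))).
  exists (M + 1) => n; have /(_ _ n Logic.I) := hM (M + 1).
  rewrite /lcoef subr0 /= (_ : z + s%:A - z = s%:A); last by rewrite addrC addKr.
  rewrite qnormM -exprnP qnormX qnorm_real gtr0_norm//.
  by rewrite mulrC; apply; rewrite ltrDl.
have hr2 : 0 < r / 2 < r by rewrite divr_gt0//= ltr_pdivrMr// ltr_pMr// ltr1n.
have [r20 r2r] := andP hr2.
split; last by exists (r / 2) => //; exact: ga.
exists (r / 2) => //; split=> w wI.
  move=> wr; apply: (psum_holo zI wI _ wr).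
  by apply: gbound_lcoef => //; exact: ga.
move=> /andP[w0 wr].
have [|_ [u [v [hu hv ->]]]] := hr _ wI; first by rewrite w0 (lt_trans wr).
have [|u' [v' [hu' hv' <-]]] := laurent_sum van (ga _ hr2) (w := w - z).
  by rewrite w0.
by rewrite (qcvg_unique hu hu') (qcvg_unique hv hv').
Qed.

(** The Laurent coefficients are the shifted Taylor coefficients of the
    extension. *)
Lemma mero_laurent (f : qfun R) z I G N : imag_units I -> cplane I z -> mero I f G z N ->
  (exists2 d : R, 0 < d & forall w, cplane I w -> 0 < `|w - z| < d -> dom f w) ->
  exists2 a, laurent f z I a & vanishes_below a N.
Proof.
move=> hI zI [d d0 [hG hF]] [d' d'0 hd'].
have [b hb bG] := holo_taylor hI zI d0 hG.
pose a (k : int) : H := if (k + N%:Z)%R is Posz j then b j else 0.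
have aN : lcoef a N = b by apply/funext => k; rewrite /lcoef /a subrK.
have van : vanishes_below a N.
  move=> m Nm; rewrite /a; case E: (- m%:Z + N%:Z) => [j|//].
  move: E => /eqP; rewrite addrC subr_eq -PoszD eqz_nat => /eqP NE.
  by move: Nm; rewrite NE ltnNge leq_addl.
exists a => //; split=> //; exists (Order.min d d') => [|w wI]; first by rewrite lt_min d0.
rewrite lt_min => /and3P[w0 wd wd']; split; first by apply: hd'; rewrite ?w0.
have [s /andP[ws sd]] : exists s, `|w - z| < s < d.
  by exists ((`|w - z| + d) / 2); apply/andP; lra.
have s0 : 0 < s by exact: lt_trans ws.
have gb : gbound s (lcoef a 0).
  by apply: (gbound_lcoef0 (N := N)) => //; rewrite aN; apply: hb; rewrite s0.
have [|u [v [hu hv uv]]] := laurent_sum van gb (w := w - z); first by rewrite w0.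
exists u, v; split => //.
have wz0 : (w - z) ^+ N != 0 by rewrite qexpf_neq0// -normr_gt0.
apply: (@mulrI _ ((w - z) ^+ N)); first by rewrite qunitE.
by rewrite uv aN -bG// hF// w0.
Qed.

End Laurent.

(** * Singularities of semiregular functions *)

Section Semireg.
Context {R : realType}.
Local Notation H := (quat R).
Implicit Types (x y s t e r : R) (z w c q p : H).
Variables (rho : \bar R) (f : qfun R).
Hypothesis f_sr : semiregular (qball rho) f.

Lemma qball_lt z : qball rho z -> exists2 r, `|z| < r & (r%:E < rho)%E.
Proof.
rewrite /qball /=; case: rho => [r||] h.
- by move: h; rewrite lte_fin => h; exists ((`|z| + r) / 2); rewrite ?lte_fin; lra.
- by exists (`|z| + 1); rewrite ?ltry ?ltrDl.
- by move: h; rewrite ltNge leNye.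
Qed.

Lemma qball_near z : qball rho z ->
  exists2 d : R, 0 < d & forall w, `|w - z| < d -> qball rho w.
Proof.
move=> /qball_lt[r zr rr]; exists (r - `|z|) => [|w wz]; first by rewrite subr_gt0.
rewrite /qball /=; apply: lt_trans rr; rewrite lte_fin -(subrK z w).
by apply: le_lt_trans (ler_normD _ _) _; rewrite -ltrBrDr.
Qed.

Lemma dom_near z : dom f z -> exists2 d : R, 0 < d & forall w, `|w - z| < d -> dom f w.
Proof.
case: f_sr => _ [oD _ _] _ _ fz; have /nbhs_ballP[d /= d0 hd] := open_nbhs_nbhs (conj oD fz).
by exists d => // w wz; apply: hd; rewrite -ball_normE /= distrC.
Qed.

Lemma dom_holo I z : imag_units I -> cplane I z -> dom f z -> holo I f z.
Proof. by case: f_sr => _ h _ _ hI zI fz; exact: (regular_holo h). Qed.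

Lemma sing_isolated I z : imag_units I -> cplane I z -> qball rho z ->
  exists2 d : R, 0 < d & forall w, cplane I w -> 0 < `|w - z| < d -> dom f w.
Proof.
move=> hI zI zr; have [fz|nfz] := pselect (dom f z).
  by have [d d0 hd] := dom_near fz; exists d => // w _ /andP[_]; exact: hd.
have [_ _ iso _] := f_sr; have [|_ [V Vz VS]] := iso I hI z; first by [].
have [d1 d10 hd1] := qball_near zr; have /nbhs_ballP[d /= d0 hd] := Vz.
exists (Order.min d d1) => [|w wI]; first by rewrite lt_min d0.
rewrite lt_min => /and3P[w0 wd wd1]; apply: contrapT => nfw.
have : (V `&` ((qball rho `\` dom f) `&` cplane I)) w.
  by split; [apply: hd; rewrite -ball_normE /= distrC|split=> //; split=> //; exact: hd1].
by rewrite VS /= => wz; move: w0; rewrite wz subrr normr0 ltxx.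
Qed.

(** Compactness of the disc, by bisection: every point has a neighborhood with at
    most one singularity. *)
Lemma sing_finite I r : imag_units I -> 0 < r -> (r%:E < rho)%E -> exists T : seq H,
  (forall s : H, s \in T -> [/\ cplane I s, `|s| <= r & ~ dom f s]) /\
  (forall z, cplane I z -> `|z| <= r -> z \notin T -> dom f z).
Proof.
move=> hI r0 rr.
have [T hT] : exists T : seq H, forall a b, - r <= a <= - r + 2 * r * 1 ->
    - r <= b <= - r + 2 * r * 1 -> `|slice I a b| <= r -> ~ dom f (slice I a b) ->
    slice I a b \in T.
  have r20 : 0 <= 2 * r by rewrite mulr_ge0// ltW.
  apply: (@rectangle_bisection R (fun x y t => exists T : seq H, forall a b,
    x <= a <= x + 2 * r * t -> y <= b <= y + 2 * r * t -> `|slice I a b| <= r ->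
    ~ dom f (slice I a b) -> slice I a b \in T) (- r) (- r) (2 * r) (2 * r)) => //.
  - move=> x y t t0 _ [T1 h1] [T2 h2] [T3 h3] [T4 h4].
    exists (T1 ++ T2 ++ T3 ++ T4) => a b /andP[a1 a2] /andP[b1 b2] ab nab.
    have tw (c : R) : c + 2 * r * (2 * t) = c + 2 * r * t + 2 * r * t by ring.
    rewrite tw in a2; rewrite tw in b2; rewrite !mem_cat.
    have [ax|xa] := leP a (x + 2 * r * t); have [by'|yb] := leP b (y + 2 * r * t).
    + by rewrite h1 ?orbT// ?a1 ?b1.
    + by rewrite h3 ?orbT// ?a1 ?(ltW yb).
    + by rewrite h2 ?orbT// ?b1 ?(ltW xa).
    + by rewrite h4 ?orbT// ?(ltW xa) ?(ltW yb).
  - move=> x y _ _; set z := slice I x y.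
    have close d : 0 < d -> exists2 d', 0 < d' & forall x' y' t, 0 < t < d' ->
        x' <= x <= x' + 2 * r * t -> y' <= y <= y' + 2 * r * t ->
        forall a b, x' <= a <= x' + 2 * r * t -> y' <= b <= y' + 2 * r * t ->
        `|slice I a b - z| < d.
      move=> d0; exists (d / (4 * r)); first by rewrite divr_gt0// mulr_gt0.
      move=> x' y' t /andP[t0]; rewrite ltr_pdivlMr ?mulr_gt0// => td.
      move=> /andP[x1 x2] /andP[y1 y2] a b /andP[a1 a2] /andP[b1 b2].
      rewrite /z -sliceB; apply: le_lt_trans (slice_norm_le hI _ _) _.
      have h1 : `|a - x| <= 2 * r * t by rewrite ler_norml; apply/andP; lra.
      have h2 : `|b - y| <= 2 * r * t by rewrite ler_norml; apply/andP; lra.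
      lra.
    have [zr|rz] := leP `|z| r.
      have [|d d0 hd] := @sing_isolated I z hI (cplane_slice I x y).
        by rewrite /qball /=; apply: le_lt_trans rr; rewrite lee_fin.
      have [d' d'0 hd'] := close d d0; exists d' => // x' y' t td _ xx yy.
      exists [:: z] => a b aa bb _ nab; rewrite inE; apply: contrapT => /negP abz.
      apply: nab; apply: hd; first exact: cplane_slice.
      by rewrite normr_gt0 subr_eq0 abz (hd' x' y' t).
    have [d' d'0 hd'] := close (`|z| - r) ltac:(by rewrite subr_gt0).
    exists d' => // x' y' t td _ xx yy.
    exists [::] => a b aa bb abr; have := hd' _ _ _ td xx yy _ _ aa bb.
    have := ler_normB (slice I a b) (slice I a b - z).
    by rewrite opprB addrC subrK; lra.
exists [seq s <- T | `[< [/\ cplane I s, `|s| <= r & ~ dom f s] >]]; split.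
  by move=> s; rewrite mem_filter => /andP[/asboolP].
move=> z zI zr; rewrite mem_filter negb_and => hz; apply: contrapT => nz.
move: hz => /orP[/asboolP|]; first by apply.
move=> /negP; apply; move: zI zr nz => [x [y ->]] zr nz; apply: hT => //.
  by have := slice_norm_gex hI x y; rewrite ler_norml => ?; apply/andP; lra.
by have := slice_norm_gey hI x y; rewrite ler_norml => ?; apply/andP; lra.
Qed.

(** A slice contains finitely many singularities in each smaller closed disc, so
    that [identity_slice] applies. *)
Lemma identity_semireg I r (u : H -> H) e : imag_units I -> 0 < r -> (r%:E < rho)%E ->
  0 < e -> (forall z, cplane I z -> `|z| < r -> dom f z -> holo I u z) ->
  (forall x, 0 < `|x| < e -> u x%:A = 0) ->
  forall z, cplane I z -> `|z| < r -> dom f z -> u z = 0.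
Proof.
move=> hI r0 rr e0 hu hz z zI zr fz.
have [T [hT1 hT2]] := sing_finite hI r0 rr.
apply: (@identity_slice _ _ hI u 0 r e T) => //.
- move=> w wI; rewrite scale0r subr0 => wr wT; apply: hu => //.
  by apply: hT2 => //; exact: ltW.
- by move=> x; rewrite subr0; exact: hz.
- by rewrite scale0r subr0.
- by apply/negP => /hT1[_ _].
Qed.

Lemma cplane_same I J z : imag_units I -> imag_units J -> cplane I z -> cplane J z ->
  qconj z != z -> cplane I = cplane J.
Proof.
by move=> hI hJ zI zJ zr; apply/seteqP; split; [exact: cplane_eq zr|exact: cplane_eq zr].
Qed.

Lemma laurent_same I J z a : cplane I = cplane J -> laurent f z I a -> laurent f z J a.
Proof. by rewrite /laurent => ->. Qed.

Lemma mero_dom I z : imag_units I -> cplane I z -> dom f z -> mero I f f z 0.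
Proof.
move=> hI zI /dom_near[d d0 hd]; exists d => //; split=> w wI.
  by move=> wd; apply: dom_holo => //; exact: hd.
by rewrite expr0 mul1r.
Qed.

(** The singularities are poles in every slice. At real points, which lie in all
    slices, the Laurent expansion in one slice is valid in the others by the
    identity principle. *)
Lemma mero_ball I z : imag_units I -> cplane I z -> qball rho z ->
  exists G N, mero I f G z N.
Proof.
move=> hI zI zr; have [fz|nfz] := pselect (dom f z).
  by exists f, 0%N; exact: mero_dom.
have [_ _ _ /(_ z (conj zr nfz))[J [a [hJ la [N van]]]]] := f_sr.
have [m [s s0 gs]] := laurent_mero hJ la van.
exists (fun w => psum (lcoef a N) (w - z)), N.
have [zreal|znr] := eqVneq (qconj z) z; last first.
  have e := cplane_same hJ hI (proj1 la) zI znr.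
  have la' := laurent_same e la.
  by have [] := laurent_mero hI la' van.
have [x0 zE] := real_cplane hI zI zreal.
have [d d0 hd] := sing_isolated hI zI zr.
case: m => d' d'0 [_ hd'].
pose r := Order.min d (Order.min d' s).
have r0 : 0 < r by rewrite !lt_min d0 d'0.
have [rd [rd' rs]] : r <= d /\ (r <= d' /\ r <= s) by rewrite !ge_min !lexx !orbT.
have hG w : cplane I w -> `|w - z| < r -> holo I (fun w => psum (lcoef a N) (w - z)) w.
  move=> wI wr; apply: (psum_holo zI wI (gbound_lcoef N s0 gs)).
  exact: lt_le_trans rs.
exists r => //; split=> // w wI /andP[w0 wr]; apply/eqP; rewrite -subr_eq0; apply/eqP.
apply: (@identity_slice _ _ hI (fun w => (w - z) ^+ N * f w - psum (lcoef a N) (w - z))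
  x0 r r [:: z]) => //.
- move=> w'; rewrite -zE inE => w'I w'r w'z; apply: holoB; last exact: hG.
  apply: holoM => //.
  + by apply: cplaneX => //; exact: cplaneB.
  + apply: (holoX (T := fun w => w - z)) => //.
    * by near=> v; apply: cplaneB => //; near: v; exact: plane_near.
    * exact: cplaneB.
    * exact: holo_subc.
  + by apply: dom_holo => //; apply: hd => //; rewrite normr_gt0 subr_eq0 w'z (lt_le_trans w'r).
- move=> x xr; apply/eqP; rewrite subr_eq0; apply/eqP; apply: hd'.
    exact: cplane_real.
  rewrite zE -scalerBl qnorm_real; move: xr => /andP[-> xr] /=.
  exact: lt_le_trans rd'.
- by rewrite -zE.
- by rewrite inE -subr_eq0 -normr_gt0.
Unshelve. all: by end_near. Qed.

(** Singularities are poles by hypothesis; at the other points there is the Taylor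
    series. *)
Lemma is_ord_ord z : qball rho z -> is_ord f z (ord f z).
Proof.
move=> zr; apply: (@xgetPex _ 0%N [set n | is_ord f z n]).
have [I hI zI] := cplane_exists z.
suff [J [a [hJ la [n van]]]] : pole f z.
  have ex : exists n, `[< vanishes_below a n >] by exists n; apply/asboolP.
  exists (ex_minn ex); exists J, a; case: ex_minnP => k /asboolP vk kmin.
  by split=> // k' vk'; apply: kmin; apply/asboolP.
have [fz|nfz] := pselect (dom f z); last first.
  by have [_ _ _] := f_sr; apply.
have [d d0 hd] := dom_near fz.
have [|a la van] := mero_laurent hI zI (mero_dom hI zI fz).
  by exists d => // w _ /andP[_]; exact: hd.
by exists I, a; split=> //; exists 0%N.
Qed.

End Semireg.

(** * Real polynomials as slice preserving functions *)

Section PolyEval.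
Context {R : realType}.
Local Notation H := (quat R).
Implicit Types (x y s t e r : R) (z w c q p : H) (Q : {poly R}).

Definition qcoef Q (n : nat) : H := (Q`_n)%:A.

Lemma psum_qcoef Q z : psum (qcoef Q) z = horner_alg z Q.
Proof.
rewrite (psum_finite (N := size Q)) => [|n Qn]; last first.
  by rewrite /qcoef nth_default// scale0r.
rewrite /horner_alg /horner_morph (@horner_coef_wide _ (size Q)) ?size_poly// big_mkord.
apply: eq_bigr => i _; rewrite coef_map_id0 ?rmorph0//= /qcoef.
by rewrite qscalarC.
Qed.

Lemma gbound_qcoef Q s : gbound s (qcoef Q).
Proof.
by apply: (@gbound_finite _ _ (size Q)) => n Qn; rewrite /qcoef nth_default// scale0r.
Qed.

Lemma horner_alg_real x Q : horner_alg (x%:A : H) Q = (Q.[x])%:A.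
Proof.
elim/poly_ind: Q => [|Q c IH]; first by rewrite rmorph0 horner0 scale0r.
by rewrite rmorphD rmorphM/= horner_algX horner_algC IH !hornerE qrealD qrealM.
Qed.

Lemma horner_alg_plane I z Q : imag_units I -> cplane I z -> cplane I (horner_alg z Q).
Proof.
move=> hI zI; elim/poly_ind: Q => [|Q c IH]; first by rewrite rmorph0; exact: cplane0.
rewrite rmorphD rmorphM/= horner_algX horner_algC.
by apply: cplaneD => //; [exact: cplaneM|exact: cplane_real].
Qed.

Lemma horner_alg_holo I z Q : imag_units I -> cplane I z ->
  holo I (fun w => horner_alg w Q) z.
Proof.
move=> hI zI; under [X in holo _ X]eq_fun do rewrite -psum_qcoef -[X in psum _ X]subr0.
apply: (psum_holo (s := `|z| + 1) (cplane0 I) zI); first exact: gbound_qcoef.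
by rewrite subr0 ltrDl.
Qed.

(** By the identity principle a nonzero polynomial has isolated zeros in each
    slice, although its zeros may fill spheres. *)
Lemma horner_alg_zeros I z Q : imag_units I -> cplane I z -> Q != 0 ->
  exists2 d : R, 0 < d & forall w, cplane I w -> 0 < `|w - z| < d -> horner_alg w Q != 0.
Proof.
move=> hI zI; apply: contraPP => hn; apply/negP; rewrite negbK.
have hz e : 0 < e -> exists w, [/\ cplane I w, 0 < `|w - z| < e & horner_alg w Q = 0].
  move=> e0; apply: contrapT => h; apply: hn; exists e => // w wI we.
  by apply/eqP => Qw; apply: h; exists w.
have r0 : 0 < `|z| + 1 by rewrite ltr_pwDr.
have hQ := holo_zero_disc hI zI r0 (fun w wI _ => horner_alg_holo Q hI wI) hz.
suff c0 n : qcoef Q n = 0.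
  by apply/eqP/polyP => n; rewrite coef0; apply/eqP; rewrite -qreal_eq0; apply/eqP/c0.
apply: (psum_zero ltr01 (gbound_qcoef Q 1)) => e e0.
have [t [t0 te t1]] : exists t : R, [/\ 0 < t, t < e & t < 1].
  by exists (Order.min e 1 / 2); rewrite /Order.min; case: ifP => h; split; lra.
exists t%:A; first by rewrite qnorm_real gtr0_norm// t0.
rewrite psum_qcoef; apply: hQ; first exact: cplane_real.
apply: le_lt_trans (ler_normB _ _) _.
by rewrite qnorm_real gtr0_norm// addrC ltrD2l.
Qed.

Lemma horner_small Q : Q != 0 ->
  exists2 d : R, 0 < d & forall x, 0 < `|x| < d -> Q.[x] != 0.
Proof.
move=> Q0; have [I hI _] := cplane_exists (0 : H).
have [d d0 hd] := horner_alg_zeros hI (cplane0 I) Q0; exists d => // x xd.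
by rewrite -(qreal_eq0 (R := R)) -horner_alg_real; apply: hd; rewrite ?subr0 ?qnorm_real//; exact: cplane_real.
Qed.

(** The real polynomial which vanishes on the sphere of the conjugates of [s]. *)
Definition quadp (s : H) : {poly R} := 'X^2 - (2 * qre s)%:P * 'X + (qnormsq s)%:P.

Lemma horner_quadp I z (s : H) : imag_units I -> cplane I z -> cplane I s ->
  horner_alg z (quadp s) = (z - s) * (z - qconj s).
Proof.
move=> hI zI sI; rewrite /quadp rmorphD rmorphB !rmorphM/= horner_algX !horner_algC.
have -> : 2%:A * (qre s)%:A = s + qconj s :> H.
  by rewrite -qrealM; apply: quatP; split; rewrite /=; ring.
rewrite mulrDl -qmul_conj mulrBl !mulrBr (cplane_comm zI (cplane_conj hI sI)).
by rewrite !opprD opprK !addrA; congr (_ + _); rewrite addrAC.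
Qed.

End PolyEval.

(** * Removable singularities in a slice *)

Section Patch.
Context {R : realType}.
Local Notation H := (quat R).
Implicit Types (x y s t e r : R) (z w c q p : H) (Q : {poly R}).
Variable I : H.
Hypothesis hI : imag_units I.

(** Two extensions agree on a punctured disc, hence at the center too. *)
Lemma mero_unique (F G G' : H -> H) z : cplane I z ->
  mero I F G z 0 -> mero I F G' z 0 ->
  exists2 d, 0 < d & forall w, cplane I w -> `|w - z| < d -> G w = G' w.
Proof.
move=> zI [d d0 [hG GF]] [d' d'0 [hG' GF']].
pose r := Order.min d d'; have r0 : 0 < r by rewrite lt_min d0.
have [rd rd'] : r <= d /\ r <= d' by rewrite !ge_min !lexx orbT.
exists r => // w wI wr; apply/eqP; rewrite -subr_eq0; apply/eqP.
apply: (holo_zero_disc hI (u := fun w => G w - G' w) zI r0) => //.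
- move=> v vI vr; apply: holoB; [apply: hG|apply: hG'] => //; exact: lt_le_trans vr _.
- move=> e e0; pose t := Order.min e r / 2.
  have [t0 te tr] : [/\ 0 < t, t < e & t < r].
    by rewrite /t /Order.min; case: ifP => h; split; lra.
  have nt : `|z + t%:A - z| = t by rewrite addrC addKr qnorm_real gtr0_norm.
  have tI : cplane I (z + t%:A) by apply: cplaneD => //; exact: cplane_real.
  exists (z + t%:A); split; rewrite ?nt ?t0//.
  rewrite -GF ?nt ?t0 ?(lt_le_trans tr)// -GF' ?nt ?t0 ?(lt_le_trans tr)//.
  by rewrite subrr.
Qed.

(** The values of the local extensions at their centers form a holomorphic
    function on the disc, which has a Taylor series at the origin. *)
Lemma mero_taylor (u : H -> H) r : 0 < r ->
  (forall z, cplane I z -> `|z| < r -> exists G, mero I u G z 0) ->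
  exists2 d : nat -> H, (forall s, 0 < s < r -> gbound s d) &
    forall z G, cplane I z -> `|z| < r -> mero I u G z 0 -> G z = psum d z.
Proof.
move=> r0 hu.
have [E hE] : exists E : H -> H -> H,
    forall z, cplane I z -> `|z| < r -> mero I u (E z) z 0.
  have : forall z, exists G, cplane I z -> `|z| < r -> mero I u G z 0.
    move=> z; have [[zI zr]|nz] := pselect (cplane I z /\ `|z| < r).
      by have [G hG] := hu z zI zr; exists G.
    by exists u => zI zr; case: nz.
  by move=> /choice[E hE]; exists E.
(* The value at the center of the extension chosen there. *)
pose U z := E z z.
have EU z : cplane I z -> `|z| < r ->
    exists2 d, 0 < d & forall w, cplane I w -> `|w - z| < d -> holo I (E z) w /\ U w = E z w.
  move=> zI zr; have [d d0 [hd1 hd2]] := hE z zI zr.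
  exists (Order.min d (r - `|z|)) => [|w wI]; first by rewrite lt_min d0 subr_gt0.
  rewrite lt_min ltrBrDr => /andP[wd wr]; split; first exact: hd1.
  have [->//|wz] := eqVneq w z.
  have wr' : `|w| < r.
    by rewrite -(subrK z w); apply: le_lt_trans (ler_normD _ _) wr.
  have m : mero I u (E z) w 0.
    have wz0 : 0 < `|w - z| by rewrite normr_gt0 subr_eq0.
    exists (Order.min `|w - z| (d - `|w - z|)) => [|]; first by rewrite lt_min wz0 subr_gt0.
    have vd v : `|v - w| < d - `|w - z| -> `|v - z| < d.
      move=> h; rewrite -(subrK w v) -addrA; apply: le_lt_trans (ler_normD _ _) _.
      by rewrite -ltrBrDr.
    split=> v vI; rewrite lt_min.
      by move=> /andP[_ vw]; apply: hd1 => //; exact: vd.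
    move=> /and3P[_ vw1 vw2]; rewrite -hd2 ?expr0//; rewrite vd// andbT normr_gt0 subr_eq0.
    by apply/eqP => vz; move: vw1; rewrite vz distrC ltxx.
  have [d' d'0] := mero_unique wI (hE w wI wr') m.
  by apply => //; rewrite subrr normr0.
have hU z : cplane I z -> `|z| < r -> holo I U z.
  move=> zI zr; have [d d0 hd] := EU z zI zr.
  have /hd[//|h _] : cplane I z by [].
    by rewrite subrr normr0.
  apply: holo_near h => //; apply/near_plane; exists d => // w wI wd.
  by have [] := hd w wI wd.
have [z zI|d hd Ud] := holo_taylor hI (cplane0 I) r0 (u := U).
  by rewrite subr0; exact: hU.
exists d => // z G zI zr hG; have := Ud z zI; rewrite !subr0 => <-//.
have [d' d'0 ->//] := mero_unique zI hG (hE z zI zr).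
by rewrite subrr normr0.
Qed.

End Patch.

(** * Clearing the poles of a semiregular function *)

Section Structure.
Context {R : realType}.
Local Notation H := (quat R).
Implicit Types (x y s t e r : R) (z w c q : H) (Q : {poly R}).

Lemma mero_same I J (F G : H -> H) z N : cplane I = cplane J -> mero I F G z N -> mero J F G z N.
Proof. by rewrite /mero /holo => ->. Qed.

Lemma mero_eq I (F F' G : H -> H) z N : (forall w, cplane I w -> F w = F' w) ->
  mero I F G z N -> mero I F' G z N.
Proof.
move=> FF' [d d0 [hG hF]]; exists d => //; split=> // w wI wd.
by rewrite -FF'// hF.
Qed.

(** The factor which clears the pole leaves a removable singularity. *)
Lemma mero_absorb I (F G : H -> H) z N :
  mero I F G z N -> mero I (fun w => (w - z) ^+ N * F w) G z 0.
Proof.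
move=> [d d0 [hG hF]]; exists d => //; split=> // w wI wd.
by rewrite expr0 mul1r hF.
Qed.

(** The factor [T] commutes with the power of the variable which clears the pole. *)
Lemma mero_mull I (T F G : H -> H) z N : imag_units I -> cplane I z ->
  (forall w, cplane I w -> cplane I (T w) /\ holo I T w) ->
  mero I F G z N -> mero I (fun w => T w * F w) (fun w => T w * G w) z N.
Proof.
move=> hI zI hT [d d0 [hG hF]]; exists d => //; split=> w wI wd.
  by have [Tw hTw] := hT w wI; apply: holoM => //; exact: hG.
have [Tw _] := hT w wI; rewrite -hF// !mulrA; congr (_ * _).
exact: (cplane_comm (cplaneX hI N (cplaneB wI zI)) Tw).
Qed.

Lemma holo_plane_subX I c n w : imag_units I -> cplane I c -> cplane I w ->
  cplane I ((w - c) ^+ n) /\ holo I (fun w => (w - c) ^+ n) w.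
Proof.
move=> hI cI wI; split; first by apply: cplaneX => //; exact: cplaneB.
apply: (holoX (T := fun w => w - c)) => //.
- by near=> v; apply: cplaneB => //; near: v; exact: plane_near.
- exact: cplaneB.
- exact: holo_subc.
Unshelve. all: by end_near. Qed.

Variables (rho : \bar R) (f : qfun R) (p : H).
Hypothesis f_sr : semiregular (qball rho) f.
Hypothesis p_in : qball rho p.

(** The minimality of the order says that the leading coefficient of the
    principal part does not vanish. *)
Lemma ord_extension z k : is_ord f z k -> exists I G,
  [/\ imag_units I, cplane I z, mero I f G z k & (0 < k)%N -> G z != 0].
Proof.
move=> [I [a [hI la van kmin]]]; have [mer [s s0 gs]] := laurent_mero hI la van.
exists I, (fun w => psum (lcoef a k) (w - z)); split=> //; first exact: (proj1 la).
move=> k0; rewrite subrr (psum_shift (gbound_lcoef k s0 gs)) ?normr0// mul0r addr0.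
rewrite /lcoef sub0r; apply/eqP => ak.
have : vanishes_below a k.-1.
  move=> l; rewrite prednK// leq_eqVlt => /predU1P[<-//|]; exact: van.
by move/kmin; rewrite leqNgt prednK ?leqnn.
Qed.

Let m := ord f p.
Let n := ord f (qconj p).

Definition ordfactor w : H := (w - p) ^+ ord f p * (w - qconj p) ^+ ord f (qconj p).

Lemma qball_conj : qball rho (qconj p).
Proof. by rewrite /qball /= qnorm_conj. Qed.

(** Near each of the two points one of the linear factors clears the pole and the
    other one is not zero, except that both coincide if [p] is real. *)
Lemma ordfactor_extension : exists I Gp Gp', [/\ imag_units I, cplane I p,
  mero I (fun w => ordfactor w * f w) Gp p 0,
  mero I (fun w => ordfactor w * f w) Gp' (qconj p) 0 &
  p != qconj p -> ((0 < m)%N -> Gp p != 0) /\ ((0 < n)%N -> Gp' (qconj p) != 0)].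
Proof.
have [I [G [hI pI mG G0]]] := ord_extension (is_ord_ord f_sr p_in).
have pI' := cplane_conj hI pI.
have sX c k w : cplane I c -> cplane I w -> cplane I ((w - c) ^+ k).
  by move=> cI wI; apply: cplaneX => //; exact: cplaneB.
have mp : mero I (fun w => ordfactor w * f w) (fun w => (w - qconj p) ^+ n * G w) p 0.
  have := mero_mull hI pI (fun w => holo_plane_subX n hI pI' (w := w)) (mero_absorb mG).
  apply: mero_eq => w wI; rewrite mulrA /ordfactor.
  by rewrite (cplane_comm (sX (qconj p) n w pI' wI) (sX p m w pI wI)).
have [pr|pnr] := eqVneq p (qconj p).
  case: (ex_intro (fun G => mero I _ G p 0) _ mp) => G1 {}mp.
  by exists I, G1, G1; split=> //; rewrite -?pr ?eqxx.
have [J [G' [hJ pJ mG' G'0]]] := ord_extension (is_ord_ord f_sr qball_conj).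
have e : cplane J = cplane I by apply: (cplane_same hJ hI pJ pI'); rewrite qconjK.
exists I, (fun w => (w - qconj p) ^+ n * G w), (fun w => (w - p) ^+ m * G' w); split=> //.
  have := mero_mull hI pI' (fun w => holo_plane_subX m hI pI (w := w))
    (mero_absorb (mero_same e mG')).
  by apply: mero_eq => w wI; rewrite mulrA.
move=> _; split=> k0; apply: qmulf_neq0; rewrite ?G0 ?G'0//; apply: qexpf_neq0.
  by rewrite subr_eq0.
by rewrite subr_eq0 eq_sym.
Qed.

(** For a pole [s] other than [p] and its conjugate, one of the two linear factors
    of [quadp s] clears the pole, and neither vanishes at [p] or its conjugate. *)
Lemma horner_clear I Gp Gp' (T : seq H) : imag_units I -> cplane I p ->
  mero I (fun w => ordfactor w * f w) Gp p 0 ->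
  mero I (fun w => ordfactor w * f w) Gp' (qconj p) 0 ->
  (forall s : H, s \in T -> cplane I s /\ qball rho s) ->
  exists Q, [/\ horner_alg p Q != 0, horner_alg (qconj p) Q != 0 &
    forall s : H, s \in T -> exists G,
      mero I (fun w => horner_alg w Q * (ordfactor w * f w)) G s 0].
Proof.
move=> hI pI mp mp'; have pI' := cplane_conj hI pI.
have Qh Q w : cplane I w -> cplane I (horner_alg w Q) /\ holo I (fun w => horner_alg w Q) w.
  by move=> wI; split; [exact: horner_alg_plane|exact: horner_alg_holo].
elim: T => [|s T IH] hT; first by exists 1; rewrite !rmorph1 !oner_neq0.
have [sI sr] : cplane I s /\ qball rho s by apply: hT; rewrite mem_head.
have [|Q [Qp Qp' hQ]] := IH; first by move=> s' s'T; apply: hT; rewrite inE s'T orbT.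
have [sp|sp] := eqVneq s p.
  exists Q; split=> // s'; rewrite inE => /predU1P[->|]; last exact: hQ.
  by exists (fun w => horner_alg w Q * Gp w); rewrite sp; apply: mero_mull => // w; exact: Qh.
have [sp'|sp'] := eqVneq s (qconj p).
  exists Q; split=> // s'; rewrite inE => /predU1P[->|]; last exact: hQ.
  by exists (fun w => horner_alg w Q * Gp' w); rewrite sp'; apply: mero_mull => // w; exact: Qh.
have [G [N mG]] := mero_ball f_sr hI sI sr.
have cp : qconj s != p by apply/eqP => h; move: sp'; rewrite -h qconjK eqxx.
have cp' : qconj s != qconj p.
  by apply/eqP => /(congr1 (@qconj R)); rewrite !qconjK; exact/eqP.
exists (quadp s ^+ N * Q); split.
- rewrite rmorphM rmorphXn/= qmulf_neq0// qexpf_neq0// (horner_quadp hI)//.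
  by rewrite qmulf_neq0 ?subr_eq0// eq_sym.
- rewrite rmorphM rmorphXn/= qmulf_neq0// qexpf_neq0// (horner_quadp hI)//.
  by rewrite qmulf_neq0 ?subr_eq0// eq_sym.
move=> s'; rewrite inE => /predU1P[->|s'T]; last first.
  have [G' mG'] := hQ s' s'T; have [s'I _] : cplane I s' /\ qball rho s'.
    by apply: hT; rewrite inE s'T orbT.
  exists (fun w => horner_alg w (quadp s ^+ N) * G' w).
  have := mero_mull hI s'I (Qh (quadp s ^+ N)) mG'.
  by apply: mero_eq => w wI; rewrite rmorphM mulrA.
pose T1 w := horner_alg w Q * ordfactor w * (w - qconj s) ^+ N.
exists (fun w => T1 w * G w).
have oI w : cplane I w -> cplane I (ordfactor w) /\ holo I ordfactor w.
  move=> wI; have [h1 h2] := holo_plane_subX (ord f p) hI pI wI.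
  have [h3 h4] := holo_plane_subX (ord f (qconj p)) hI pI' wI.
  by split; [exact: cplaneM|exact: holoM].
have T1I w : cplane I w -> cplane I (T1 w) /\ holo I T1 w.
  move=> wI; have [h1 h2] := oI w wI; have [h3 h4] := Qh Q w wI.
  have [h5 h6] := holo_plane_subX N hI (cplane_conj hI sI) wI.
  split; first by apply: cplaneM => //; exact: cplaneM.
  by apply: holoM => //; [exact: cplaneM|exact: holoM].
have := mero_mull hI sI T1I (mero_absorb mG).
apply: mero_eq => w wI; have [h1 _] := oI w wI; have [h2 _] := Qh Q w wI.
have ws := cplaneB wI sI; have ws' := cplaneB wI (cplane_conj hI sI).
rewrite rmorphM rmorphXn/= (horner_quadp hI)// /T1 exprMn_comm; last exact: (cplane_comm ws ws').
have := cplaneX hI N ws'; have := cplaneX hI N ws; move: h1 h2.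
move: (ordfactor w) (horner_alg w Q) (_ ^+ N) (_ ^+ N) => o q a b oI' qI' aI bI.
rewrite !mulrA; congr (_ * _); rewrite -[RHS]mulrA.
by rewrite (cplane_comm (cplaneM hI aI bI) (cplaneM hI qI' oI')) (cplane_comm aI bI) !mulrA.
Qed.

(** Once the poles are cleared, the product is a power series on the disc; its
    values at [p] and [qconj p] are those of the local extensions of
    [ordfactor * f], multiplied by the nonzero values of [Q]. *)
Lemma ordfactor_quotient r : 0 < r -> (r%:E < rho)%E -> exists Q (d : nat -> H),
  [/\ horner_alg p Q != 0, horner_alg (qconj p) Q != 0,
      forall s, 0 < s < r -> gbound s d,
      exists2 e, 0 < e & forall x, 0 < `|x| < e -> dom f x%:A /\
        (Q.[x])%:A * (ordfactor x%:A * f x%:A) = psum d x%:A &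
      `|p| < r -> p != qconj p ->
        ((0 < m)%N -> psum d p != 0) /\ ((0 < n)%N -> psum d (qconj p) != 0)].
Proof.
move=> r0 rr; have [I [Gp [Gp' [hI pI mp mp' G0]]]] := ordfactor_extension.
have pI' := cplane_conj hI pI.
have [T [hT1 hT2]] := sing_finite f_sr hI r0 rr.
have [s sT|Q [Qp Qp' hQ]] := horner_clear (T := T) hI pI mp mp'.
  have [sI sr _] := hT1 s sT; split=> //; rewrite /qball /=.
  by apply: le_lt_trans rr; rewrite lee_fin.
have Qh w : cplane I w -> cplane I (horner_alg w Q) /\ holo I (fun w => horner_alg w Q) w.
  by move=> wI; split; [exact: horner_alg_plane|exact: horner_alg_holo].
pose u w := horner_alg w Q * (ordfactor w * f w).
have md z : cplane I z -> dom f z -> mero I u u z 0.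
  move=> zI fz.
  have h := mero_mull hI zI (fun w => holo_plane_subX (ord f (qconj p)) hI pI' (w := w))
    (mero_dom f_sr hI zI fz).
  have {}h := mero_mull hI zI (fun w => holo_plane_subX (ord f p) hI pI (w := w)) h.
  have {}h := mero_mull hI zI Qh h.
  have e : (fun w => horner_alg w Q *
    ((w - p) ^+ ord f p * ((w - qconj p) ^+ ord f (qconj p) * f w))) = u.
    by apply/funext => w; rewrite /u /ordfactor !mulrA.
  by rewrite e in h.
have [z zI zr|d hd ud] := mero_taylor hI r0 (u := u).
  have [zT|zT] := boolP (z \in T); first exact: hQ.
  by exists u; apply: md => //; apply: hT2 => //; exact: ltW.
exists Q, d; split=> //.
- have [|e e0 he] := sing_isolated f_sr hI (cplane0 I).
    by rewrite /qball /= normr0; apply: lt_trans rr; rewrite lte_fin.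
  exists (Order.min e r) => [|x]; first by rewrite lt_min e0.
  rewrite lt_min => /and3P[x0 xe xr]; have xI := cplane_real I x.
  have fx : dom f x%:A by apply: he => //; rewrite subr0 qnorm_real x0.
  split=> //; rewrite -horner_alg_real; apply: (ud x%:A u) => //; first by rewrite qnorm_real.
  exact: md.
- move=> pr pp; have [h1 h2] := G0 pp.
  have e1 := ud p _ pI pr (mero_mull hI pI Qh mp).
  have e2 : horner_alg (qconj p) Q * Gp' (qconj p) = psum d (qconj p).
    by apply: (ud _ _ pI' _ (mero_mull hI pI' Qh mp')); rewrite qnorm_conj.
  by split=> k0; [rewrite -e1 qmulf_neq0//; exact: h1|rewrite -e2 qmulf_neq0//; exact: h2].
Qed.

End Structure.

(** * Evaluating regular quotients at real points *)

Section RealPoints.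
Context {R : realType}.
Local Notation H := (quat R).
Implicit Types (x y s t e r : R) (z w c q p : H) (Q : {poly R}) (a b d : nat -> H).

(** The growth condition which characterizes convergence on the ball of
    radius [r]. *)
Definition gball r a := forall s, 0 < s < r -> gbound s a.

Lemma convergesP r a : converges r%:E a <-> gball r a.
Proof.
split=> [h s /andP[s0 sr]|h]; first exact: (converges_gbound h).
by apply: gbound_converges => s s0 sr; apply: h; rewrite s0.
Qed.

Lemma gball_finite r a N : (forall n, (N <= n)%N -> a n = 0) -> gball r a.
Proof. by move=> aN s _; exact: gbound_finite aN. Qed.

Lemma gball_star r a b : gball r a -> gball r b -> gball r (star a b).
Proof.
move=> ha hb s /andP[s0 sr].
have [s' [ss' sr']] : exists s', s < s' /\ s' < r by exists ((s + r) / 2); split; lra.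
have s'0 := lt_trans s0 ss'.
by apply: (gbound_star s0 ss'); [apply: ha|apply: hb]; rewrite s'0.
Qed.

Lemma gball_conjc r a : gball r a -> gball r (conjc a).
Proof. by move=> ha s sr; apply: gbound_conjc; exact: ha. Qed.

Lemma gball_sym r a : gball r a -> gball r (sym a).
Proof. by move=> ha; apply: gball_star => //; exact: gball_conjc. Qed.

Lemma between (u r : R) : 0 <= u -> u < r -> exists s, u < s /\ 0 < s < r.
Proof. by move=> u0 ur; exists ((u + r) / 2); split; [|apply/andP; split]; lra. Qed.

Lemma ball_star_comm r a b q : gball r a -> gball r b -> `|q| < r ->
  (forall k, a k * q = q * a k) -> psum (star a b) q = psum a q * psum b q.
Proof.
move=> ha hb qr; have [s [qs sr]] := between (normr_ge0 q) qr.
by apply: (psum_star_comm _ _ qs); [exact: ha|exact: hb].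
Qed.

Lemma ball_star_real r a b x : gball r a -> gball r b -> `|x| < r ->
  psum (star a b) x%:A = psum a x%:A * psum b x%:A.
Proof.
move=> ha hb xr; apply: (ball_star_comm ha hb); first by rewrite qnorm_real.
by move=> k; rewrite qscalarC.
Qed.

Lemma ball_conjc_real r a x : gball r a -> `|x| < r ->
  psum (conjc a) x%:A = qconj (psum a x%:A).
Proof.
move=> ha xr; have [s [xs sr]] := between (normr_ge0 x) xr.
by apply: (psum_conjc_real _ xs); exact: ha.
Qed.

Lemma ball_sym_real r a x : gball r a -> `|x| < r ->
  psum (sym a) x%:A = (qnormsq (psum a x%:A))%:A.
Proof.
move=> ha xr; rewrite (ball_star_real ha (gball_conjc ha) xr).
by rewrite (ball_conjc_real ha xr) qmul_conj.
Qed.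

Lemma ball_sym_eq0 r a x : gball r a -> `|x| < r ->
  (psum (sym a) x%:A == 0) = (psum a x%:A == 0).
Proof. by move=> ha xr; rewrite (ball_sym_real ha xr) qreal_eq0 qnormsq_eq0. Qed.

Lemma sym_conj_inv q : (qnormsq q)%:A^-1 * qconj q = q^-1.
Proof. by rewrite -qrealV -scalerAl mul1r. Qed.

(** At a real point the factors [conj a / |a|^2] combine to the inverse of the
    value of [a]. *)
Lemma lquot_real r a b x : gball r a -> gball r b -> `|x| < r ->
  (psum (sym a) x%:A)^-1 * psum (star (conjc a) b) x%:A =
  (psum a x%:A)^-1 * psum b x%:A.
Proof.
move=> ha hb xr; rewrite (ball_star_real (gball_conjc ha) hb xr) (ball_conjc_real ha xr).
by rewrite (ball_sym_real ha xr) mulrA sym_conj_inv.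
Qed.

Lemma lquot_mul_real r a b (c : nat -> H) d x : gball r a -> gball r b -> gball r c -> gball r d ->
  `|x| < r ->
  (psum (sym a) x%:A)^-1 * (psum (sym c) x%:A)^-1 *
    psum (star (star (star (conjc a) b) (conjc c)) d) x%:A =
  ((psum a x%:A)^-1 * psum b x%:A) * ((psum c x%:A)^-1 * psum d x%:A).
Proof.
move=> ha hb hc hd xr; have ha' := gball_conjc ha; have hc' := gball_conjc hc.
have hab := gball_star ha' hb.
rewrite (ball_star_real (gball_star hab hc') hd xr) (ball_star_real hab hc' xr).
rewrite (ball_star_real ha' hb xr) !(ball_conjc_real _ xr)//.
rewrite (ball_sym_real ha xr) (ball_sym_real hc xr).
move: (psum a _) (psum b _) (psum c _) (psum d _) => A B C D.
rewrite -(sym_conj_inv A) -(sym_conj_inv C) -!qrealV.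
move: (qconj A) (qconj C) (qnormsq A)^-1 (qnormsq C)^-1 => A' C' u v.
have e := qscalarC v (A' * B); rewrite mulrA in e.
by rewrite -!mulrA; congr (_ * _); rewrite !mulrA e.
Qed.

Lemma nonzero_small r a : 0 < r -> gball r a -> nonzero r%:E a ->
  exists2 e, 0 < e & forall x, 0 < `|x| < e -> psum a x%:A != 0.
Proof.
move=> r0 ha [q _ /eqP aq]; apply: contrapT => h; apply: aq; apply: psum0.
have r2 : 0 < r / 2 < r by rewrite divr_gt0//= ltr_pdivrMr// ltr_pMr// ltr1n.
apply: (psum_zero (proj1 (andP r2)) (ha _ r2)) => e e0.
apply: contrapT => h'; apply: h; exists e => // x xe; apply/eqP => ax.
by apply: h'; exists x%:A => //; rewrite qnorm_real.
Qed.

Lemma ball_holo I r a z : imag_units I -> cplane I z -> gball r a -> `|z| < r ->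
  holo I (psum a) z.
Proof.
move=> hI zI ha zr; have [s [zs sr]] := between (normr_ge0 z) zr.
have -> : psum a = fun w => psum a (w - 0) by apply/funext => w; rewrite subr0.
by apply: (psum_holo (cplane0 I) zI (ha _ sr)); rewrite subr0.
Qed.

Lemma ball_differentiable r a z : gball r a -> `|z| < r -> differentiable (psum a) z.
Proof.
move=> ha zr; have [s [zs sr]] := between (normr_ge0 z) zr.
exact: psum_differentiable (ha _ sr) zs.
Qed.

Lemma gball_star1 r : gball r (star1 : nat -> H).
Proof. by apply: (@gball_finite _ _ 1) => -[]. Qed.

Lemma gball_starpow r a k : gball r a -> gball r (starpow a k).
Proof.
by move=> ha; elim: k => [|k IH]; [exact: gball_star1|exact: gball_star].
Qed.

Lemma gball_lin r c : gball r (lin c).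
Proof. by apply: (@gball_finite _ _ 2) => -[|[]]. Qed.

Lemma gball_qcoef r Q : gball r (qcoef Q : nat -> H).
Proof. by move=> s _; exact: gbound_qcoef. Qed.

Lemma psum_star1 q : psum star1 q = 1.
Proof.
rewrite (psum_finite (N := 1)) => [|[]//].
by rewrite big_nat1 expr0 mul1r.
Qed.

Lemma psum_lin c q : psum (lin c) q = q - c.
Proof.
rewrite (psum_finite (N := 2)) => [|[|[]]//].
by rewrite !big_nat_recr//= big_geq// add0r expr0 mul1r mulr1 addrC.
Qed.

Lemma psum_starpow_lin c k x : psum (starpow (lin c) k) x%:A = (x%:A - c) ^+ k.
Proof.
have xr : `|x| < `|x| + 1 by rewrite ltrDl.
elim: k => [|k IH]; first by rewrite psum_star1 expr0.
rewrite /= (ball_star_real (gball_lin c) (gball_starpow k (gball_lin c)) xr).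
by rewrite psum_lin IH exprS.
Qed.

End RealPoints.

(** * Slice preserving factors *)

Section SlicePreserving.
Context {R : realType}.
Local Notation H := (quat R).
Implicit Types (x y s t e r : R) (z w c q p : H) (Q : {poly R}) (a b d : nat -> H).

(** The commutator of two vectors is twice their cross product, so that vectors
    which commute with [I] are multiples of [I]. *)
Lemma cplane_commP I q : imag_units I -> q * I = I * q -> cplane I q.
Proof.
move=> hI qI; have [I0 nI] := imag_unitP hI.
have [_ e1 e2 e3] : [/\ True, qj q * qk I = qk q * qj I, qi q * qk I = qk q * qi I
    & qi q * qj I = qj q * qi I].
  have := congr1 (@qi R) qI; have := congr1 (@qj R) qI; have := congr1 (@qk R) qI; rewrite /= I0.
  by move=> h1 h2 h3; split=> //; lra.
exists (qre q), (qi q * qi I + qj q * qj I + qk q * qk I).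
have [s1 s2 s3 s4] := slice_comp (qre q) (qi q * qi I + qj q * qj I + qk q * qk I) hI.
apply: quatP; rewrite s1 s2 s3 s4; move: nI; rewrite /qnormsq I0 expr0n /= add0r => nI.
split=> //.
- rewrite -[LHS]mulr1 -nI !mulrDr !mulrDl; congr (_ + _ + _).
  + by rewrite expr2 mulrA.
  + by rewrite expr2 mulrA e3; ring.
  + by rewrite expr2 mulrA e2; ring.
- rewrite -[LHS]mulr1 -nI !mulrDr !mulrDl; congr (_ + _ + _).
  + by rewrite expr2 mulrA -e3; ring.
  + by rewrite expr2 mulrA.
  + by rewrite expr2 mulrA e1; ring.
- rewrite -[LHS]mulr1 -nI !mulrDr !mulrDl; congr (_ + _ + _).
  + by rewrite expr2 mulrA -e2; ring.
  + by rewrite expr2 mulrA -e1; ring.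
  + by rewrite expr2 mulrA.
Qed.

(** The partial sums commute with [I], and so does their limit. *)
Lemma psum_real_plane I r a z : imag_units I -> cplane I z -> gball r a -> `|z| < r ->
  (forall n, a n = (qre (a n))%:A) -> cplane I (psum a z).
Proof.
move=> hI zI ha zr areal; have [s [zs sr]] := between (normr_ge0 z) zr.
have h := psum_cvg (ha _ sr) zs; apply: cplane_commP => //.
have hr : (fun n => series (pterm a z) n * I) @ \oo --> psum a z * I by exact: cvg_qmulr.
apply: (qcvg_unique hr).
rewrite [X in X @ _ --> _](_ : _ = fun n => I * series (pterm a z) n); first exact: cvg_qmull.
apply/funext => n; rewrite /series /= mulr_suml mulr_sumr; apply: eq_bigr => k _.
apply: (@cplane_comm _ I); last exact: cplane_unit.
by apply: cplaneM => //; [exact: cplaneX|rewrite areal; exact: cplane_real].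
Qed.

Lemma psum_drop s b q N : gbound s b -> `|q| < s -> (forall k, (k < N)%N -> b k = 0) ->
  psum b q = q ^+ N * psum (fun k => b (N + k)%N) q /\ gbound s (fun k => b (N + k)%N).
Proof.
move=> hb qs; have s0 : 0 < s by exact: le_lt_trans qs.
elim: N => [|N IH] bN; first by rewrite expr0 mul1r.
have [|-> hN] := IH; first by move=> k kN; apply: bN; exact: ltnW.
have e : shiftc (fun k => b (N + k)%N) = fun k => b (N.+1 + k)%N.
  by apply/funext => k; rewrite /shiftc addnS.
rewrite (psum_shift hN qs) addn0 bN// add0r e exprSr mulrA; split=> //.
by rewrite -e; exact: gbound_shift.
Qed.

(** If [N] is the order of the zero of [T] at [z], then [T w] is [(w - z)^N] times
    a power series which does not vanish near [z]; the values of this series lie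
    in the plane, so that its inverse is holomorphic. *)
Lemma mero_inv I (T : H -> H) z r : imag_units I -> cplane I z -> 0 < r ->
  (forall w, cplane I w -> `|w - z| < r -> cplane I (T w) /\ holo I T w) ->
  (forall w, cplane I w -> 0 < `|w - z| < r -> T w != 0) ->
  exists N V e, [/\ 0 < e,
    forall w, cplane I w -> `|w - z| < e -> cplane I (V w) /\ holo I V w &
    forall w, cplane I w -> 0 < `|w - z| < e -> (w - z) ^+ N * (T w)^-1 = V w].
Proof.
move=> hI zI r0 hT T0.
have [w wI wr|b hb Tb] := holo_taylor hI zI r0 (u := T); first by have [] := hT w wI wr.
have r2 : 0 < r / 2 < r by rewrite divr_gt0//= ltr_pdivrMr// ltr_pMr// ltr1n.
have [r20 r2r] := andP r2.
have ex : exists n, b n != 0.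
  apply: contrapT => h.
  have tI : cplane I (z + (r / 2)%:A) by apply: cplaneD => //; exact: cplane_real.
  have nt : `|z + (r / 2)%:A - z| = r / 2 by rewrite addrC addKr qnorm_real gtr0_norm.
  have := T0 _ tI; rewrite nt => /(_ r2)/eqP; apply; rewrite Tb ?nt//.
  by apply: psum0 => n; apply/eqP; apply: contrapT => /negP bn; apply: h; exists n.
case: (ex_minnP ex) => N bN Nmin.
have bk k : (k < N)%N -> b k = 0.
  by move=> kN; apply/eqP; rewrite -[_ == _]negbK; apply/negP => /Nmin; rewrite leqNgt kN.
pose U w := psum (fun k => b (N + k)%N) (w - z).
have gN : gbound (r / 2) (fun k => b (N + k)%N).
  by apply: (proj2 (psum_drop (q := 0) (hb _ r2) _ bk)); rewrite normr0.
have TU w : cplane I w -> `|w - z| < r / 2 -> T w = (w - z) ^+ N * U w.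
  move=> wI wr; rewrite Tb ?(lt_trans wr)//.
  by have [] := psum_drop (hb _ r2) wr bk.
have hU w : cplane I w -> `|w - z| < r / 2 -> holo I U w.
  by move=> wI wr; exact: (psum_holo zI wI gN wr).
have Upun w : cplane I w -> 0 < `|w - z| < r / 2 -> cplane I (U w) /\ U w != 0.
  move=> wI /andP[w0 wr]; have wz : w - z != 0 by rewrite -normr_gt0.
  have wzN := qexpf_neq0 N wz; have wzI := cplaneX hI N (cplaneB wI zI).
  have -> : U w = ((w - z) ^+ N)^-1 * T w by rewrite TU// mulrA qmulVf// mul1r.
  have wr' := lt_trans wr r2r.
  split; last by rewrite qmulf_neq0 ?qinv_neq0// T0// w0.
  by apply: cplaneM => //; [exact: cplaneV|exact: (proj1 (hT w wI wr'))].
have Uz : U z = b N.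
  by rewrite /U subrr (psum_shift gN) ?normr0// mul0r addr0 addn0.
(* At the center, where the quotient is undefined, by the identity principle. *)
have UI w : cplane I w -> `|w - z| < r / 2 -> cplane I (U w).
  move=> wI wr; apply: cplane_commP => //; apply/eqP; rewrite -subr_eq0; apply/eqP.
  apply: (holo_zero_disc hI (u := fun w => U w * I - I * U w) zI r20) => //.
  - move=> v vI vr; apply: holoB; first by apply: holoMr; exact: hU.
    by apply: holoM => //; [exact: cplane_unit|exact: holo_cst|exact: hU].
  - move=> e e0.
    have [t [t0 te tr]] : exists t : R, [/\ 0 < t, t < e & t < r / 2].
      by exists (Order.min e (r / 2) / 2); rewrite /Order.min; case: ifP => h; split; lra.
    have nt : `|z + t%:A - z| = t by rewrite addrC addKr qnorm_real gtr0_norm.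
    have tI : cplane I (z + t%:A) by apply: cplaneD => //; exact: cplane_real.
    exists (z + t%:A); rewrite nt t0; split=> //; apply/eqP; rewrite subr_eq0; apply/eqP.
    by apply: (@cplane_comm _ I); [apply: (proj1 (Upun _ _ _)) => //; rewrite nt t0|exact: cplane_unit].
have U0 w : cplane I w -> `|w - z| < r / 2 -> U w != 0.
  have [->|wz] := eqVneq w z; first by rewrite Uz.
  by move=> wI wr; apply: (proj2 (Upun w wI _)); rewrite normr_gt0 subr_eq0 wz.
exists N, (fun w => (U w)^-1), (r / 2); split=> // w wI wr.
  split; first by apply: cplaneV => //; exact: UI.
  apply: holoV => //; [|exact: U0|exact: hU].
  apply/near_plane; exists (r / 2 - `|w - z|) => [|v vI vw]; first by rewrite subr_gt0.
  apply: UI => //; rewrite -(subrK w v) -addrA.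
  by apply: le_lt_trans (ler_normD _ _) _; rewrite -ltrBrDr.
have [w0 wr'] := andP wr; have Tw0 : T w != 0 by apply: T0; rewrite ?w0 ?(lt_trans wr').
have Uw0 := U0 w wI wr'.
rewrite -[LHS]mul1r -(qmulVf Uw0) -mulrA -[RHS]mulr1; congr (_ * _).
have wzI := cplaneX hI N (cplaneB wI zI).
by rewrite mulrA (cplane_comm (UI w wI wr') wzI) -TU// qmulfV.
Qed.

(** Differentiability at [z] depends on the values near [z] only; the components
    of the increment bound the differential. *)
Lemma differentiable_local (F G : H -> H) z (d : R) : 0 < d ->
  (forall w, `|w - z| < d -> F w = G w) -> differentiable G z -> differentiable F z.
Proof.
move=> d0 FG hG; pose L : H -> H := 'd G z.
have Lin x (k k' : H) : L (x *: k + k') = x *: L k + L k' by rewrite /L linearP.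
have LZ x (k : H) : L (x *: k) = x *: L k by rewrite /L linearZ.
have LD (k k' : H) : L (k + k') = L k + L k' by rewrite /L linearD.
apply: (differentiable_intro (L := L)
  (C := `|L 1| + `|L (qI : H)| + `|L (qJ : H)| + `|L (qK : H)|) Lin).
- move=> k; rewrite {1}(quat_basis k) !LD !LZ !mulrDl.
  have Zle x (v : H) : `|x| <= `|k| -> `|x *: v| <= `|v| * `|k|.
    by move=> xk; rewrite normrZ mulrC ler_wpM2l.
  apply: le_trans (ler_normD _ _) _; apply: lerD; last by apply: Zle; exact: qk_le.
  apply: le_trans (ler_normD _ _) _; apply: lerD; last by apply: Zle; exact: qj_le.
  apply: le_trans (ler_normD _ _) _; apply: lerD; last by apply: Zle; exact: qi_le.
  by apply: Zle; exact: qre_le.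
- move=> e e0; have [d' d'0 hd'] := differentiable_expansion hG e0.
  exists (Order.min d d') => [|k]; first by rewrite lt_min d0.
  rewrite lt_min => /andP[kd kd']; rewrite FG; last by rewrite addrC addKr.
  by rewrite FG ?hd'// subrr normr0.
Qed.

End SlicePreserving.

(** * The quotient of the pole factor *)

Section Quotient.
Context {R : realType}.
Local Notation H := (quat R).
Implicit Types (x y s t e r : R) (z w q : H) (Q : {poly R}) (d : nat -> H).
Variables (rho : \bar R) (f : qfun R) (p : H).
Hypothesis rho_gt0 : (0%:E < rho)%E.
Hypothesis f_sr : semiregular (qball rho) f.
Hypothesis p_in : qball rho p.

Lemma qball_ex q : qball rho q -> exists r, [/\ 0 < r, (r%:E < rho)%E & `|q| < r].
Proof.
by move=> /qball_lt[r qr rr]; exists r; split=> //; exact: le_lt_trans qr.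
Qed.

Lemma sub_qball r q : (r%:E < rho)%E -> `|q| < r -> qball rho q.
Proof. by move=> rr qr; rewrite /qball /=; apply: lt_trans rr; rewrite lte_fin. Qed.

(** The zeros [p] and [qconj p] are equally far from the origin. *)
Lemma ordfactor_small : exists2 e : R, 0 < e &
  forall x, 0 < `|x| < e -> ordfactor f p x%:A != 0.
Proof.
exists (if p == 0 then 1 else `|p|) => [|x].
  by case: eqVneq => // p0; rewrite normr_gt0.
move=> /andP[x0 xp].
have sub0 (c : H) : `|c| = `|p| -> x%:A - c != 0.
  move=> cp; rewrite subr_eq0; apply/eqP => xc; move: xp x0.
  rewrite -(qnorm_real x) xc cp; case: eqVneq => [->|_]; first by rewrite normr0 ltxx.
  by rewrite ltxx.
by rewrite qmulf_neq0 ?qexpf_neq0 ?sub0 ?qnorm_conj.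
Qed.

(** [psum d] is the product of [Q], the pole factor and [f]. The identity is
    stated at small real points only, where products are pointwise; they determine
    a power series. *)
Definition clearing r Q d := [/\ 0 < r, (r%:E < rho)%E, Q != 0, gball r d &
  exists2 e, 0 < e & forall x, 0 < `|x| < e -> dom f x%:A /\
    (Q.[x])%:A * (ordfactor f p x%:A * f x%:A) = psum d x%:A].

Lemma clearing_exists r : 0 < r -> (r%:E < rho)%E -> exists Q d,
  [/\ clearing r Q d, horner_alg p Q != 0, horner_alg (qconj p) Q != 0 &
      `|p| < r -> p != qconj p -> ((0 < ord f p)%N -> psum d p != 0) /\
        ((0 < ord f (qconj p))%N -> psum d (qconj p) != 0)].
Proof.
move=> r0 rr; have [Q [d [Qp Qp' hd hx dp]]] := ordfactor_quotient f_sr p_in r0 rr.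
exists Q, d; split=> //; split=> //.
by apply/eqP => Q0; move: Qp; rewrite Q0 rmorph0 eqxx.
Qed.

(** Both sides are equal at small real points, where the values of [Q] and [Q']
    are real numbers, and the left factors preserve the slices. *)
Lemma clearing_same r Q d r' Q' d' q : clearing r Q d -> clearing r' Q' d' ->
  `|q| < r -> `|q| < r' ->
  horner_alg q Q' * psum d q = horner_alg q Q * psum d' q.
Proof.
move=> [r0 rr Q0 hd [e e0 he]] [r'0 rr' Q'0 hd' [e' e'0 he']] qr qr'.
have [I hI qI] := cplane_exists q.
apply/eqP; rewrite -subr_eq0; apply/eqP.
pose t := Order.min r r'; have t0 : 0 < t by rewrite lt_min r0.
apply: (holo_zero_disc hI
  (u := fun w => horner_alg w Q' * psum d w - horner_alg w Q * psum d' w)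
  (cplane0 I) t0) => //; last by rewrite subr0 lt_min qr.
- move=> z zI; rewrite subr0 lt_min => /andP[zr zr'].
  apply: holoB; (apply: holoM => //; [exact: horner_alg_plane|exact: horner_alg_holo|]).
    exact: (ball_holo hI zI hd zr).
  exact: (ball_holo hI zI hd' zr').
- move=> e1 e10.
  have [x [x0 xe1 xe xe']] : exists x, [/\ 0 < x, x < e1, x < e & x < e'].
    have m0 : 0 < Order.min e1 (Order.min e e') by rewrite !lt_min e10 e0.
    exists (Order.min e1 (Order.min e e') / 2); rewrite divr_gt0//.
    have : Order.min e1 (Order.min e e') / 2 < Order.min e1 (Order.min e e').
      by rewrite ltr_pdivrMr// ltr_pMr// ltr1n.
    by rewrite [X in _ < X -> _]/Order.min !lt_min => /and3P[].
  have nx : `|x| = x by rewrite gtr0_norm.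
  exists x%:A; rewrite subr0 qnorm_real nx x0; split=> //; first exact: cplane_real.
  have [|_ <-] := he x; first by rewrite nx x0.
  have [|_ <-] := he' x; first by rewrite nx x0.
  by rewrite !horner_alg_real !mulrA -!qrealM [Q.[x] * _]mulrC subrr.
Qed.

Definition quot_dom : set H := [set q : H | exists r Q d,
  [/\ clearing r Q d, `|q| < r & horner_alg q Q != 0]].

(** The values obtained from different [r], [Q] and [d] coincide by
    [clearing_same]; [xget] picks one of them. *)
Definition quot_val q : H := xget 0 [set v | exists r Q d,
  [/\ clearing r Q d, `|q| < r, horner_alg q Q != 0 &
      v = (horner_alg q Q)^-1 * psum d q]].

Definition quot : qfun R := QFun quot_dom quot_val.

Lemma quotE r Q d q : clearing r Q d -> `|q| < r -> horner_alg q Q != 0 ->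
  quot q = (horner_alg q Q)^-1 * psum d q.
Proof.
move=> c qr Qq; rewrite /quot /= /quot_val.
case: xgetP => [v _ [r' [Q' [d' [c' qr' Q'q ->]]]]|/(_ ((horner_alg q Q)^-1 * psum d q))].
  have e := clearing_same c c' qr qr'; have [I hI qI] := cplane_exists q.
  have AI := horner_alg_plane Q hI qI; have BI := horner_alg_plane Q' hI qI.
  rewrite -[RHS]mul1r -(qmulVf Q'q) -[RHS]mulrA; congr (_ * _).
  by rewrite mulrA (cplane_comm BI (cplaneV hI AI)) -mulrA e mulrA qmulVf// mul1r.
by case; exists r, Q, d.
Qed.

Lemma quot_dom_open_at q r Q d : clearing r Q d -> `|q| < r -> horner_alg q Q != 0 ->
  exists2 e : R, 0 < e & forall w, `|w - q| < e -> `|w| < r /\ horner_alg w Q != 0.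
Proof.
move=> c qr Qq.
have hc : differentiable (fun w : H => horner_alg w Q) q.
  rewrite (_ : (fun w => _) = psum (qcoef Q)); last by apply/funext => w; rewrite psum_qcoef.
  exact: ball_differentiable (gball_qcoef Q (r := r)) qr.
have : \forall w \near q, horner_alg w Q != 0.
  exact: cvgr_neq0 (differentiable_continuous hc) Qq.
move=> /nbhs_ballP[e /= e0 he].
exists (Order.min e (r - `|q|)) => [|w]; first by rewrite lt_min e0 subr_gt0.
rewrite lt_min ltrBrDr => /andP[we wr]; split.
  by rewrite -(subrK q w); apply: le_lt_trans (ler_normD _ _) wr.
by apply: he; rewrite -ball_normE /= distrC.
Qed.

Lemma quot_regular : regular (dom quot) quot.
Proof.
apply: regular_intro.
- rewrite openE => q [r [Q [d [c qr Qq]]]].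
  have [e e0 he] := quot_dom_open_at c qr Qq.
  apply/nbhs_ballP; exists e => //= w; rewrite -ball_normE /= distrC => /he[wr Qw].
  by exists r, Q, d.
- move=> q [r [Q [d [c qr Qq]]]]; have [_ _ _ hd _] := c.
  have [e e0 he] := quot_dom_open_at c qr Qq.
  apply: (differentiable_local (G := fun w => (horner_alg w Q)^-1 * psum d w) e0).
    by move=> w /he[wr Qw]; exact: (quotE c).
  apply: qmul_differentiable; last exact: ball_differentiable hd qr.
  apply: (differentiable_comp (f := fun w : H => horner_alg w Q) (g := fun w : H => w^-1)).
    rewrite (_ : (fun w => _) = psum (qcoef Q)); last by apply/funext => w; rewrite psum_qcoef.
    exact: ball_differentiable (gball_qcoef Q (r := r)) qr.
  exact: qinv_differentiable.
- move=> I z hI [r [Q [d [c zr Qz]]]] zI; have [_ _ _ hd _] := c.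
  have [e e0 he] := quot_dom_open_at c zr Qz.
  apply: (holo_near (F := fun w => (horner_alg w Q)^-1 * psum d w) zI).
    apply/near_plane; exists e => // w wI /he[wr Qw]; exact/esym/(quotE c).
  apply: holoM => //; first by apply: cplaneV => //; exact: horner_alg_plane.
    apply: holoV => //; last exact: horner_alg_holo.
    apply/near_plane; exists 1 => // w wI _; exact: horner_alg_plane.
  exact: ball_holo hd zr.
Qed.

(** In each slice the singularities are zeros of [Q], which are isolated and at
    which [Q^-1] has poles. *)
Lemma quot_mero I z : imag_units I -> cplane I z -> qball rho z ->
  (exists2 e : R, 0 < e & forall w, cplane I w -> 0 < `|w - z| < e -> dom quot w) /\
  exists G N, mero I quot G z N.
Proof.
move=> hI zI /qball_ex[r [r0 rr zr]]; have [Q [d [c _ _ _]]] := clearing_exists r0 rr.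
have [_ _ Q0 hd _] := c; have [e1 e10 hQ] := horner_alg_zeros hI zI Q0.
pose e := Order.min e1 (r - `|z|).
have e0 : 0 < e by rewrite lt_min e10 subr_gt0.
have we w : `|w - z| < e -> `|w - z| < e1 /\ `|w| < r.
  rewrite lt_min ltrBrDr => /andP[h wr]; split=> //.
  by rewrite -(subrK z w); apply: le_lt_trans (ler_normD _ _) wr.
have Qw w : cplane I w -> 0 < `|w - z| < e -> horner_alg w Q != 0.
  by move=> wI /andP[w0 /we[wz wr]]; apply: hQ; rewrite ?w0.
split.
  exists e => // w wI wz; have [w0 wz'] := andP wz; have [wz1 wr] := we w wz'.
  by exists r, Q, d; split=> //; exact: Qw.
have [|N [V [e2 [e20 hV VE]]]] := mero_inv hI zI e0 (T := fun w => horner_alg w Q) _ Qw.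
  by move=> w wI _; split; [exact: horner_alg_plane|exact: horner_alg_holo].
exists (fun w => V w * psum d w), N, (Order.min e e2); first by rewrite lt_min e0.
split=> w wI; rewrite lt_min.
  move=> /andP[/we[wz wr] wz2]; have [VI hVw] := hV w wI wz2.
  by apply: holoM => //; exact: ball_holo hd wr.
move=> /and3P[w0 wz wz2]; have [wz1 wr] := we w wz.
rewrite (quotE c wr) ?Qw ?w0// mulrA VE ?w0//.
Qed.

Lemma quot_semiregular : semiregular (qball rho) quot.
Proof.
split; [|exact: quot_regular| |].
- by move=> q [r [Q [d [[_ rr _ _ _] qr _]]]]; exact: sub_qball qr.
- move=> I hI /= z Sz; have [[zr nz] zI] := Sz; split; first by rewrite in_setE.
  have [[e e0 he] _] := quot_mero hI zI zr.
  exists (ball z e); first exact: nbhsx_ballx.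
  apply/seteqP; split=> w /=.
    move=> [wz [[wr nw] wI]]; apply: contrapT => /eqP wnz; apply: nw; apply: he => //.
    by rewrite normr_gt0 subr_eq0 wnz/=; move: wz; rewrite -ball_normE /= distrC.
  by move=> ->; split=> //; exact: ballxx.
- move=> z [zr nz]; have [I hI zI] := cplane_exists z.
  have [hd [G [N m]]] := quot_mero hI zI zr.
  have [a la van] := mero_laurent hI zI m hd.
  by exists I, a; split=> //; exists N.
Qed.

Definition ordcoef : nat -> H :=
  star (starpow (lin p) (ord f p)) (starpow (lin (qconj p)) (ord f (qconj p))).

Lemma gball_ordcoef r : gball r ordcoef.
Proof. by apply: gball_star; apply: gball_starpow; exact: gball_lin. Qed.

Lemma psum_ordcoef x : psum ordcoef x%:A = ordfactor f p x%:A.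
Proof.
have xr : `|x| < `|x| + 1 by rewrite ltrDl.
rewrite (ball_star_real _ _ xr) ?psum_starpow_lin//; apply: gball_starpow; exact: gball_lin.
Qed.

Lemma nonzero_at r a x : `|x| < r -> psum a x%:A != 0 -> nonzero r%:E a.
Proof. by move=> xr ax; exists x%:A; rewrite // /qball /= lte_fin qnorm_real. Qed.

Lemma qcoef_comm Q k q : qcoef Q k * q = q * qcoef Q k.
Proof. exact: qscalarC. Qed.

Lemma conjc_qcoef Q : conjc (qcoef Q) = qcoef Q :> (nat -> H).
Proof. by apply/funext => k; rewrite /conjc qconj_real. Qed.

(** The coefficients are real: conjugation fixes them, and the regular product is
    the pointwise product at every point. *)
Lemma psum_sym_qcoef Q r q : `|q| < r ->
  psum (sym (qcoef Q)) q = horner_alg q Q * horner_alg q Q.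
Proof.
move=> qr; rewrite /sym conjc_qcoef (ball_star_comm (gball_qcoef Q) (gball_qcoef Q) qr).
  by rewrite psum_qcoef.
by move=> k; exact: qcoef_comm.
Qed.

Lemma quot_lquot r Q d : clearing r Q d -> qfun_eq quot (lquot r%:E (qcoef Q) d).
Proof.
move=> c q _ [qr /=]; have [_ _ _ hd _] := c; rewrite /qball /= lte_fin in qr.
rewrite (psum_sym_qcoef Q qr) qmulf_eq0 orbb => Qq; rewrite -[LHS]/(quot q) (quotE c qr Qq).
rewrite conjc_qcoef (ball_star_comm (gball_qcoef Q) hd qr) => [|k]; last exact: qcoef_comm.
by rewrite psum_qcoef invrM ?qunitE// !mulrA -[_ * _ * horner_alg _ _]mulrA qmulVf ?mulr1.
Qed.

(** Both sides are compared after multiplication by the slice preserving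
    denominators, so that the identity principle applies in each slice. *)
Lemma f_lquot_mul r Q d : clearing r Q d ->
  qfun_eq f (lquot_mul r%:E ordcoef star1 (qcoef Q) d).
Proof.
move=> c q fq [qr /= Pq Qq]; have [r0 rr Q0 hd [e e0 he]] := c.
rewrite /qball /= lte_fin in qr.
pose E := star (star (star (conjc ordcoef) star1) (conjc (qcoef Q))) d.
have hE : gball r E.
  apply: gball_star => //; apply: gball_star; last exact/gball_conjc/gball_qcoef.
  apply: gball_star; last exact: gball_star1.
  exact/gball_conjc/gball_ordcoef.
(* The common denominator has real coefficients and preserves the slices. *)
pose T w := psum (sym (qcoef Q)) w * psum (sym ordcoef) w.
have [I hI qI] := cplane_exists q.
have hsP := gball_sym (@gball_ordcoef r); have hsQ := gball_sym (gball_qcoef Q (r := r)).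
have TI w : cplane I w -> `|w| < r -> [/\ cplane I (T w), cplane I (psum (sym (qcoef Q)) w) & holo I T w].
  move=> wI wr; have h1 := psum_real_plane hI wI hsQ wr (sym_real _).
  have h2 := psum_real_plane hI wI hsP wr (sym_real _).
  split=> //; first exact: cplaneM.
  by apply: holoM => //; exact: ball_holo wr.
have [e1 e10 hP] := ordfactor_small; have [e2 e20 hQ] := horner_small Q0.
pose e' := Order.min (Order.min e r) (Order.min e1 e2).
have e'0 : 0 < e' by rewrite !lt_min e0 r0 e10.
have : T q * f q - psum E q = 0.
  apply: (identity_semireg f_sr (u := fun w => T w * f w - psum E w) hI r0 rr e'0) => //.
    move=> w wI wr fw; have [T1 _ T2] := TI w wI wr; apply: holoB; last exact: ball_holo wr.
    by apply: holoM => //; exact: dom_holo f_sr _ _ _ _ _.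
  move=> x; rewrite !lt_min => /andP[x0 /andP[/andP[xe xr] /andP[xe1 xe2]]].
  have [|fx dE] := he x; first by rewrite x0.
  have Px : psum ordcoef x%:A != 0 by rewrite psum_ordcoef hP// x0.
  have Qx : psum (qcoef Q) (x%:A : H) != 0.
    by rewrite psum_qcoef horner_alg_real qreal_eq0 hQ// x0.
  have := lquot_mul_real (@gball_ordcoef r) (gball_star1 (r := r)) (gball_qcoef Q) hd xr.
  rewrite psum_star1 mulr1 -dE psum_qcoef horner_alg_real psum_ordcoef.
  rewrite [X in _ = _ * X]mulrA qmulVf ?mul1r; last by rewrite qreal_eq0 hQ// x0.
  rewrite mulrA qmulVf ?mul1r; last by rewrite hP// x0.
  move=> <-; rewrite /T.
  have sQ : psum (sym (qcoef Q)) (x%:A : H) != 0 by rewrite (ball_sym_eq0 (gball_qcoef Q) xr).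
  have sP : psum (sym ordcoef) x%:A != 0 by rewrite (ball_sym_eq0 (@gball_ordcoef r) xr).
  rewrite -/E; move: sQ sP (psum E _).
  move: (psum (sym (qcoef Q)) _) (psum (sym ordcoef) _) => X Y X0 Y0 Z.
  by rewrite !mulrA -(mulrA X Y) qmulfV// mulr1 qmulfV// mul1r subrr.
move=> /eqP; rewrite subr_eq0 => /eqP h.
move: h; rewrite /= -/E /T; move: Pq Qq (psum E q).
move: (psum (sym (qcoef Q)) q) (psum (sym ordcoef) q) => X Y Y0 X0 _ <-.
by rewrite !mulrA -(mulrA Y^-1) qmulVf// mulr1 qmulVf// mul1r.
Qed.

Lemma small_point (e e' : R) : 0 < e -> 0 < e' -> exists x, 0 < `|x| < e /\ 0 < `|x| < e'.
Proof.
move=> e0 e'0; exists (Order.min e e' / 2).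
have m0 : 0 < Order.min e e' by rewrite lt_min e0.
rewrite gtr0_norm ?divr_gt0//.
have : Order.min e e' / 2 < Order.min e e' by rewrite ltr_pdivrMr// ltr_pMr// ltr1n.
by rewrite lt_min => /andP[-> ->].
Qed.

Lemma quot_star_prod : is_star_prod rho (lquot rho ordcoef star1) quot f.
Proof.
split=> // r r0 rr; have [Q [d [c _ _ _]]] := clearing_exists r0 rr.
have [_ _ Q0 hd _] := c; exists ordcoef, star1, (qcoef Q), d; split.
- by split; apply/convergesP => //;
    [exact: gball_ordcoef|exact: gball_star1|exact: gball_qcoef].
- have [e1 e10 hP] := ordfactor_small; have [e2 e20 hQ] := horner_small Q0.
  have [x [x1 xr]] := small_point e10 r0; have [y [y2 yr]] := small_point e20 r0.
  split.
    by apply: (nonzero_at (x := x)); [case/andP: xr|rewrite psum_ordcoef; exact: hP].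
  apply: (nonzero_at (x := y)); first by case/andP: yr.
  by rewrite psum_qcoef horner_alg_real qreal_eq0; exact: hQ.
- by [].
- exact: quot_lquot.
- exact: f_lquot_mul.
Qed.

(** At small real points the equation is an equation between values in a skew
    field, which has only one solution. *)
Lemma quot_unique (g : qfun R) : semiregular (qball rho) g ->
  is_star_prod rho (lquot rho ordcoef star1) g f -> qfun_eq g quot.
Proof.
move=> g_sr [_ hg] q gq [r [Q [d [c qr Qq]]]].
have [r0 rr Q0 hd [e e0 he]] := c.
have [a [b [a' [b' [[ca cb ca' cb'] [na na'] E1 E2 E3]]]]] := hg r r0 rr.
move/convergesP in ca; move/convergesP in cb.
move/convergesP in ca'; move/convergesP in cb'.
have [e1 e10 ha0] := nonzero_small r0 ca na.
have [e2 e20 ha'0] := nonzero_small r0 ca' na'.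
have [e3 e30 hP] := ordfactor_small.
have [I hI qI] := cplane_exists q.
have [|e4 e40 hg4] := sing_isolated g_sr hI (cplane0 I); first by rewrite /qball /= normr0.
pose e' := Order.min (Order.min e r) (Order.min (Order.min e1 e2) (Order.min e3 e4)).
have e'0 : 0 < e' by rewrite !lt_min e0 r0 e10 e20 e30.
have : horner_alg q Q * g q - psum d q = 0.
  apply: (identity_semireg g_sr (u := fun w => horner_alg w Q * g w - psum d w) hI r0 rr e'0) => //.
    move=> w wI wr gw; apply: holoB; last exact: (ball_holo hI wI hd wr).
    apply: holoM => //; [exact: horner_alg_plane|exact: horner_alg_holo|].
    exact: (dom_holo g_sr).
  move=> x; rewrite !lt_min.
  move=> /andP[x0 /andP[/andP[xe xr] /andP[/andP[xe1 xe2] /andP[xe3 xe4]]]].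
  have [|fx <-] := he x; first by rewrite x0.
  have xI := cplane_real I x; have nx := qnorm_real x.
  have gx : dom g x%:A by apply: hg4 => //; rewrite subr0 nx x0.
  have xB : qball r%:E (x%:A : H) by rewrite /qball /= lte_fin nx.
  have Px : ordfactor f p x%:A != 0 by apply: hP; rewrite x0.
  have hoP := @gball_ordcoef r.
  have sP : psum (sym ordcoef) x%:A != 0 by rewrite (ball_sym_eq0 hoP xr) psum_ordcoef.
  have sa : psum (sym a) x%:A != 0 by rewrite (ball_sym_eq0 ca xr) ha0// x0.
  have sa' : psum (sym a') x%:A != 0 by rewrite (ball_sym_eq0 ca' xr) ha'0// x0.
  (* At [x] the three hypotheses read [P^-1 = a^-1 b], [g = a'^-1 b'] and
     [f = (a^-1 b) (a'^-1 b')]. *)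
  have := E1 x%:A; rewrite /= => /(_ (conj (sub_qball rr _) sP) (conj xB sa)).
  rewrite nx => /(_ xr); rewrite (lquot_real hoP (gball_star1 (r := r)) xr).
  rewrite (lquot_real ca cb xr) psum_star1 mulr1 psum_ordcoef => P1.
  have := E2 x%:A gx (conj xB sa'); rewrite /= (lquot_real ca' cb' xr) => g1.
  have := E3 x%:A fx; rewrite /= => /(_ (And3 xB sa sa')).
  rewrite (lquot_mul_real ca cb ca' cb' xr) -P1 -g1 => ->.
  by rewrite horner_alg_real (mulrA (ordfactor _ _ _)) qmulfV// mul1r subrr.
move=> /eqP; rewrite subr_eq0 => /eqP h.
by rewrite (quotE c qr Qq) -h mulrA qmulVf// mul1r.
Qed.

(** The polynomial [Q] vanishes neither at [p] nor at its conjugate, which are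
    therefore points of regularity of the quotient. *)
Lemma quot_at_pole : [/\ dom quot p, dom quot (qconj p) & p != qconj p ->
  ((0 < ord f p)%N -> quot p != 0) /\ ((0 < ord f (qconj p))%N -> quot (qconj p) != 0)].
Proof.
have [r [r0 rr pr]] := qball_ex p_in.
have [Q [d [c Qp Qp' dp]]] := clearing_exists r0 rr.
have pr' : `|qconj p| < r by rewrite qnorm_conj.
split; [by exists r, Q, d|by exists r, Q, d|move=> pp].
have [h1 h2] := dp pr pp; rewrite (quotE c pr Qp) (quotE c pr' Qp').
by split=> k0; apply: qmulf_neq0; [exact: qinv_neq0|exact: h1|exact: qinv_neq0|exact: h2].
Qed.

End Quotient.

Theorem theorem1p6 (R : realType) (rho : \bar R) (f : qfun R) (p : quat R)
    (rho_gt0 : (0%:E < rho)%E)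
    (f_semiregular : semiregular (qball rho) f) (p_in_ball : qball rho p) :
  let m := ord f p in
  let n := ord f (qconj p) in
  let P := star (starpow (lin p) m) (starpow (lin (qconj p)) n) in
  let factors (g : qfun R) :=
    semiregular (qball rho) g /\
    is_star_prod rho (lquot rho P star1) g f in
  exists g : qfun R,
    [/\ factors g,
        (forall g' : qfun R, factors g' -> qfun_eq g' g),
        regular_near g p /\ regular_near g (qconj p) &
        p != qconj p ->
          ((0 < m)%N -> g p != 0) /\ ((0 < n)%N -> g (qconj p) != 0)].
Proof.
move=> m n P factors; have [dp dp' nz] := quot_at_pole f_semiregular p_in_ball.
exists (quot rho f p); split=> //.
- split; first exact: quot_semiregular.
  exact: quot_star_prod.
- by move=> g [g_sr gf]; exact: quot_unique.
- by split; exists (dom (quot rho f p)); split=> //; exact: quot_regular.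
Qed.
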